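(* Let $V:\mathbb{R}^d\times\mathcal{G}\to\mathbb{R}$ be differentiable in $x$, let $W\in W^{1,2}_{loc}(\mathbb{R}^d)$ with $\int_{\mathbb{R}^d}|x|^2e^{-W}dx<\infty$, and let $\lambda,\Lambda,\lambda',\Lambda'$ be positive constants with $$\lambda'e^{-W(x)}\le e^{-V(x,g)}\le\Lambda'e^{-W(x)}\qquad\text{for all }(x,g).$$ Then there exists $\tau_0\in(0,1/2)$, depending only on $\lambda,\Lambda,\lambda',\Lambda'$ (for the fixed graph $(\mathcal{G},K)$), such that the following holds for every $\tau\in(0,\tau_0)$. Let $\mu\in\mathcal{P}_2(\mathbb{R}^d\times\mathcal{G})$ satisfy $\mathcal{E}(\mu)<\infty$ and have density $f$ with $\lambda e^{-V}\le f\le\Lambda e^{-V}$, let $\mu_\tau$, with density $f_\tau$, be a minimizer over $\sigma\in\mathcal{P}_2(\mathbb{R}^d\times\mathcal{G})$ of $\mathcal{E}(\sigma)+\mathcal{A}^{\mathcal{G},W,\tau}(\mu,\sigma)$, and let $(\gamma_\tau,h_\tau)\in Opt(\mu,\mu_\tau)$. Then: (i) For each $g\in\mathcal{G}$ the optimal transport plan $\gamma_{\tau,g}$ is given by $$\gamma_{\tau,g}=(S_g,\mathrm{Id})_{\#}\Big(f_{\tau,g}+\tau\sum_{g'}h_{\tau,gg'}K(g,g')e^{-W}\Big),$$ where the corresponding optimal transport map $S_g:\mathbb{R}^d\to\mathbb{R}^d$ satisfies $$\frac{S_g(y)-y}{\tau}f_\tau(y,g)=\nabla_xf_\tau(y,g)+f_\tau(y,g)\nabla_xV(y,g)\qquad\text{for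 almost every }y\in\mathbb{R}^d.$$ (ii) For each pair $g,g'$ with $K(g,g')>0$ and almost every $x\in\mathbb{R}^d$, $$h_{\tau,gg'}(x)=\log f_\tau(x,g)+V(x,g)-\log f_\tau(x,g')-V(x,g').$$
   Context: $\mathcal{G}$ is a finite set and $K:\mathcal{G}\times\mathcal{G}\to[0,\infty)$ is symmetric; $(\mathcal{G},K)$ is connected, i.e. any $g,g'$ are joined by a path $g_0=g,\dots,g_m=g'$ with $K(g_l,g_{l+1})>0$. $dg$ is counting measure on $\mathcal{G}$; $\mathcal{P}_2(\mathbb{R}^d\times\mathcal{G})$ is the set of Borel probability measures with finite second moment. Every such $\mu$ is written $\mu=\sum_g\mu_g\otimes\delta_g$ with $\mu_g$ positive measures on $\mathbb{R}^d$. Densities are with respect to $dx\,dg$, $f_g(x)=f(x,g)$, and absolutely continuous measures on $\mathbb{R}^d$ are identified with their densities. Relative entropy: $\mathcal{E}(\mu)=\sum_g\int_{\mathbb{R}^d}(f\log f+Vf)(x,g)\,dx$ if $d\mu=f\,dx\,dg$, and $+\infty$ otherwise. Static cost: $ADM(\mu,\sigma)$ is the set of pairs $(\gamma,h)$ where (1) $\gamma=\{\gamma_g\}_{g\in\mathcal{G}}$, each $\gamma_g$ a positive Borel measure on $\mathbb{R}^d\times\mathbb{R}^d$ with first marginal $\pi_{1\#}\gamma_g=\mu_g$; (2) $h=(h_{gg'}(x)):\mathbb{R}^d\times\mathcal{G}\times\mathcal{G}\to\mathbb{R}$ satisfies $h_{gg'}=-h_{g'g}$ and $\sum_{g,g'}\int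 h_{gg'}^2e^{-W}K(g,g')dx<\infty$; (3) for every $g$, $\sigma_g=\pi_{2\#}\gamma_g-\tau\sum_{g'}h_{gg'}(x)K(g,g')e^{-W(x)}dx$. Set $$C_\tau(\gamma,h)=\sum_g\frac1{2\tau}\int_{\mathbb{R}^d\times\mathbb{R}^d}|x-x'|^2d\gamma_g(x,x')+\frac{\tau}{4}\sum_{g,g'}\int_{\mathbb{R}^d}h_{gg'}^2K(g,g')e^{-W}dx,$$ and $\mathcal{A}^{\mathcal{G},W,\tau}(\mu,\sigma)=\inf_{ADM(\mu,\sigma)}C_\tau$, with $\inf\emptyset=+\infty$. $Opt(\mu,\sigma)$ is the set of minimizers when this infimum is finite. For $(\gamma,h)\in Opt(\mu,\sigma)$ each $\gamma_g$ is an optimal plan for the cost $|x-y|^2/(2\tau)$ between its marginals. *)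

(* Defs.v *)
From HB Require Import structures.
From mathcomp Require Import all_boot all_order all_algebra.
From mathcomp Require Import all_classical all_reals all_analysis.
From mathcomp Require Import measurable_realfun lra.

Set Implicit Arguments.
Unset Strict Implicit.
Unset Printing Implicit Defensive.
Import Order.TTheory GRing.Theory Num.Theory.
Import numFieldNormedType.Exports.

Local Open Scope classical_set_scope.
Local Open Scope ring_scope.

(* [R^d] is ['rV[R]_d].  The norm [`|x|] of the library on it is the sup norm,
   which serves for topology and differentiation only; all transport costs and
   moments use the Euclidean [sqnorm] below. *)
HB.instance Definition _ (R : realType) (m n : nat) :=
  @isMeasurable.Build (sigma_display (@open 'M[R]_(m, n))) 'M[R]_(m, n)
    <<s @open 'M[R]_(m, n) >> (@sigma_algebra0 _ setT _)
    (@sigma_algebraC 'M[R]_(m, n) _) (@sigma_algebra_bigcup _ setT _).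

Section lebesgue_rV.
Context {R : realType}.

Lemma borel_rV_open m n (U : set 'M[R]_(m, n)) : open U -> measurable U.
Proof. exact: sub_sigma_algebra. Qed.

Definition cons_rV (n : nat) (p : measurableTypeR R * 'rV[R]_n) : 'rV[R]_n.+1 :=
  row_mx (p.1%:M : 'rV[R]_1) p.2.

Lemma cons_rV_ball n (x y : R) (v w : 'rV[R]_n) e :
  ball x e y -> ball v e w -> ball (cons_rV (x, v)) e (cons_rV (y, w)).
Proof.
move=> xy vw.
have e0 : 0 < e by case: vw.
split => // i j; rewrite ord1 {i}.
case: (@splitP 1 n j) => k jk.
  have -> : j = @lshift 1 n k by apply: val_inj.
  by rewrite !(@row_mxEl R 1 1 n) !mxE (ord1 k) eqxx !mulr1n.
have -> : j = @rshift 1 n k by apply: val_inj.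
by rewrite !(@row_mxEr R 1 1 n); case: vw.
Qed.

Lemma rat_dense_ball (x e : R) : 0 < e -> exists q : rat, ball (ratr q : R) e x.
Proof.
move=> e0; have /rat_in_itvoo[q] : x < x + e by rewrite ltrDl.
rewrite in_itv/= => /andP[xq qe]; exists q.
by rewrite /ball/= ltr_norml; apply/andP; split; lra.
Qed.

Lemma rat_dense_ball_rV n (v : 'rV[R]_n) (e : R) : 0 < e ->
  exists w : 'rV[rat]_n, ball (map_mx ratr w : 'rV[R]_n) e v.
Proof.
move=> e0; have /choice[w wP] i := rat_dense_ball (v ord0 i) e0.
by exists (\row_i w i); split => // i j; rewrite ord1 !mxE.
Qed.

Lemma cons_rV_preimage_open n (U : set 'rV[R]_n.+1) :
  open U -> measurable (@cons_rV n @^-1` U).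
Proof.
move=> oU.
pose B (i : rat * 'rV[rat]_n * nat) : set (measurableTypeR R * 'rV[R]_n) :=
  ball (ratr i.1.1 : R) i.2.+1%:R^-1 `*`
  ball (map_mx ratr i.1.2 : 'rV[R]_n) i.2.+1%:R^-1.
pose F i := if `[< B i `<=` @cons_rV n @^-1` U >] then B i else set0.
have -> : @cons_rV n @^-1` U = \bigcup_(i in setT) F i.
  apply/seteqP; split=> [[x v] /= Uxv|p [i _]]; last first.
    by rewrite /F; case: asboolP => // + Bp; apply.
  have /nbhs_ballP[e /= e0 eU] := open_nbhs_nbhs (conj oU Uxv).
  have [k] : exists k, 0 + k.+1%:R^-1 < e / 2 by apply: ltr_add_invr; lra.
  rewrite add0r => ke.
  have k0 : 0 < k.+1%:R^-1 :> R by rewrite invr_gt0.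
  have [q xq] := rat_dense_ball x k0.
  have [w vw] := rat_dense_ball_rV v k0.
  exists (q, w, k) => //; rewrite /F; case: asboolP => // -[].
  move=> [y u] [/= yq uw]; apply: eU.
  have le_ke := ltW ke; apply: cons_rV_ball.
    by apply: (@ball_splitr _ R (ratr q)); exact: le_ball le_ke _ _.
  by apply: (@ball_splitr _ 'rV[R]_n (map_mx ratr w)); exact: le_ball le_ke _ _.
apply: countable_bigcupT_measurable => // i; rewrite /F.
case: asboolP => // _; apply: measurableX.
  by apply: open_measurable; exact: ball_open.
by apply: borel_rV_open; exact: ball_open.
Qed.

Lemma measurable_cons_rV n : measurable_fun setT (@cons_rV n).
Proof.
apply: (@measurability _ _ _ _ _ _ (@open 'rV[R]_n.+1)) => //.
by move=> _ [U oU <-]; rewrite setTI; exact: cons_rV_preimage_open.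
Qed.

(* Lebesgue measure on [R^n], as the iterated product of the one on [R]. *)
Section step.
Variables (n : nat) (m : {sigma_finite_measure set 'rV[R]_n -> \bar R}).

Definition lebesgue_rV_step : set 'rV[R]_n.+1 -> \bar R :=
  pushforward (lebesgue_measure \x m)%E (@cons_rV n).

Let mcons := @measurable_cons_rV n.

HB.instance Definition _ := Measure.copy lebesgue_rV_step
  (measure_function_pushforward__canonical__measure_function_Measure
     (lebesgue_measure \x m)%E mcons).

Let uncons (x : 'rV[R]_n.+1) : measurableTypeR R * 'rV[R]_n :=
  (x ord0 ord0, \row_j x ord0 (lift ord0 j)).

Let uncons_cons p : uncons (cons_rV p) = p.
Proof.
case: p => x v; congr pair.
  have -> : ord0 = @lshift 1 n ord0 by exact: val_inj.
  by rewrite [LHS](@row_mxEl R 1 1 n) mxE.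
apply/rowP => j; rewrite mxE.
have -> : lift ord0 j = @rshift 1 n j by exact: val_inj.
exact: (@row_mxEr R 1 1 n).
Qed.

Let measurable_uncons : measurable_fun setT uncons.
Proof.
apply/measurable_fun_pairP; split.
  apply: (@measurability _ _ _ _ _ _ (@RGenOpens.G R)).
    exact: RGenOpens.measurableE.
  move=> _ [_ [a [b ->]] <-]; rewrite setTI; apply: borel_rV_open.
  apply: (@open_comp _ _ (fun x : 'rV[R]_n.+1 => x ord0 ord0)) => //.
  by move=> x _; exact: coord_continuous.
apply: (@measurability _ _ _ _ _ _ (@open 'rV[R]_n)) => //.
move=> _ [U oU <-]; rewrite setTI; apply: borel_rV_open.
apply: (@open_comp _ _ (fun x : 'rV[R]_n.+1 => \row_j x ord0 (lift ord0 j))) => //.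
move=> x _ A /nbhs_ballP[e /= e0 eA]; apply/nbhs_ballP; exists e => // y xy.
by apply: eA; split => // i j; rewrite !mxE; case: xy.
Qed.

Let sigma_finite_step : sigma_finite setT lebesgue_rV_step.
Proof.
have /sigma_finiteP[F [TF ndF Foo]] :=
  sigma_finiteT (@lebesgue_measure R : {sigma_finite_measure set _ -> \bar R}).
have /sigma_finiteP[G [TG ndG Goo]] := sigma_finiteT m.
exists (fun k => uncons @^-1` (F k `*` G k)).
  rewrite -preimage_bigcup (_ : \bigcup_k _ = setT) ?preimage_setT//.
  apply/seteqP; split => // -[x y] _.
  have [k _ Fkx] : (\bigcup_k F k) x by rewrite -TF.
  have [l _ Gly] : (\bigcup_k G k) y by rewrite -TG.
  exists (maxn k l) => //; split.
    by move: x Fkx; exact/subsetPset/ndF/leq_maxl.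
  by move: y Gly; exact/subsetPset/ndG/leq_maxr.
move=> k; have [? ?] := Foo k; have [? ?] := Goo k; split.
  by rewrite -[X in measurable X]setTI; apply: measurable_uncons => //;
    exact: measurableX.
rewrite /lebesgue_rV_step /pushforward -comp_preimage.
rewrite (_ : uncons \o _ = id); last by apply/funext => p /=.
by rewrite preimage_id product_measure1E// lte_mul_pinfty// ge0_fin_numE.
Qed.

HB.instance Definition _ := Measure_isSigmaFinite.Build _ _ _ lebesgue_rV_step
  sigma_finite_step.

End step.

Fixpoint lebesgue_rV n : {sigma_finite_measure set 'rV[R]_n -> \bar R} :=
  if n is n'.+1 then lebesgue_rV_step (lebesgue_rV n')
  else \d_(0 : 'rV[R]_0).
End lebesgue_rV.

(* Nonempty finite sets: a measurable type of the library has to be pointed. *)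
#[short(type="finPointedType")]
HB.structure Definition FinPointed := {T of Finite T & Pointed T}.

(* A finite set with the discrete sigma-algebra. *)
Definition discrete_space (G : finPointedType) : Type := G.
HB.instance Definition _ (G : finPointedType) := FinPointed.on (discrete_space G).
HB.instance Definition _ (G : finPointedType) :=
  @isMeasurable.Build default_measure_display (discrete_space G)
    discrete_measurable (@discrete_measurable0 G)
    (@discrete_measurableC G) (@discrete_measurableU G).

Section calculus.
Context {R : realType} {d : nat}.
Implicit Types (x y : 'rV[R]_d) (f W : 'rV[R]_d -> R).

Definition sqnorm x : R := \sum_(i < d) x ord0 i ^+ 2.

Definition pderiv (i : 'I_d) f : 'rV[R]_d -> R :=
  fun x => 'D_(delta_mx ord0 i : 'rV[R]_d) f x.

Definition grad f x : 'rV[R]_d := \row_i pderiv i f x.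

(* [Dx] is almost everywhere the gradient of some representative of the
   almost-everywhere class of [f]. *)
Definition ae_gradient f (Df : 'rV[R]_d -> 'rV[R]_d) : Prop :=
  exists f' : 'rV[R]_d -> R,
    {ae lebesgue_rV d, forall x, f' x = f x} /\
    {ae lebesgue_rV d, forall x, differentiable f' x /\ grad f' x = Df x}.

(* All iterated partial derivatives exist and are continuous. *)
Definition smooth f : Prop :=
  forall s : seq 'I_d, let g := foldr pderiv f s in
    continuous g /\ forall i x, derivable g x (delta_mx ord0 i).

Definition test_function f : Prop :=
  smooth f /\ exists2 A : set 'rV[R]_d, compact A & forall x, ~ A x -> f x = 0.

Definition L2loc f : Prop :=
  measurable_fun setT f /\
  forall A : set 'rV[R]_d, compact A ->
    (\int[lebesgue_rV d]_(x in A) (f x ^+ 2)%:E < +oo)%E.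

Definition W12loc W : Prop :=
  L2loc W /\
  forall i : 'I_d, exists2 w : 'rV[R]_d -> R, L2loc w &
    forall phi, test_function phi ->
      (\int[lebesgue_rV d]_x (W x * pderiv i phi x)%:E =
       - \int[lebesgue_rV d]_x (w x * phi x)%:E)%E.

End calculus.

Section transport.
Context {R : realType} {d : nat}.
Notation E := 'rV[R]_d.

Definition quadratic_cost (tau : R) (pi : {measure set (E * E) -> \bar R}) : \bar R :=
  (\int[pi]_p ((2 * tau)^-1 * sqnorm (p.1 - p.2))%:E)%E.

Definition optimal_plan (tau : R) (pi : {measure set (E * E) -> \bar R}) : Prop :=
  forall pi' : {measure set (E * E) -> \bar R},
    (forall A, measurable A -> pi' (A `*` setT) = pi (A `*` setT)) ->
    (forall A, measurable A -> pi' (setT `*` A) = pi (setT `*` A)) ->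
    (quadratic_cost tau pi <= quadratic_cost tau pi')%E.

Context {G : finPointedType} (K : G -> G -> R).
Notation state := (E * discrete_space G)%type.
Implicit Types (mu sigma : probability state R).

Definition slice mu (g : G) (A : set E) : \bar R := mu (A `*` [set g : discrete_space G]).

Definition finite_second_moment mu : Prop :=
  (\int[mu]_p (sqnorm p.1)%:E < +oo)%E.

Definition is_density mu (f : E -> G -> R) : Prop :=
  [/\ forall g, measurable_fun setT (f^~ g),
      forall x g, 0 <= f x g &
      forall g A, measurable A ->
        (slice mu g A = \int[lebesgue_rV d]_(x in A) (f x g)%:E)%E].

(* The value does not depend on the density that is picked; [0 * ln 0 = 0]. *)
Definition entropy (V : E -> G -> R) mu : \bar R :=
  if pselect (exists f, is_density mu f) is left H then
    let f := sval (cid H) in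
    (\sum_(g : G) \int[lebesgue_rV d]_x
       (f x g * ln (f x g) + V x g * f x g)%:E)%E
  else +oo%E.

Definition plans := G -> {measure set (E * E) -> \bar R}.
Definition jumps := G -> G -> E -> R.

Definition jump_energy (W : E -> R) (h : jumps) : \bar R :=
  (\sum_(g : G) \sum_(g' : G) \int[lebesgue_rV d]_x
     (h g g' x ^+ 2 * K g g' * expR (- W x))%:E)%E.

Definition ADM (W : E -> R) (tau : R) mu sigma (gamma : plans) (h : jumps) : Prop :=
  [/\ forall g A, measurable A -> gamma g (A `*` setT) = slice mu g A,
      forall g g', measurable_fun setT (h g g'),
      forall g g' x, h g g' x = - h g' g x,
      (jump_energy W h < +oo)%E &
      forall g A, measurable A -> (slice sigma g A =
         gamma g (setT `*` A) - tau%:E * \sum_(g' : G)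
           \int[lebesgue_rV d]_(x in A)
             (h g g' x * K g g' * expR (- W x))%:E)%E].

Definition cost (W : E -> R) (tau : R) (gamma : plans) (h : jumps) : \bar R :=
  (\sum_(g : G) quadratic_cost tau (gamma g) + (tau / 4)%:E * jump_energy W h)%E.

Definition transport_cost (W : E -> R) (tau : R) mu sigma : \bar R :=
  ereal_inf [set c | exists gamma h,
    ADM W tau mu sigma gamma h /\ c = cost W tau gamma h].

Definition Opt (W : E -> R) (tau : R) mu sigma (gamma : plans) (h : jumps) : Prop :=
  [/\ transport_cost W tau mu sigma \is a fin_num,
      ADM W tau mu sigma gamma h &
      cost W tau gamma h = transport_cost W tau mu sigma].

Definition JKO_minimizer (V : E -> G -> R) (W : E -> R) (tau : R)
    (mu mu_tau : probability state R) : Prop :=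
  finite_second_moment mu_tau /\
  forall sigma, finite_second_moment sigma ->
    (entropy V mu_tau + transport_cost W tau mu mu_tau <=
     entropy V sigma + transport_cost W tau mu sigma)%E.

End transport.

(* Main.v *)
Require Import Defs.
From HB Require Import structures.
From mathcomp Require Import all_boot all_order all_algebra.
From mathcomp Require Import all_classical all_reals all_analysis.
From mathcomp Require Import measurable_realfun ring lra.
Import Order.TTheory GRing.Theory Num.Theory.
Import numFieldNormedType.Exports.
Local Open Scope classical_set_scope.
Local Open Scope ring_scope.

Set Implicit Arguments.
Unset Strict Implicit.
Unset Printing Implicit Defensive.

(* Let [u] be the density of the minimizer and [w := u e^V].  Perturbing the
   minimizer by an infinitesimal mass, carried either by an additional jump along an
   edge or by redirecting a part of a plan, gives first-order inequalities:
   [h g g' <= ln w_g - ln w_g'] a.e. if [0 < K g g'], and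
   [ln w(y) + |x - y|^2 / (2 tau) <= ln w(z) + |x - z|^2 / (2 tau)] for [gamma g]-almost
   every [(x, y)] and Lebesgue-almost every [z].  By antisymmetry of [h] the first one
   is (ii).  The second one with [z = x] says that transport decreases [w], while jumps
   point towards smaller [w]; hence the bounds of [f e^V] by [lam] and [Lam] pass to
   [w].  So [h] is bounded, and for small [tau] the second marginal of [gamma g] has a
   positive density.  Therefore [ln w + |.|^2 / (2 tau)] agrees a.e. with
   a supremum [psi] of affine functions of slopes [x / tau], and almost every [y] is
   a contact point with the function of slope [x / tau] for the [x] coupled to it.
   As [psi] is convex, it is differentiable a.e., so that [x = tau grad psi(y)]. *)

(** * Measures with a density, and Lebesgue measure in coordinates *)

(** The infinitesimal perturbations are realised with a small fixed [eps]. A first-order inequality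
    that fails does so with room to spare on a set of positive measure where constants control all
    quantities; there a small [eps] contradicts minimality. Rational constants leave countably many
    such sets. Entropy changes are bounded by the tangent at the perturbed density, so nothing is
    differentiated under an integral and there is no remainder to control. The obstacle is that [u]
    may vanish a priori, where [ln w] means nothing; hence the inequalities are first stated through
    [expR]. Jumps spread positivity over the connected graph, so at almost every point [u] vanishes
    at all nodes or at none. Jumps preserve the total mass at a point, so no plan ends where all
    nodes are empty. A single contact pair of [gamma g] then keeps [w] positive at [g] almost
    everywhere. The convex potential comes from the contact inequality instead of duality, and its
    differentiability almost everywhere from slopes on coordinate lines. Smallness of [tau] enters
    once, to make the second marginals of the plans positive. *)

Lemma measurable_set_ltr d (T : measurableType d) (R : realType) (f g : T -> R) :
  measurable_fun setT f -> measurable_fun setT g -> measurable [set x | f x < g x].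
Proof.
move=> mf mg; have h := measurable_fun_ltr mf mg.
by have := h measurableT [set true] I; rewrite setTI.
Qed.

Lemma measurable_set_ler d (T : measurableType d) (R : realType) (f g : T -> R) :
  measurable_fun setT f -> measurable_fun setT g -> measurable [set x | f x <= g x].
Proof.
move=> mf mg; rewrite (_ : mkset _ = ~` [set x | g x < f x]).
  by apply: measurableC; exact: measurable_set_ltr.
by apply/seteqP; split => x /=; rewrite leNgt => /negP.
Qed.

Section measures_with_density.
Context d (T : measurableType d) (R : realType).
Variable m : {sigma_finite_measure set T -> \bar R}.

Lemma density_measure (f : T -> R) : measurable_fun setT f ->
  (forall x, 0 <= f x) ->
  exists nu : {measure set T -> \bar R},
    forall A, measurable A -> nu A = (\int[m]_(x in A) (f x)%:E)%E.
Proof.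
move=> mf f0.
pose nu (A : set T) := (\int[m]_(x in A) (f x)%:E)%E.
have nu0 : nu set0 = 0%E by rewrite /nu integral_set0.
have nu_ge0 A : (0 <= nu A)%E by apply: integral_ge0 => x _; rewrite lee_fin.
have nu_add : semi_sigma_additive nu.
  move=> F mF tF mUF; rewrite /nu ge0_integral_bigcup//; last 2 first.
  - exact/measurable_EFinP/measurable_funTS.
  - by move=> x _; rewrite lee_fin.
  apply: is_cvg_ereal_nneg_natsum => n _; exact: nu_ge0.
pose mu := isMeasure.Build _ _ _ nu nu0 nu_ge0 nu_add.
pose nu' : {measure set T -> \bar R} := HB.pack nu mu.
by exists nu'.
Qed.

Lemma ge0_integral_density (nu : {measure set T -> \bar R}) (f : T -> R)
    (g : T -> \bar R) : measurable_fun setT f -> (forall x, 0 <= f x) ->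
  (nu setT < +oo)%E ->
  (forall A, measurable A -> nu A = (\int[m]_(x in A) (f x)%:E)%E) ->
  measurable_fun setT g -> (forall x, 0 <= g x)%E ->
  (\int[nu]_x g x = \int[m]_x (g x * (f x)%:E))%E.
Proof.
move=> mf f0 nuT nuE mg g0.
(* This is [nu] packaged as a finite measure, so that it has a Radon-Nikodym derivative with respect
   to [m]; that derivative is then identified with [f] almost everywhere. *)
pose nu' := mfrestr measurableT nuT.
have nu'E A : nu' A = nu A by rewrite /nu' /= /mfrestr /mrestr setIT.
have dom : nu' `<< m.
  apply/null_content_dominatesP => A mA mA0.
  rewrite [LHS]nu'E nuE//; apply: null_set_integral => //.
  exact/measurable_EFinP/measurable_funTS.
rewrite (@eq_measure_integral _ _ _ _ nu')//.
rewrite -(Radon_Nikodym_SigmaFinite.change_of_variables dom)//.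
apply: ge0_ae_eq_integral => //.
- apply: emeasurable_funM => //.
  exact: measurable_int (Radon_Nikodym_SigmaFinite.f_integrable dom).
- exact/emeasurable_funM/measurable_EFinP.
- by move=> x _; rewrite mule_ge0// Radon_Nikodym_SigmaFinite.f_ge0.
- by move=> x _; rewrite mule_ge0// lee_fin.
apply: ae_eqe_mul2l; apply: integral_ae_eq => //.
- exact: Radon_Nikodym_SigmaFinite.f_integrable.
- exact/measurable_EFinP.
move=> A _ mA; rewrite -Radon_Nikodym_SigmaFinite.f_integral//.
by rewrite [LHS]nu'E nuE.
Qed.

Lemma ge0_integral_mrestr (mu : {measure set T -> \bar R}) (D : set T)
    (mD : measurable D) (g : T -> \bar R) :
  measurable_fun setT g -> (forall x, 0 <= g x)%E ->
  (\int[mrestr mu mD]_x g x = \int[mu]_(x in D) g x)%E.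
Proof.
move=> mg g0; rewrite (@ge0_negligible_integral _ _ _ _ setT (~` D))//.
- rewrite setDE setTI setCK; apply: eq_measure_integral => A mA AD.
  by rewrite /= /mrestr setIidl.
- exact: measurableC.
- by rewrite /= /mrestr setICl measure0.
Qed.
End measures_with_density.

Lemma negligible_countable d (T : measurableType d) (R : realType)
    (m : {measure set T -> \bar R}) (I : countType) (F : I -> set T) :
  (forall i, m.-negligible (F i)) -> m.-negligible (\bigcup_i F i).
Proof.
move=> H; pose E n := if unpickle n is Some i then F i else set0.
apply: (@negligibleS _ _ _ _ (\bigcup_n E n)); last first.
  apply: negligible_bigcup => n; rewrite /E.
  by case: unpickle => // *; exact: negligible_set0.
by move=> x [i _ Fx]; exists (pickle i) => //; rewrite /E pickleK.
Qed.

Section euclidean.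
Context {R : realType} {d : nat}.
Implicit Types x y : 'rV[R]_d.

Lemma measurable_cont_rV (f : 'rV[R]_d -> R) : continuous f ->
  measurable_fun setT f.
Proof.
move=> cf; apply: (@measurability _ _ _ _ _ _ (@RGenOpens.G R)).
  exact: RGenOpens.measurableE.
move=> _ [_ [a [b ->]] <-]; rewrite setTI; apply: borel_rV_open.
by apply: open_comp => // x _; exact: cf.
Qed.

Lemma measurable_coord (i : 'I_d) : measurable_fun setT (fun x => x ord0 i).
Proof. by apply: measurable_cont_rV => x; exact: coord_continuous. Qed.

Lemma sqnorm_ge0 x : 0 <= sqnorm x.
Proof. by apply: sumr_ge0 => i _; exact: sqr_ge0. Qed.

Lemma measurable_sqnorm : measurable_fun setT (@sqnorm R d).
Proof.
apply: measurable_sum => i; apply: measurable_funX; exact: measurable_coord.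
Qed.

Lemma measurable_sqnormB :
  measurable_fun setT (fun p : 'rV[R]_d * 'rV[R]_d => sqnorm (p.1 - p.2)).
Proof.
apply: measurable_sum => i; apply: measurable_funX.
under eq_fun do rewrite !mxE.
apply: measurable_funB.
- exact: (measurableT_comp (measurable_coord i) measurable_fst).
- exact: (measurableT_comp (measurable_coord i) measurable_snd).
Qed.

Lemma ball_rVP x y e : 0 < e ->
  ball x e y <-> forall i, `|x ord0 i - y ord0 i| < e.
Proof.
move=> e0; split=> [[_ xy] i|xy]; first exact: xy.
by split => // i j; rewrite ord1; exact: xy.
Qed.

End euclidean.

Lemma lebesgue_rV_cons (R : realType) n (A : set 'rV[R]_n.+1) :
  lebesgue_rV n.+1 A = (lebesgue_measure \x lebesgue_rV n)%E (@cons_rV R n @^-1` A).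
Proof. by []. Qed.

Lemma lebesgue_rV_ball_gt0 (R : realType) n (x : 'rV[R]_n) e : 0 < e ->
  (0 < lebesgue_rV n (ball x e))%E.
Proof.
move=> e0; elim: n => [|n IH] in x *.
  rewrite /= diracE mem_set//= ?lte_fin//.
  by apply/ball_rVP => // -[].
pose t := x ord0 ord0; pose v : 'rV[R]_n := \row_j x ord0 (lift ord0 j).
have xE : x = cons_rV (t, v).
  apply/rowP => j; case: (@splitP 1 n j) => k jk.
    have -> : j = @lshift 1 n k by apply: val_inj.
    rewrite (@row_mxEl R 1 1 n) !mxE (ord1 k) eqxx mulr1n /t.
    by congr (x _ _); apply: val_inj.
  have -> : j = @rshift 1 n k by apply: val_inj.
  rewrite (@row_mxEr R 1 1 n) mxE.
  by congr (x _ _); apply: val_inj.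
rewrite lebesgue_rV_cons.
have sub : (ball t e `*` ball v e) `<=` (@cons_rV R n @^-1` ball x e).
  by move=> [s w] [/= ts vw]; rewrite xE; exact: cons_rV_ball.
have m1 : measurable (ball t e : set (measurableTypeR R)).
  by apply: open_measurable; exact: ball_open.
have m2 : measurable (ball v e).
  by apply: borel_rV_open; exact: ball_open.
have mm : measurable (@cons_rV R n @^-1` ball x e).
  by apply: cons_rV_preimage_open; exact: ball_open.
apply: (@lt_le_trans _ _ ((lebesgue_measure \x lebesgue_rV n)%E (ball t e `*` ball v e))).
  rewrite product_measure1E//; apply: mule_gt0; last exact: IH.
  rewrite [X in (_ < X)%E](_ : _ = lebesgue_measure (ball t e))//.
  by rewrite lebesgue_measure_ball ?lte_fin ?mulrn_wgt0// ltW.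
by apply: le_measure; rewrite ?inE//; exact: measurableX.
Qed.

(** Balls have positive measure. This is how an inequality between continuous functions passes from
    almost every point to every point. *)
Lemma lebesgue_rV_dense (R : realType) n (M : set 'rV[R]_n) (x : 'rV[R]_n) e : 0 < e ->
  (lebesgue_rV n).-negligible M -> exists2 y, ball x e y & ~ M y.
Proof.
move=> e0 Mn; apply: contrapT => /forall2NP H.
have : (lebesgue_rV n).-negligible (ball x e).
  by apply: negligibleS Mn => y xy; have [//|/contrapT] := H y.
have mb : measurable (ball x e) by apply: borel_rV_open; exact: ball_open.
by move/(negligibleP _ mb); apply/eqP; rewrite gt_eqF//; exact: lebesgue_rV_ball_gt0.
Qed.

Lemma cons_rV0 (R : realType) n (p : R * 'rV[R]_n) :
  cons_rV (p : measurableTypeR R * _) ord0 ord0 = p.1.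
Proof.
have -> : ord0 = @lshift 1 n ord0 by exact: val_inj.
by rewrite [LHS](@row_mxEl R 1 1 n) !mxE eqxx mulr1n.
Qed.

Lemma cons_rVS (R : realType) n (p : R * 'rV[R]_n) j :
  cons_rV (p : measurableTypeR R * _) ord0 (lift ord0 j) = p.2 ord0 j.
Proof.
have -> : lift ord0 j = @rshift 1 n j by exact: val_inj.
by rewrite [LHS](@row_mxEr R 1 1 n).
Qed.

(** Fubini for a set that meets each line parallel to axis [i] in at most one point. If [i] is not
    the first coordinate, the slices at a fixed first coordinate are null by induction; if it is,
    the first coordinate is integrated first, over sections with at most one point. *)
Lemma lebesgue_rV_line (R : realType) n (i : 'I_n) (A : set 'rV[R]_n) :
  measurable A ->
  (forall x y, A x -> A y -> (forall j, j != i -> x ord0 j = y ord0 j) ->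
     x ord0 i = y ord0 i) ->
  lebesgue_rV n A = 0%E.
Proof.
elim: n => [|n IH] in i A *; first by case: i.
move=> mA H; rewrite lebesgue_rV_cons.
set B := _ @^-1` A; have mB : measurable B.
  by rewrite -[X in measurable X]setTI; apply: measurable_cons_rV.
case: (unliftP ord0 i) H => [k ->|->] H.
- rewrite /product_measure1 integral0_eq// => s _.
  apply: (IH k); first exact: measurable_xsection.
  move=> v w /xsectionP Av /xsectionP Aw vw; have := H _ _ Av Aw.
  rewrite !cons_rVS; apply => j; case: (unliftP ord0 j) => [l ->|->].
    by rewrite (inj_eq lift_inj) !cons_rVS; exact: vw.
  by rewrite !cons_rV0.
rewrite -[B]setIT -integral_indic// (@fubini_tonelli2 _ _ _ _ _ _ _ (EFin \o \1_B))//; last 2 first.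
- exact/measurable_EFinP.
- by move=> z; rewrite lee_fin.
rewrite integral0_eq// => v _.
rewrite /fubini_G/= (_ : (fun x => _) = (EFin \o \1_(ysection B v))); last first.
  by apply/funext => s /=; rewrite !indicE mem_ysection.
rewrite integral_indic ?setIT//; last exact: measurable_ysection.
have [->|/set0P[s Bs]] := eqVneq (ysection B v) set0; first exact: measure0.
apply: (@countable_lebesgue_measure0 R); apply: (sub_countable _ (countable1 s)).
apply: subset_card_le => t; move: Bs => /ysectionP As /ysectionP At /=.
have := H _ _ At As; rewrite !cons_rV0; apply => j.
by case: (unliftP ord0 j) => [l ->|->]; rewrite ?eqxx// !cons_rVS.
Qed.

(** * Measures on the product of [R^d] with the nodes *)

Section states.
Context {R : realType} {d : nat} {G : finPointedType}.
Notation state := ('rV[R]_d * discrete_space G)%type.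

Lemma measurable_at_node (g : G) :
  measurable_fun setT (fun x : 'rV[R]_d => (x, g) : state).
Proof. exact: measurable_fun_pair (@measurable_id _ _ _) (measurable_cst _). Qed.

Lemma integral_state (mu : probability state R) (f : 'rV[R]_d -> G -> R)
    (F : 'rV[R]_d -> \bar R) : is_density mu f -> measurable_fun setT F ->
  (forall x, 0 <= F x)%E ->
  (\int[mu]_p F p.1 = \sum_(g : G) \int[lebesgue_rV d]_x (F x * (f x g)%:E))%E.
Proof.
case=> mf f0 fE mF F0.
have mG (g : G) : measurable (setT `*` [set g] : set state).
  by apply: measurableX.
have -> : [set: state] = \big[setU/set0]_(g <- enum G) (setT `*` [set g : discrete_space G]).
  rewrite -bigcup_seq; apply/seteqP; split=> // -[x g] _; exists g => //=.
  by rewrite mem_enum.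
rewrite ge0_integral_bigsetU//=; last 3 first.
- exact: enum_uniq.
- move=> g g' _ _ [[x k] [[_ /= ->] [_ /= ->]]]//.
- apply: measurable_funTS; exact: measurableT_comp.
rewrite big_enum/=; apply: eq_bigr => g _.
rewrite -(ge0_integral_mrestr _ (mG g))//; last exact: measurableT_comp.
pose nu := pushforward (mrestr mu (mG g)) (@fst 'rV[R]_d (discrete_space G)).
transitivity (\int[nu]_x F x)%E.
  by rewrite ge0_integral_pushforward.
have nuE A : measurable A -> nu A = (\int[lebesgue_rV d]_(x in A) (f x g)%:E)%E.
  move=> mA; rewrite -fE// /nu/= /pushforward /mrestr /slice; congr (mu _).
  by apply/seteqP; split=> [[x k] [/= ? [_ ->]]|[x k] [/= ? ->]].
apply: ge0_integral_density => //.
have := nuE _ measurableT; rewrite -fE// => nuT.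
rewrite [X in (X < _)%E]nuT /slice (le_lt_trans (probability_le1 _ _)) ?ltry//.
Qed.

(** Turns a perturbed density into a competitor: the sum over the nodes of the measures of density
    [u^~ g], pushed forward to the copy of [R^d] at [g]. *)
Lemma probability_of_density (u : 'rV[R]_d -> G -> R) :
  (forall g, measurable_fun setT (u^~ g)) -> (forall x g, 0 <= u x g) ->
  (\sum_(g : G) \int[lebesgue_rV d]_x (u x g)%:E = 1)%E ->
  exists sigma : probability state R, is_density sigma u.
Proof.
move=> mu_ u0 u1.
have /choice[nu nuE] g := density_measure (lebesgue_rV d) (mu_ g) (u0^~ g).
pose node k : G := nth point (enum G) k.
pose m k : {measure set state -> \bar R} :=
  measure_function_pushforward__canonical__measure_function_Measure
    (nu (node k)) (measurable_at_node (node k)).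
pose sigma0 : {measure set state -> \bar R} := msum m (size (enum G)).
have sigma0E A : sigma0 A = (\sum_(g : G) nu g [set x | A (x, g)])%E.
  rewrite /sigma0 /= /msum -[RHS]big_enum/= (big_nth point) big_mkord.
  by apply: eq_bigr.
have sigma1 : sigma0 setT = 1%E.
  rewrite sigma0E -u1; apply: eq_bigr => g _.
  by rewrite -nuE.
pose p := Measure_isProbability.Build _ _ _ (Measure.sort sigma0) sigma1.
pose sigma : probability state R := HB.pack (Measure.sort sigma0) p.
exists sigma; split => // g A mA.
rewrite /slice [LHS]sigma0E (bigD1 g)//= [X in (_ + X)%E]big1 ?adde0.
  rewrite -nuE//; congr (nu _ _); apply/seteqP; split => [x [] //|x Ax]; by split.
move=> g' /eqP g'g; rewrite (_ : [set _ | _] = set0) ?measure0//.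
by apply/seteqP; split => // x [_ /= /g'g].
Qed.
End states.

(** * Suprema of affine functions *)

Section supremum_of_affine_functions.
Context {R : realType} {d : nat}.
Implicit Types (x y z v w : 'rV[R]_d) (psi : 'rV[R]_d -> R).

Definition dotp x y : R := \sum_(i < d) x ord0 i * y ord0 i.

Lemma dotp_linear x : linear (dotp x).
Proof.
move=> k y z; rewrite /dotp scaler_sumr -big_split/=; apply: eq_bigr => i _.
by rewrite !mxE mulrDr mulrCA.
Qed.

Lemma dotpD x y z : dotp x (y + z) = dotp x y + dotp x z.
Proof. by have := dotp_linear x 1 y z; rewrite !scale1r. Qed.

Lemma dotpZ x k y : dotp x (k *: y) = k * dotp x y.
Proof.
by rewrite /dotp mulr_sumr; apply: eq_bigr => i _; rewrite mxE mulrCA.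
Qed.

Lemma dotp_delta x i : dotp x (delta_mx ord0 i) = x ord0 i.
Proof.
rewrite /dotp (bigD1 i)//= mxE !eqxx mulr1 big1 ?addr0// => j ji.
by rewrite mxE (negbTE ji) andbF mulr0.
Qed.

Lemma sqnormB x y : sqnorm (x - y) = sqnorm x - 2 * dotp x y + sqnorm y.
Proof.
rewrite /sqnorm /dotp mulr_sumr -sumrB -big_split/=; apply: eq_bigr => i _.
by rewrite !mxE; ring.
Qed.

Lemma continuous_dotp x : continuous (dotp x).
Proof.
move=> y; apply: differentiable_continuous.
rewrite (_ : dotp x = \sum_(i < d) (fun z : 'rV[R]_d => x ord0 i * z ord0 i)); last first.
  by apply/funext => z; rewrite fct_sumE.
apply: differentiable_sum => i.
by apply: differentiableM => //; exact: differentiable_coord.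
Qed.

Lemma differentiable_sqnorm x : differentiable (@sqnorm R d) x.
Proof.
rewrite (_ : @sqnorm R d = \sum_(i < d) (fun z : 'rV[R]_d => z ord0 i ^+ 2)); last first.
  by apply/funext => z; rewrite fct_sumE.
apply: differentiable_sum => i; under eq_fun do rewrite expr2.
by apply: differentiableM; exact: differentiable_coord.
Qed.

(** Convexity of a finite function, in the form in which the potential is produced. The minorants
    give Jensen's inequality for finite families and Borel measurability directly. *)
Definition affine_sup psi := forall z e, 0 < e -> exists x r,
  (forall w, dotp x w + r <= psi w) /\ psi z - e < dotp x z + r.

Variables (psi : 'rV[R]_d -> R) (psi_sup : affine_sup psi).

(** An affine minorant that nearly touches [psi] at the barycentre commutes with the average. *)
Lemma affine_sup_jensen (I : finType) (c : I -> R) (z : I -> 'rV[R]_d) :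
  (forall i, 0 <= c i) -> \sum_i c i = 1 ->
  psi (\sum_i c i *: z i) <= \sum_i c i * psi (z i).
Proof.
move=> c0 c1; apply/ler_addgt0Pr => e e0.
have [x [r [xr]]] := psi_sup (\sum_i c i *: z i) e0.
rewrite ltrBlDr => /ltW /le_trans; apply; rewrite lerD2r.
have -> : dotp x (\sum_i c i *: z i) + r = \sum_i c i * (dotp x (z i) + r).
  under [RHS]eq_bigr do rewrite mulrDr.
  rewrite big_split/= -mulr_suml c1 mul1r; congr (_ + _).
  pose f := HB.pack_for {linear 'rV[R]_d -> R} (dotp x)
    (GRing.isLinear.Build _ _ _ _ _ (dotp_linear x)).
  rewrite -[dotp x _]/(f _) raddf_sum; apply: eq_bigr => i _.
  by rewrite /f/= dotpZ.
by apply: ler_sum => i _; rewrite ler_wpM2l.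
Qed.

Lemma affine_sup_convex t x y : 0 <= t <= 1 ->
  psi (t *: x + (1 - t) *: y) <= t * psi x + (1 - t) * psi y.
Proof.
move=> /andP[t0 t1].
have := @affine_sup_jensen bool (fun b => if b then t else 1 - t)
  (fun b => if b then x else y).
rewrite !big_bool/=; apply; last by ring.
by case=> //; rewrite subr_ge0.
Qed.

(** The sets where [psi] exceeds a level are unions of open sets, one for each affine minorant. *)
Lemma measurable_affine_sup : measurable_fun setT psi.
Proof.
apply: (@measurability _ _ _ _ _ _ (@RGenOInfty.G R)).
  exact: RGenOInfty.measurableE.
move=> _ [_ [a ->] <-]; rewrite setTI; apply: borel_rV_open.
rewrite (_ : _ @^-1` _ = \bigcup_(p in [set p : 'rV[R]_d * R |
    forall w, dotp p.1 w + p.2 <= psi w]) [set w | a < dotp p.1 w + p.2]).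
  apply: bigcup_open => p _.
  rewrite (_ : mkset _ = (fun w => dotp p.1 w + p.2) @^-1` [set u | a < u])//.
  apply: open_comp => [w _|]; last exact: open_gt.
  by apply: (@continuousD _ _ _ (dotp p.1) (cst p.2));
    [exact: continuous_dotp|exact: cst_continuous].
apply/seteqP; split=> z /=; rewrite in_itv/= andbT.
  move=> az; have [|x [r [xr]]] := psi_sup z (e := psi z - a).
    by rewrite subr_gt0.
  by rewrite opprB addrCA subrr addr0 => arz; exists (x, r).
by move=> [p /= pP ap]; exact: lt_le_trans (pP z).
Qed.

Let slope v y (t : R) := (psi (y + t *: v) - psi y) / t.

Lemma slope_le v y s t : 0 < s <= t -> slope v y s <= slope v y t.
Proof.
move=> /andP[s0 st]; have t0 : 0 < t by apply: lt_le_trans st.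
rewrite /slope ler_pdivrMr// mulrAC ler_pdivlMr//.
have t01 : 0 <= s / t <= 1 by rewrite divr_ge0 ?(ltW s0) ?(ltW t0)//= ler_pdivrMr// mul1r.
have := @affine_sup_convex (s / t) (y + t *: v) y t01.
have -> : (s / t) *: (y + t *: v) + (1 - s / t) *: y = y + s *: v.
  rewrite scalerDr scalerA divfK ?gt_eqF// addrAC -scalerDl.
  by rewrite (addrC (s / t)) subrK scale1r.
rewrite -(ler_pM2r t0) mulrDl => H.
have -> : (psi (y + t *: v) - psi y) * s =
    s / t * psi (y + t *: v) * t + (1 - s / t) * psi y * t - psi y * t.
  by field; rewrite gt_eqF.
by lra.
Qed.

(** The point [y] is a convex combination of one point on each side. This keeps the infimum in
    [dir_deriv] finite. *)
Lemma slope_ge v y s t : 0 < s -> 0 < t -> - slope (- v) y s <= slope v y t.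
Proof.
move=> s0 t0; have st0 : 0 < s + t by rewrite addr_gt0.
have t01 : 0 <= s / (s + t) <= 1.
  by rewrite divr_ge0 ?(ltW s0) ?(ltW st0)//= ler_pdivrMr// mul1r lerDl ltW.
have := @affine_sup_convex (s / (s + t)) (y + t *: v) (y + s *: - v) t01.
have e1 : 1 - s / (s + t) = t / (s + t) by field; rewrite gt_eqF.
have -> : (s / (s + t)) *: (y + t *: v) + (1 - s / (s + t)) *: (y + s *: - v) = y.
  rewrite e1 !scalerDr addrACA -scalerDl -mulrDl divff ?gt_eqF// scale1r.
  rewrite scalerN scalerA scalerN scalerA -scalerBl.
  by rewrite (_ : s / (s + t) * t - t / (s + t) * s = 0) ?scale0r ?addr0//; ring.
rewrite e1 -(ler_pM2r st0) mulrDl.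
have -> : s / (s + t) * psi (y + t *: v) * (s + t) = s * psi (y + t *: v).
  by field; rewrite gt_eqF.
have -> : t / (s + t) * psi (y + s *: - v) * (s + t) = t * psi (y + s *: - v).
  by field; rewrite gt_eqF.
move=> H; rewrite /slope -mulNr ler_pdivrMr// mulrAC ler_pdivlMr//.
by lra.
Qed.

(** The one-sided derivative of [psi] at [y] in direction [v]. Slopes increase with the step, so the
    steps [1 / (n + 1)] suffice, and a countable infimum is measurable. *)
Definition dir_deriv v y : R := inf (range (fun n => slope v y n.+1%:R^-1)).

Let slope_lb v y : has_lbound (range (fun n => slope v y n.+1%:R^-1)).
Proof.
exists (- slope (- v) y 1) => _ [n _ <-]; exact: slope_ge.
Qed.

Lemma dir_deriv_le v y t : 0 < t -> dir_deriv v y <= slope v y t.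
Proof.
move=> t0; have [n nt] : exists n, 0 + n.+1%:R^-1 < t by apply: ltr_add_invr.
rewrite add0r in nt.
apply: (@le_trans _ _ (slope v y n.+1%:R^-1)).
  by apply: (ge_inf (slope_lb v y)); exists n.
by apply: slope_le; rewrite invr_gt0 ltr0n/= ltW.
Qed.

Lemma dir_deriv_ge v y c : (forall t, 0 < t -> c <= slope v y t) ->
  c <= dir_deriv v y.
Proof.
move=> H; apply: lb_le_inf; first by exists (slope v y 1); exists 0%N => //; rewrite invr1.
by move=> _ [n _ <-]; apply: H; rewrite invr_gt0.
Qed.

Lemma dir_deriv_near v y e : 0 < e -> exists2 del, 0 < del &
  forall t, 0 < t < del -> slope v y t <= dir_deriv v y + e.
Proof.
move=> e0; have hi : has_inf (range (fun n => slope v y n.+1%:R^-1)).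
  by split; [exists (slope v y 1), 0%N; rewrite ?invr1|exact: slope_lb].
have [_ [n _ <-] sn] := inf_adherent e0 hi.
exists n.+1%:R^-1; first by rewrite invr_gt0.
move=> t /andP[t0 tn]; rewrite ltW// (le_lt_trans _ sn)//.
by apply: slope_le; rewrite t0 ltW.
Qed.

Lemma measurable_dir_deriv v : measurable_fun setT (dir_deriv v).
Proof.
have := @measurable_fun_infs _ _ R setT
  (fun n y => slope v y n.+1%:R^-1) 0 (fun y _ => slope_lb v y).
rewrite (_ : (fun y => _) = dir_deriv v); last first.
  apply/funext => y; rewrite /infs/= /sdrop /dir_deriv; congr inf.
  by apply/seteqP; split=> _ [n _ <-]; exists n.
apply=> n; rewrite /slope; apply: measurable_funM => //.
apply: measurable_funB; last exact: measurable_affine_sup.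
apply: measurableT_comp; first exact: measurable_affine_sup.
apply: (@measurability _ _ _ _ _ _ (@open 'rV[R]_d)) => //.
move=> _ [U oU <-]; rewrite setTI; apply: borel_rV_open.
have c : continuous (fun y : 'rV[R]_d => y + n.+1%:R^-1 *: v).
  move=> z; apply: (@continuousD _ _ _ id (cst (n.+1%:R^-1 *: v))); first exact: cvg_id.
  exact: cst_continuous.
by apply: open_comp => // z _; exact: c.
Qed.

Let e_ i : 'rV[R]_d := delta_mx ord0 i.

(* The one-sided slopes increase along a line, so for each rational [q] a line in
   the direction [i] has at most one point where [q] separates them. *)
Lemma affine_sup_corner_set i :
  (lebesgue_rV d).-negligible
    [set y | - dir_deriv (- e_ i) y < dir_deriv (e_ i) y].
Proof.
pose A (q : rat) := [set y | - dir_deriv (- e_ i) y < ratr q] `&`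
  [set y | ratr q < dir_deriv (e_ i) y].
have mA q : measurable (A q).
  have m1 := measurable_dir_deriv (e_ i).
  have m2 := measurable_funN (measurable_dir_deriv (- e_ i)).
  have mc := @measurable_cst _ _ 'rV[R]_d R setT (ratr q).
  by apply: measurableI; exact: measurable_set_ltr.
have -> : [set y | - dir_deriv (- e_ i) y < dir_deriv (e_ i) y] = \bigcup_q A q.
  apply/seteqP; split=> [y /= /rat_in_itvoo[q]|y [q _ [/=]]].
    by rewrite in_itv/= => /andP[? ?]; exists q.
  exact: lt_trans.
apply: negligible_countable => q; apply/negligibleP => //.
apply: (@lebesgue_rV_line _ _ i) => // x y [/= x1 x2] [/= y1 y2] xy.
(* If [a] precedes [b] on the line, the right slope at [a] is at most the chord slope, which is at
   most the left slope at [b]; so [q] cannot lie below the first and above the last. *)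
have key (a b : 'rV[R]_d) : (forall j, j != i -> a ord0 j = b ord0 j) ->
    ratr q < dir_deriv (e_ i) a -> - dir_deriv (- e_ i) b < ratr q ->
    ~ a ord0 i < b ord0 i.
  move=> ab qa qb; rewrite -subr_gt0; set s := _ - _ => s0.
  have bE : b = a + s *: e_ i.
    apply/rowP => j; rewrite !mxE eqxx/=; case: eqVneq => [->|ji].
      by rewrite mulr1 addrC subrK.
    by rewrite mulr0 addr0 ab.
  have aE : a = b + s *: - e_ i by rewrite bE scalerN addrK.
  have := dir_deriv_le (e_ i) a s0; have := dir_deriv_le (- e_ i) b s0.
  rewrite /slope -bE -aE; set u := psi a; set v := psi b => h1 h2.
  have : (u - v) / s = - ((v - u) / s) by rewrite -mulNr opprB.
  by lra.
apply/eqP; rewrite eq_le !leNgt; apply/andP; split; apply/negP.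
  by apply: key => // j /xy.
exact: key.
Qed.

(** For convex functions, partial derivatives give full differentiability. Expansions along the axes
    bound [psi (y + h)] from above by Jensen; the bound from below follows from the one at [- h] and
    midpoint convexity. *)
Lemma affine_sup_differentiable y : (0 < d)%N ->
  (forall i, dir_deriv (e_ i) y <= - dir_deriv (- e_ i) y) ->
  differentiable psi y /\ forall i, pderiv i psi y = dir_deriv (e_ i) y.
Proof.
move=> d0 H; pose g : 'rV[R]_d := \row_i dir_deriv (e_ i) y.
pose df := HB.pack_for {linear 'rV[R]_d -> R} (dotp g)
  (GRing.isLinear.Build _ _ _ _ _ (dotp_linear g)).
have axis (e : R) : 0 < e -> exists2 del : R, 0 < del & forall i t, `|t| < del ->
    psi (y + t *: e_ i) <= psi y + t * g ord0 i + e * `|t|.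
  move=> e0.
  have H1 i : exists2 del : R, 0 < del & forall t : R, `|t| < del ->
      psi (y + t *: e_ i) <= psi y + t * g ord0 i + e * `|t|.
    have [d1 d10 dP1] := dir_deriv_near (e_ i) y e0.
    have [d2 d20 dP2] := dir_deriv_near (- e_ i) y e0.
    exists (Num.min d1 d2); first by rewrite lt_min d10.
    move=> t; rewrite lt_min => /andP[t1 t2]; rewrite !mxE.
    have [t0|t0|->] := ltgtP t 0; last by rewrite scale0r normr0 addr0; lra.
    - move: t2; rewrite ltr0_norm// => t2; have := dP2 (- t).
      rewrite oppr_gt0 t0 t2 => /(_ isT); rewrite /slope scalerN scaleNr opprK.
      rewrite ler_pdivrMr ?oppr_gt0// => Hs.
      have := H i; have : (0 - t) * (- dir_deriv (- e_ i) y - dir_deriv (e_ i) y) >= 0.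
        by rewrite mulr_ge0 ?subr_ge0// ?ltW// sub0r oppr_gt0.
      by nra.
    - move: t1; rewrite gtr0_norm// => t1; have := dP1 t.
      rewrite t0 t1 => /(_ isT); rewrite /slope ler_pdivrMr// => Hs.
      by lra.
  have /choice[f fP] i : exists del : R, 0 < del /\ forall t : R, `|t| < del ->
      psi (y + t *: e_ i) <= psi y + t * g ord0 i + e * `|t|.
    by have [del ? ?] := H1 i; exists del.
  exists (\big[Num.min/1]_i f i).
    by apply: lt_bigmin => // i _; have [] := fP i.
  move=> i t /lt_le_trans; move=> /(_ (f i)) tf; apply: (fP i).2; apply: tf.
  exact: bigmin_le_cond.
have coordN (h : 'rV[R]_d) i : `|h ord0 i| <= `|h|.
  rewrite -[leRHS]/(mx_norm h) mx_normrE.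
  exact: (le_bigmax _ (fun ij : 'I_1 * 'I_d => `|h ij.1 ij.2|) (ord0, i)).
have upper (e : R) : 0 < e -> exists2 del : R, 0 < del & forall h : 'rV[R]_d,
    `|h| < del -> psi (y + h) <= psi y + dotp g h + e * `|h|.
  move=> e0; have dR : 0 < d%:R :> R by rewrite ltr0n.
  have [|del del0 delP] := axis (e / d%:R); first by rewrite divr_gt0.
  exists (del / d%:R) => [|h hdel]; first by rewrite divr_gt0.
  (* The point [y + h] is the mean of [d] points on the axes through [y], each with a coordinate
     step enlarged by [d]; hence [e] and [del] are divided by [d]. *)
  have hE : y + h = \sum_(i < d) d%:R^-1 *: (y + (d%:R * h ord0 i) *: e_ i).
    under eq_bigr do rewrite scalerDr scalerA mulrA mulVf ?gt_eqF// mul1r.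
    rewrite big_split/= sumr_const card_ord -[X in _ = X + _]scaler_nat scalerA divff ?gt_eqF//.
    by rewrite scale1r -row_sum_delta.
  rewrite hE; apply: (le_trans (affine_sup_jensen _ _ _)) => //.
    by rewrite sumr_const card_ord -[LHS]mulr_natr mulVf// gt_eqF.
  have step (i : 'I_d) : d%:R^-1 * psi (y + (d%:R * h ord0 i) *: e_ i) <=
      d%:R^-1 * psi y + g ord0 i * h ord0 i + e / d%:R * `|h|.
    have hi : `|d%:R * h ord0 i| < del.
      rewrite normrM gtr0_norm// -ltr_pdivlMl// mulrC.
      exact: le_lt_trans (coordN h i) hdel.
    rewrite -(ler_pM2l dR) mulrA divff ?gt_eqF// mul1r.
    apply: (le_trans (delP i _ hi)); rewrite !mulrDr mulrA divff ?gt_eqF// mul1r.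
    rewrite -!addrA lerD2l; apply: lerD; first by rewrite -mulrA (mulrC (h _ _)).
    rewrite mulrA mulrCA divff ?gt_eqF// mulr1.
    by rewrite normrM gtr0_norm// mulrA divfK ?gt_eqF// ler_pM2l.
  apply: (le_trans (ler_sum _ (fun i _ => step i))).
  rewrite !big_split/= !sumr_const card_ord -/(dotp g h).
  by rewrite -[_ *+ d]mulr_natl mulrA divff ?gt_eqF// mul1r
    -[_ *+ d]mulr_natl mulrA mulrCA divff ?gt_eqF// mulr1.
have dfc : continuous df by exact: continuous_dotp.
have o : psi \o shift y = cst (psi y) + df +o_ (0 : 'rV[R]_d) id.
  apply/eqaddoP => e e0; have [del del0 delP] := upper e e0.
  apply/nbhs_ballP; exists del => //= h; rewrite mx_norm_ball /ball_/= sub0r normrN => hdel.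
  have h1 := delP h hdel.
  have h2 : psi (y - h) <= psi y - dotp g h + e * `|h|.
    by have := delP (- h); rewrite normrN -[- h]scaleN1r dotpZ mulN1r; apply.
  have h3 : psi y <= 2^-1 * psi (y + h) + 2^-1 * psi (y - h).
    have := @affine_sup_convex 2^-1 (y + h) (y - h).
    rewrite invr_ge0 ler0n invf_le1// ler1n => /(_ isT).
    rewrite -[1 - _]/(1 - _) (_ : 1 - 2^-1 = 2^-1); last lra.
    by rewrite -scalerDr addrACA subrr addr0 -mulr2n -[y *+ 2]scaler_nat scalerA mulVf ?scale1r.
  rewrite /= !fctE/= (addrC h) ler_norml; apply/andP; split; rewrite /df/=; lra.
have dE := diff_unique dfc o.
have dpsi : differentiable psi y.
  by apply/diff_locallyP; rewrite dE.
split => // i; rewrite /pderiv deriveE// dE /df/= dotp_delta mxE.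
by [].
Qed.

(** The affine minorant touches [psi] at [y], so its slope is below every difference quotient. With
    [v] and [- v] this determines the slope wherever the one-sided derivatives match. *)
Lemma affine_sup_contact x r v y : (forall w, dotp x w + r <= psi w) ->
  psi y = dotp x y + r -> dotp x v <= dir_deriv v y.
Proof.
move=> xr yE; apply: dir_deriv_ge => t t0; rewrite ler_pdivlMr// yE.
by have := xr (y + t *: v); rewrite dotpD dotpZ; lra.
Qed.

End supremum_of_affine_functions.

(** * Entropy inequalities, integrals and plans *)

Section real_inequalities.
Context {R : realType}.
Implicit Types u v A B : R.

(** The graph of [t * ln t] lies above its tangent at [v], from [ln s <= s - 1] with [s = v / u];
    the convention [0 * ln 0 = 0] covers [u = 0]. *)
Lemma entropy_tangent u v : 0 <= u -> 0 < v -> u * ln v + u - v <= u * ln u.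
Proof.
rewrite le_eqVlt => /orP[/eqP <-|u0] v0; first by rewrite !mul0r; lra.
have := @le_ln1Dx R (v / u - 1); rewrite (addrC 1) subrK => H.
have {}H : ln (v / u) <= v / u - 1.
  by apply: H; rewrite ltrBDr addrC subrr divr_gt0.
rewrite ln_div ?posrE// in H.
have := ler_wpM2l (ltW u0) H; rewrite !mulrBr mulrCA divff ?gt_eqF// !mulr1.
lra.
Qed.

(** The tangent at [expR (- c)]. With [c = V x g] it bounds the entropy integrand below by an
    integrable function. *)
Lemma entropy_ge u c : 0 <= u -> - expR (- c) <= u * ln u + c * u.
Proof.
move=> u0; have := entropy_tangent u0 (expR_gt0 (- c)).
by rewrite expRK; lra.
Qed.

(** The tangent is taken at the perturbed value [u + A - B] instead of [u], so there is no
    second-order term. Its slope is at most [al + 1] where mass is added and at least [be + 1] where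
    mass is removed. The bound [B <= u / 2] forces [u = A = B = 0] if the perturbed value
    vanishes. *)
Lemma entropy_perturb u A B c al be : 0 <= u -> 0 <= A -> 0 <= B <= u / 2 ->
  (0 < A -> (u + A) * expR c <= expR al) ->
  (0 < B -> expR be <= (u - B) * expR c) ->
  (u + A - B) * ln (u + A - B) + c * (u + A - B) <= u * ln u + c * u + (al + 1) * A - (be + 1) * B.
Proof.
move=> u0 A0 /andP[B0 Bu] hA hB; set u' := u + A - B.
have u'0 : 0 <= u' by rewrite /u'; lra.
move: u'0; rewrite le_eqVlt => /orP[/eqP e0|u'0].
  have -> : u = 0 by rewrite /u' in e0; lra.
  have -> : A = 0 by rewrite /u' in e0; lra.
  have -> : B = 0 by rewrite /u' in e0; lra.
  by rewrite -e0 !mul0r !mulr0; lra.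
have lnE c0 : 0 < c0 -> ln (c0 * expR c) = ln c0 + c.
  by move=> c00; rewrite lnM ?posrE ?expR_gt0// expRK.
have H := entropy_tangent u0 u'0.
have HA : A * (ln u' + c) <= A * al.
  move: A0; rewrite le_eqVlt => /orP[/eqP <-|A0]; first by rewrite !mul0r.
  rewrite ler_pM2l// -lnE// -[leRHS]expRK ler_ln ?posrE ?mulr_gt0 ?expR_gt0//.
  by apply: le_trans (hA A0); rewrite ler_pM2r ?expR_gt0// /u'; lra.
have HB : B * be <= B * (ln u' + c).
  move: B0; rewrite le_eqVlt => /orP[/eqP <-|B0]; first by rewrite !mul0r.
  rewrite ler_pM2l// -lnE// -[leLHS]expRK ler_ln ?posrE ?mulr_gt0 ?expR_gt0//.
  by apply: le_trans (hB B0) _; rewrite ler_pM2r ?expR_gt0// /u'; lra.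
have -> : u' * ln u' + c * u' = u * ln u' + A * (ln u' + c) - B * (ln u' + c) + c * u.
  by rewrite /u'; ring.
have : u' = u + A - B by []. lra.
Qed.

End real_inequalities.

Section integrals.
Context d (T : measurableType d) (R : realType) (m : {measure set T -> \bar R}).
Implicit Types f g : T -> R.

Lemma integrable_le f g : measurable_fun setT f -> (forall x, `|f x| <= g x) ->
  m.-integrable setT (EFin \o g) -> m.-integrable setT (EFin \o f).
Proof.
move=> mf fg ig; apply: le_integrable ig => //; first exact/measurable_EFinP.
by move=> x _ /=; rewrite lee_fin (le_trans (fg x))// ler_norm.
Qed.

Lemma integrable_le2 f g1 g2 : measurable_fun setT f ->
  (forall x, g1 x <= f x <= g2 x) ->
  m.-integrable setT (EFin \o g1) -> m.-integrable setT (EFin \o g2) ->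
  m.-integrable setT (EFin \o f).
Proof.
move=> mf fg i1 i2; apply: (@integrable_le f (fun x => `|g1 x| + `|g2 x|)) => //.
- move=> x; have /andP[h1 h2] := fg x; rewrite ler_norml.
  have := ler_norm (g2 x); have := normr_ge0 (g1 x); have := normr_ge0 (g2 x).
  by have := ler_norm (- g1 x); rewrite normrN; lra.
- have j1 := integrable_abse i1; have j2 := integrable_abse i2.
  by have := integrableD measurableT j1 j2.
Qed.

Lemma integral_finE f : m.-integrable setT (EFin \o f) ->
  (\int[m]_x (f x)%:E = (fine (\int[m]_x (f x)%:E))%:E)%E.
Proof. by move=> i; rewrite fineK//; exact: integrable_fin_num i. Qed.

Let integral_funeneg_lty f g : measurable_fun setT f ->
  (forall x, - g x <= f x) -> m.-integrable setT (EFin \o g) ->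
  (\int[m]_x ((EFin \o f)^\- x) < +oo)%E.
Proof.
move=> mf gf ig; have mEf : measurable_fun setT (EFin \o f) by exact/measurable_EFinP.
apply: (@le_lt_trans _ _ (\int[m]_x `|(EFin \o g) x|)%E); last first.
  by case/integrableP : ig.
apply: ge0_le_integral => //.
- exact: measurable_funeneg.
- by apply: measurableT_comp => //; exact: measurable_int ig.
move=> x _; rewrite funenegE ge_max abse_ge0 andbT lee_fin.
by rewrite (le_trans _ (ler_norm _))// lerNl.
Qed.

Lemma integral_gtNy f g : measurable_fun setT f -> (forall x, - g x <= f x) ->
  m.-integrable setT (EFin \o g) -> (\int[m]_x (f x)%:E != -oo)%E.
Proof.
move=> mf gf ig; rewrite integralE.
have := integral_funeneg_lty mf gf ig; rewrite -ge0_fin_numE; last first.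
  exact: integral_ge0.
move=> /fineK <-; have : (0 <= \int[m]_x ((EFin \o f)^\+ x))%E.
  exact: integral_ge0.
by case: (\int[m]_x ((EFin \o f)^\+ x))%E.
Qed.

Lemma integrable_bounded_below f g : measurable_fun setT f ->
  (forall x, - g x <= f x) -> m.-integrable setT (EFin \o g) ->
  (\int[m]_x (f x)%:E < +oo)%E -> m.-integrable setT (EFin \o f).
Proof.
move=> mf gf ig; have mEf : measurable_fun setT (EFin \o f) by exact/measurable_EFinP.
have neg := integral_funeneg_lty mf gf ig.
have iN : m.-integrable setT ((EFin \o f)^\-)%E.
  apply/integrableP; split; first exact: measurable_funeneg.
  by under eq_integral do rewrite gee0_abs//.
rewrite integralE => fy.
have {}fy : (\int[m]_x ((EFin \o f)^\+ x) - \int[m]_x ((EFin \o f)^\- x) < +oo)%E by [].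
have iP : m.-integrable setT ((EFin \o f)^\+)%E.
  apply/integrableP; split; first exact: measurable_funepos.
  under eq_integral do rewrite gee0_abs//.
  move: fy; have := integrable_fin_num measurableT iN.
  by move=> /fineK <-; case: (\int[m]_x ((EFin \o f)^\+ x))%E => [r _||]; rewrite ?ltry.
by rewrite [X in integrable _ _ X](@funeposneg _ _ (EFin \o f)); exact: integrableB.
Qed.

Lemma integral_indic_gt0 f (S : set T) : measurable S -> measurable_fun setT f ->
  (forall x, 0 < f x) -> m S != 0%E -> (0 < \int[m]_x (\1_S x * f x)%:E)%E.
Proof.
move=> mS mf f0; apply: contraNT; rewrite -leNgt => le0.
have g0 x : 0 <= \1_S x * f x by rewrite mulr_ge0 // ltW.
have mg : measurable_fun setT (fun x => (\1_S x * f x)%:E).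
  by apply/measurable_EFinP; apply: measurable_funM => //; exact: measurable_indic.
have : (\int[m]_x `|(\1_S x * f x)%:E| = 0)%E.
  under eq_integral do rewrite gee0_abs ?lee_fin//.
  by apply/le_anti/andP; split => //; apply: integral_ge0 => x _; rewrite lee_fin.
move/(ae_eq_integral_abs _ measurableT mg) => H; apply/eqP/negligibleP => //.
case: H => N [mN N0 sN]; exists N; split => // x Sx; apply: sN => /= /(_ I)[].
by apply/eqP; rewrite indicE mem_set// mul1r gt_eqF.
Qed.

Lemma ae_le_integral f g : m.-integrable setT (EFin \o f) ->
  m.-integrable setT (EFin \o g) -> {ae m, forall x, f x <= g x} ->
  (\int[m]_x (f x)%:E <= \int[m]_x (g x)%:E)%E.
Proof.
move=> if_ ig fg.
have mf : measurable_fun setT f by apply/measurable_EFinP; exact: measurable_int if_.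
have mg : measurable_fun setT g by apply/measurable_EFinP; exact: measurable_int ig.
have mfg : measurable_fun setT (fun x => Num.max (f x) (g x)) by exact: measurable_maxr.
have E : (\int[m]_x (g x)%:E = \int[m]_x (Num.max (f x) (g x))%:E)%E.
  apply: ae_eq_integral => //; [exact/measurable_EFinP|exact/measurable_EFinP|].
  by apply: filterS fg => x fgx _; rewrite max_r.
rewrite E; apply: le_integral => //; last by move=> x _; rewrite lee_fin le_max lexx.
apply: (@integrable_le2 _ f (fun x => `|f x| + `|g x|)) => //.
- move=> x; rewrite le_max lexx/= ge_max.
  have := ler_norm (f x); have := ler_norm (g x).
  by have := normr_ge0 (f x); have := normr_ge0 (g x); lra.
- have j1 := integrable_abse if_; have j2 := integrable_abse ig.
  by have := integrableD measurableT j1 j2.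
Qed.

End integrals.

(** The Radon-Nikodym derivative is cut off at [phi], which loses nothing: on the set where it
    exceeds [phi], the mass of [nu] is already at most the integral of [phi]. The bound then holds
    at every point, as the competitors require. *)
Lemma dominated_density d (T : measurableType d) (R : realType)
    (m : {sigma_finite_measure set T -> \bar R})
    (nu : {measure set T -> \bar R}) (phi : T -> R) : (nu setT < +oo)%E ->
  measurable_fun setT phi -> (forall x, 0 <= phi x) ->
  (forall S, measurable S -> (nu S <= \int[m]_(x in S) (phi x)%:E)%E) ->
  exists b : T -> R, [/\ measurable_fun setT b, forall x, 0 <= b x <= phi x &
    forall S, measurable S -> nu S = (\int[m]_(x in S) (b x)%:E)%E].
Proof.
move=> nuT mphi phi0 nu_phi.
pose nu' := mfrestr measurableT nuT.
have nu'E A : nu' A = nu A by rewrite /nu' /= /mfrestr /mrestr setIT.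
have dom : nu' `<< m.
  apply/null_content_dominatesP => A mA mA0.
  apply/le_anti/andP; split; last exact: measure_ge0.
  rewrite [leLHS]nu'E (le_trans (nu_phi A mA))// null_set_integral//.
  exact/measurable_EFinP/measurable_funTS.
have [f [f0 ffin if_ fE]] := radon_nikodym_sigma_finite dom.
pose b0 x := fine (f x); have b0E x : (b0 x)%:E = f x by rewrite /b0 fineK.
have mb0 : measurable_fun setT b0.
  apply/measurable_EFinP; rewrite (_ : EFin \o b0 = f); first exact: measurable_int if_.
  exact/funext.
have b00 x : 0 <= b0 x by rewrite -lee_fin b0E.
have nuE S : measurable S -> nu S = (\int[m]_(x in S) (b0 x)%:E)%E.
  by move=> mS; rewrite -nu'E [LHS]fE//; apply: eq_integral => x _; rewrite b0E.
exists (fun x => Num.min (b0 x) (phi x)); split.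
- exact: measurable_minr.
- by move=> x; rewrite le_min b00 phi0/= ge_min lexx orbT.
have mb : measurable_fun setT (fun x => Num.min (b0 x) (phi x)).
  exact: measurable_minr.
have bmin0 x : 0 <= Num.min (b0 x) (phi x) by rewrite le_min b00 phi0.
move=> S mS; apply/le_anti/andP; split; last first.
  rewrite nuE//; apply: ge0_le_integral => //.
  - by move=> x _; rewrite lee_fin.
  - exact/measurable_EFinP/measurable_funTS.
  - exact/measurable_EFinP/measurable_funTS.
  - by move=> x _; rewrite lee_fin ge_min lexx.
pose P := [set x | phi x < b0 x].
have mP : measurable P by exact: measurable_set_ltr.
have mSP : measurable (S `&` P) by exact: measurableI.
have mSN : measurable (S `\` P) by exact: measurableD.
rewrite -(setUIDK S P) measureU//; last by rewrite setDE setIACA setICr setI0.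
rewrite ge0_integral_setU//; last 3 first.
- exact/measurable_EFinP/measurable_funTS.
- by move=> x _; rewrite lee_fin.
- by apply/disj_set2P; rewrite setDE setIACA setICr setI0.
apply: leeD.
  apply: (le_trans (nu_phi _ mSP)).
  have -> // : (\int[m]_(x in S `&` P) (phi x)%:E =
      \int[m]_(x in S `&` P) (Num.min (b0 x) (phi x))%:E)%E.
  by apply: eq_integral => x; rewrite inE => -[_ Px]; rewrite min_r// ltW.
have E : (nu (S `\` P) = \int[m]_(x in S `\` P) (Num.min (b0 x) (phi x))%:E)%E.
  rewrite nuE//; apply: eq_integral => x; rewrite inE => -[_ Px].
  by rewrite min_l// leNgt; apply/negP.
by rewrite [leLHS]E.
Qed.

(* [pi'] keeps the first coordinates but redistributes the fraction [eps] of the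
   mass in [B] according to [n]. *)
Lemma spread_plan d1 d2 (X : measurableType d1) (Y : measurableType d2)
    (R : realType) (pi : {measure set (X * Y) -> \bar R}) (B : set (X * Y))
    (n : {finite_measure set Y -> \bar R}) (eps : R) :
  (pi setT < +oo)%E -> measurable B -> n setT = 1%E -> 0 <= eps <= 1 ->
  exists pi' : {measure set (X * Y) -> \bar R},
  [/\ forall S, measurable S -> pi' (S `*` setT) = pi (S `*` setT),
      forall S, measurable S ->
        (pi' (setT `*` S) + eps%:E * pi (B `&` (setT `*` S)) =
         pi (setT `*` S) + eps%:E * (pi B * n S))%E &
      forall (c : X * Y -> R) k1 k2, measurable_fun setT c ->
        (forall p, 0 <= c p) -> (\int[pi]_p (c p)%:E < +oo)%E ->
        (forall p, B p -> k1 <= c p) ->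
        (forall p, B p -> (\int[n]_z (c (p.1, z))%:E <= k2%:E)%E) ->
        (\int[pi']_p (c p)%:E <=
         \int[pi]_p (c p)%:E + (eps * (k2 - k1))%:E * pi B)%E].
Proof.
move=> piT mB n1 /andP[eps0 eps1].
have mNB : measurable (~` B) by exact: measurableC.
have eps'0 : 0 <= 1 - eps by rewrite subr_ge0.
pose piB : {measure set (X * Y) -> \bar R} := mrestr pi mB.
pose piN : {measure set (X * Y) -> \bar R} := mrestr pi mNB.
pose first0 : {measure set X -> \bar R} :=
  measure_function_pushforward__canonical__measure_function_Measure piB
    (@measurable_fst _ _ X Y).
have first0T : (first0 setT < +oo)%E.
  rewrite /first0 /= /pushforward /piB /= /mrestr preimage_setT setTI.
  by rewrite (le_lt_trans _ piT)// le_measure ?inE.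
pose first : {finite_measure set X -> \bar R} := mfrestr measurableT first0T.
have firstE A : first A = first0 A by rewrite /first /= /mfrestr /mrestr setIT.
pose pr : {measure set (X * Y) -> \bar R} := (first \x n)%E.
pose pi1 : {measure set (X * Y) -> \bar R} :=
  measure_add piN (mscale (NngNum eps'0) piB).
pose pi' : {measure set (X * Y) -> \bar R} :=
  measure_add pi1 (mscale (NngNum eps0) pr).
have pi'E A : (pi' A = piN A + (1 - eps)%:E * piB A + eps%:E * pr A)%E.
  transitivity (pi1 A + eps%:E * pr A)%E.
    exact: (measure_addE pi1 (mscale (NngNum eps0) pr) A).
  congr (_ + _)%E; exact: (measure_addE piN (mscale (NngNum eps'0) piB) A).
have fin A : measurable A -> pi A \is a fin_num.
  move=> mA; rewrite ge0_fin_numE// (le_lt_trans _ piT)// le_measure ?inE//.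
have split_pi A : measurable A -> (pi A = piN A + piB A)%E.
  move=> mA; rewrite /piN /piB /= /mrestr -measureU//; last 3 first.
  - exact: measurableI.
  - exact: measurableI.
  - by rewrite setIACA setICl setI0.
  by rewrite -setIUr setvU setIT.
have finB A : measurable A -> piB A \is a fin_num.
  by move=> mA; apply: fin; exact: measurableI.
have prE A1 A2 : measurable A1 -> measurable A2 ->
    pr (A1 `*` A2) = (first A1 * n A2)%E.
  exact: product_measure1E.
exists pi'; split.
- move=> S mS; have mST : measurable (S `*` [set: Y]) by exact: measurableX.
  rewrite pi'E split_pi// prE// n1 mule1.
  have -> : first S = piB (S `*` setT).
    rewrite firstE /first0 /= /pushforward; congr (piB _).
    by apply/seteqP; split=> [[x y]//|[x y] []].
  rewrite -(fineK (finB _ mST)) -!EFinM -addeA -EFinD; congr (_ + _%:E)%E; ring.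
- move=> S mS; have mTS : measurable ([set: X] `*` S) by exact: measurableX.
  rewrite (pi'E (setT `*` S)) (split_pi (setT `*` S))// (prE setT S)//.
  have -> : first setT = pi B.
    by rewrite firstE /first0 /= /pushforward preimage_setT /piB /= /mrestr setTI.
  have -> : pi (B `&` (setT `*` S)) = piB (setT `*` S) by rewrite setIC.
  set bn := (pi B * n S)%E.
  have /fineK <- : bn \is a fin_num by rewrite fin_numM ?fin// fin_num_measure.
  rewrite -(fineK (finB _ mTS)) -!EFinM -!addeA -!EFinD; congr (_ + _%:E)%E; ring.
move=> c k1 k2 mc c0 cfin cB cn.
have mEc : measurable_fun setT (EFin \o c) by exact/measurable_EFinP.
have Ec0 p : (0 <= (EFin \o c) p)%E by rewrite lee_fin.
have -> : (\int[pi']_p (c p)%:E = \int[piN]_p (c p)%:E +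
    (1 - eps)%:E * \int[piB]_p (c p)%:E + eps%:E * \int[pr]_p (c p)%:E)%E.
  have addE m1 m2 := @ge0_integral_measure_add _ _ R m1 m2 setT measurableT
    (EFin \o c) (fun p _ => Ec0 p) mEc.
  transitivity (\int[pi1]_p (EFin \o c) p +
      \int[mscale (NngNum eps0) pr]_p (EFin \o c) p)%E; first exact: addE.
  rewrite (ge0_integral_mscale _ measurableT (NngNum eps0))//; congr (_ + _)%E.
  transitivity (\int[piN]_p (EFin \o c) p +
      \int[mscale (NngNum eps'0) piB]_p (EFin \o c) p)%E; first exact: addE.
  by rewrite (ge0_integral_mscale _ measurableT (NngNum eps'0)).
have cE : (\int[pi]_p (c p)%:E = \int[piN]_p (c p)%:E + \int[piB]_p (c p)%:E)%E.
  rewrite -(@ge0_integral_measure_add _ _ R piN piB setT measurableT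
    (EFin \o c) (fun p _ => Ec0 p) mEc).
  apply: eq_measure_integral => A mA _.
  by rewrite split_pi//; exact/esym/measure_addE.
have cB_fin : (\int[piB]_p (c p)%:E)%E \is a fin_num.
  have I0 (m : {measure set (X * Y) -> \bar R}) : (0 <= \int[m]_p (c p)%:E)%E.
    by apply: integral_ge0 => p _; exact: Ec0.
  rewrite ge0_fin_numE//; apply: le_lt_trans cfin; rewrite cE; exact: leeDr.
(* The cost removed is [eps] times an integral over [B], which is at least [k1] times its mass; the
   cost added is at most [k2] times that mass by Tonelli. *)
have lower : (k1%:E * pi B <= \int[piB]_p (c p)%:E)%E.
  rewrite ge0_integral_mrestr// -integral_cst//.
  have icB : pi.-integrable B (EFin \o c).
    apply: (integrableS measurableT) => //; apply/integrableP; split => //.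
    by under eq_integral do rewrite gee0_abs//.
  apply: le_integral => //; last by move=> p; rewrite inE => Bp; rewrite lee_fin cB.
  apply/integrableP; split => //.
  rewrite (eq_integral (fun=> `|k1%:E|%E))// integral_cst//.
  by rewrite -(fineK (fin _ mB)) -EFinM ltry.
have upper : (\int[pr]_p (c p)%:E <= k2%:E * pi B)%E.
  rewrite [leLHS](@fubini_tonelli1 _ _ _ _ _ first n (EFin \o c) mEc Ec0).
  rewrite (@eq_measure_integral _ _ _ _ first0); last by move=> A _ _; exact: firstE.
  have mF := @measurable_fun_fubini_tonelli_F _ _ _ _ _ n (EFin \o c) mEc Ec0.
  have F0 x : (0 <= fubini_F n (EFin \o c) x)%E by exact: integral_ge0.
  rewrite [leLHS]ge0_integral_pushforward//.
  rewrite preimage_setT ge0_integral_mrestr//; last first.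
  - by move=> p; exact: F0.
  - exact: measurableT_comp.
  rewrite -integral_cst//; apply: ge0_le_integral => //.
  - by move=> p _; exact: F0.
  - by apply: measurable_funTS; exact: measurableT_comp.
rewrite cE -(fineK cB_fin) -addeA -addeA; apply: leeD2l.
move: lower upper; rewrite -(fineK cB_fin) -(fineK (fin _ mB)) -!EFinM lee_fin => lower upper.
apply: (@le_trans _ _ (((1 - eps) * fine (\int[piB]_p (c p)%:E))%:E +
   (eps * (k2 * fine (pi B)))%:E)%E).
  by apply: leeD2l; rewrite (EFinM eps) lee_wpmul2l// lee_fin.
rewrite -!EFinD lee_fin; nra.
Qed.
Lemma measurable_row d0 (T : measurableType d0) (R : realType) n
    (F : T -> 'rV[R]_n) :
  (forall i, measurable_fun setT (fun t => F t ord0 i)) -> measurable_fun setT F.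
Proof.
elim: n F => [|n IH] F mF.
  rewrite (_ : F = cst 0); first exact: measurable_cst.
  by apply/funext => t; apply/rowP => -[].
rewrite (_ : F = @cons_rV R n \o
    (fun t => (F t ord0 ord0 : measurableTypeR R, \row_j F t ord0 (lift ord0 j)))).
  apply: measurableT_comp; first exact: measurable_cons_rV.
  apply: measurable_fun_pair; first exact: mF.
  by apply: IH => i; under eq_fun do rewrite mxE; exact: mF.
apply/funext => t; apply/rowP => j; case: (unliftP ord0 j) => [k|] -> /=.
  by rewrite cons_rVS mxE.
by rewrite cons_rV0.
Qed.

Lemma pderiv_sqnorm (R : realType) d (i : 'I_d) (y : 'rV[R]_d) :
  pderiv i (@sqnorm R d) y = 2 * y ord0 i.
Proof.
rewrite /pderiv /derive; apply: cvg_lim => //.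
have E : \forall t \near (0:R)^', 2 * y ord0 i + t =
    t^-1 *: ((@sqnorm R d \o shift y) (t *: delta_mx ord0 i) - @sqnorm R d y).
  near=> t; have t0 : t != 0 by near: t; exact: nbhs_dnbhs_neq.
  rewrite /= (_ : t *: delta_mx ord0 i + y = y - (- t *: delta_mx ord0 i)); last first.
    by rewrite scaleNr opprK addrC.
  rewrite sqnormB dotpZ dotp_delta /sqnorm.
  rewrite [X in _ + X - _](_ : _ = t ^+ 2); last first.
    rewrite (bigD1 i)//= big1 ?addr0 => [|j ji]; rewrite !mxE eqxx ?(negbTE ji) ?eqxx/=; ring.
  by rewrite /GRing.scale/=; field.
apply: cvg_trans (near_eq_cvg E) _.
rewrite -[X in _ `=>` nbhs X]addr0; apply: cvgD; first exact: cvg_cst.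
exact: cvg_within.
Unshelve. all: by end_near. Qed.

Lemma pderiv_expR (R : realType) d (i : 'I_d) (k : 'rV[R]_d -> R) (y : 'rV[R]_d) :
  differentiable k y -> differentiable (expR \o k) y /\
  pderiv i (expR \o k) y = expR (k y) * pderiv i k y.
Proof.
move=> dk; have de : differentiable (expR : R -> R) (k y).
  by apply/derivable1_diffP; exact: derivable_expR.
have dek : differentiable (expR \o k) y by exact: differentiable_comp.
split => //; rewrite /pderiv !deriveE// diff_comp//= diff1E// derive1E.
have -> := congr1 (@^~ (k y)) (derive_expR R).
by rewrite /GRing.scale/= mulrC.
Qed.

(** * First-order conditions for the minimizer *)

Section densities.
Context {R : realType} {G : finPointedType} {d : nat}.
Notation state := ('rV[R]_d * discrete_space G)%type.
Notation L := (lebesgue_rV d).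
Implicit Types (mu : probability state R) (u : 'rV[R]_d -> G -> R).

Lemma slice_lty mu g A : measurable A -> (slice mu g A < +oo)%E.
Proof.
move=> mA; rewrite /slice (le_lt_trans (probability_le1 _ _)) ?ltry//.
by apply: measurableX.
Qed.

Lemma density_integrable mu u g : is_density mu u ->
  L.-integrable setT (EFin \o u^~ g).
Proof.
case=> mu_ u0 uE; apply/integrableP; split; first exact/measurable_EFinP.
under eq_integral do rewrite /= ger0_norm//.
by rewrite -uE//; exact: slice_lty.
Qed.

Lemma density_mass mu u : is_density mu u ->
  (\sum_(g : G) \int[L]_x (u x g)%:E = 1)%E.
Proof.
move=> du; have := integral_state du (@measurable_cst _ _ _ _ setT 1%E) (fun _ => @lee01 R).
rewrite integral_cst// mul1e [LHS](@probability_setT _ _ _ mu) => ->.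
by apply: eq_bigr => g _; apply: eq_integral => x _; rewrite mul1e.
Qed.

Lemma density_ae_unique mu u u' g : is_density mu u -> is_density mu u' ->
  {ae L, forall x, u x g = u' x g}.
Proof.
move=> du du'; have [_ _ uE] := du; have [mu' _ uE'] := du'.
have : ae_eq L setT (EFin \o u^~ g) (EFin \o u'^~ g).
  apply: integral_ae_eq => //; first exact: density_integrable du.
  - exact/measurable_EFinP.
  - by move=> A _ mA; rewrite -uE// -uE'.
by apply: filterS => x /(_ I) [].
Qed.

(** The density chosen in [entropy] agrees almost everywhere with [u]. *)
Lemma entropyE (V : 'rV[R]_d -> G -> R) mu u :
  (forall g, measurable_fun setT (V^~ g)) -> is_density mu u ->
  entropy V mu = (\sum_(g : G)
    \int[L]_x (u x g * ln (u x g) + V x g * u x g)%:E)%E.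
Proof.
move=> mV du; rewrite /entropy; case: pselect => [H|[]]; last by exists u.
case: (cid H) => f df /=; apply: eq_bigr => g _.
have mF h : is_density mu h ->
    measurable_fun setT (fun x => (h x g * ln (h x g) + V x g * h x g)%:E).
  case=> mh _ _; apply/measurable_EFinP; apply: measurable_funD.
    by apply: measurable_funM => //; apply: measurableT_comp (mh g).
  exact: measurable_funM.
apply: ae_eq_integral => //; [exact: mF|exact: mF|].
by apply: filterS (density_ae_unique g df du) => x -> _.
Qed.

End densities.

Section competitors.
Context {R : realType} {G : finPointedType} (K : G -> G -> R) {d : nat}.
Notation state := ('rV[R]_d * discrete_space G)%type.
Notation L := (lebesgue_rV d).
Context (V : 'rV[R]_d -> G -> R) (W : 'rV[R]_d -> R) (tau lam' Lam' : R).
Hypothesis K_ge0 : forall g g', 0 <= K g g'.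
Hypothesis K_sym : forall g g', K g g' = K g' g.
Hypothesis mV : forall g, measurable_fun setT (V^~ g).
Hypothesis mW : measurable_fun setT W.
Hypothesis lam'_gt0 : 0 < lam'.
Hypothesis WV : forall x g, lam' * expR (- W x) <= expR (- V x g).
Hypothesis VW : forall x g, expR (- V x g) <= Lam' * expR (- W x).
Hypothesis momentW : (\int[L]_x (sqnorm x * expR (- W x))%:E < +oo)%E.
Hypothesis iW : L.-integrable setT (fun x => (expR (- W x))%:E).
Context (mu mu_tau : probability state R) (u : 'rV[R]_d -> G -> R).
Context (gamma : @plans R d G) (h : @jumps R d G).
Hypothesis tau_gt0 : 0 < tau.
Hypothesis min_mu_tau : JKO_minimizer K V W tau mu mu_tau.
Hypothesis du : is_density mu_tau u.
Hypothesis opt_h : Opt K W tau mu mu_tau gamma h.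
Hypothesis entropy_lty : (entropy V mu_tau < +oo)%E.

Let F (t : R) x g := t * ln t + V x g * t.

Let mF (f : 'rV[R]_d -> R) g : measurable_fun setT f ->
  measurable_fun setT (fun x => F (f x) x g).
Proof.
move=> mf; apply: measurable_funD; last exact: measurable_funM.
by apply: measurable_funM => //; apply: measurableT_comp mf.
Qed.

Lemma integrable_expRV g : L.-integrable setT (fun x => (expR (- V x g))%:E).
Proof.
apply: (@integrable_le _ _ _ _ (fun x => expR (- V x g)) (fun x => Lam' * expR (- W x))).
- by apply: measurableT_comp => //; exact: measurable_funN.
- by move=> x; rewrite ger0_norm ?expR_ge0.
- exact: (integrableZl measurableT Lam' iW).
Qed.

Let entropy_lb t x g : 0 <= t -> - expR (- V x g) <= F t x g.
Proof. exact: entropy_ge. Qed.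

(** No node contributes [-oo] by [entropy_lb], so a total below [+oo] excludes [+oo] at every single
    node. *)
Lemma integrable_entropy g : L.-integrable setT (fun x => (F (u x g) x g)%:E).
Proof.
have [mu_ u0 _] := du.
have gtNy g' : (\int[L]_x (F (u x g') x g')%:E != -oo)%E.
  apply: (integral_gtNy (g := fun x => expR (- V x g'))).
  - exact: mF.
  - by move=> x; exact: entropy_lb.
  - exact: integrable_expRV.
apply: (integrable_bounded_below (f := fun x => F (u x g) x g)
  (g := fun x => expR (- V x g))).
- exact: mF.
- by move=> x; exact: entropy_lb.
- exact: integrable_expRV.
move: entropy_lty; rewrite (entropyE mV du) !ltey; apply: contra_neq => gy.
by apply/esum_eqyP => [g' _|]; [exact: gtNy|exists g; rewrite mem_index_enum].
Qed.

(* First-order optimality against the competitor of density [u + A - B], whose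
   entropy changes by at most [(al - be) * m]. *)
Lemma first_order_condition (A B : 'rV[R]_d -> G -> R) (gamma' : @plans R d G)
    (h' : @jumps R d G) (C al be Delta m : R) :
  (forall g, measurable_fun setT (A^~ g)) ->
  (forall g, measurable_fun setT (B^~ g)) ->
  (forall x g, 0 <= A x g <= C * expR (- W x)) ->
  (forall x g, 0 <= B x g <= u x g / 2) ->
  (\sum_(g : G) \int[L]_x (A x g)%:E = m%:E)%E ->
  (\sum_(g : G) \int[L]_x (B x g)%:E = m%:E)%E ->
  (forall x g, 0 < A x g -> (u x g + A x g) * expR (V x g) <= expR al) ->
  (forall x g, 0 < B x g -> expR be <= (u x g - B x g) * expR (V x g)) ->
  (forall g S, measurable S -> gamma' g (S `*` setT) = slice mu g S) ->
  (forall g g', measurable_fun setT (h' g g')) ->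
  (forall g g' x, h' g g' x = - h' g' g x) ->
  (jump_energy K W h' < +oo)%E ->
  (forall g S, measurable S ->
     (\int[L]_(x in S) (u x g + A x g - B x g)%:E =
      gamma' g (setT `*` S) - tau%:E * \sum_(g' : G)
        \int[L]_(x in S) (h' g g' x * K g g' * expR (- W x))%:E)%E) ->
  (cost K W tau gamma' h' <= cost K W tau gamma h + Delta%:E)%E ->
  0 <= (al - be) * m + Delta.
Proof.
move=> mA mB AW Bu Am Bm Aal Bbe gamma1 mh' anti_h' energy' gamma2 cost'.
have [mu_ u0 _] := du.
pose u' x g := u x g + A x g - B x g.
have u'0 x g : 0 <= u' x g.
  by have := u0 x g; have := AW x g; have := Bu x g; rewrite /u'; lra.
have mu' g : measurable_fun setT (u'^~ g).
  by apply: measurable_funB => //; exact: measurable_funD.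
have iu g : L.-integrable setT (EFin \o u^~ g) := density_integrable g du.
have iA g : L.-integrable setT (EFin \o A^~ g).
  apply: (@integrable_le _ _ _ _ (A^~ g) (fun x => C * expR (- W x))) => //.
    by move=> x; have /andP[? ?] := AW x g; rewrite ger0_norm.
  exact: (integrableZl measurableT C iW).
have iB g : L.-integrable setT (EFin \o B^~ g).
  apply: (@integrable_le _ _ _ _ (B^~ g) (u^~ g)) => //.
  by move=> x; have := Bu x g; have := u0 x g; move=> ? /andP[? ?]; rewrite ger0_norm//; lra.
have Am' : \sum_(g : G) fine (\int[L]_x (A x g)%:E) = m.
  apply: EFin_inj; rewrite -Am -sumEFin; apply: eq_bigr => g _.
  exact/esym/integral_finE.
have Bm' : \sum_(g : G) fine (\int[L]_x (B x g)%:E) = m.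
  apply: EFin_inj; rewrite -Bm -sumEFin; apply: eq_bigr => g _.
  exact/esym/integral_finE.
have iu' g : L.-integrable setT (EFin \o u'^~ g).
  have := integrableB measurableT (integrableD measurableT (iu g) (iA g)) (iB g).
  exact: eq_integrable.
have int_u' g : (\int[L]_x (u' x g)%:E =
    \int[L]_x (u x g)%:E + \int[L]_x (A x g)%:E - \int[L]_x (B x g)%:E)%E.
  rewrite -(@integralD_EFin _ _ _ L _ measurableT (u^~ g) (A^~ g))//.
  rewrite -integralB_EFin//; last first.
    by have := integrableD measurableT (iu g) (iA g); exact: eq_integrable.
have u'1 : (\sum_(g : G) \int[L]_x (u' x g)%:E = 1)%E.
  rewrite -(density_mass du); transitivity (\sum_(g : G) ((fine (\int[L]_x (u x g)%:E))%:E +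
     (fine (\int[L]_x (A x g)%:E) - fine (\int[L]_x (B x g)%:E))%:E))%E.
    apply: eq_bigr => g _; rewrite int_u' (integral_finE (iu g)).
    by rewrite (integral_finE (iA g)) (integral_finE (iB g)) /= -addeA.
  rewrite big_split/= [X in (_ + X)%E]sumEFin sumrB Am' Bm' subrr adde0.
  by apply: eq_bigr => g _; rewrite -integral_finE.
have [sigma dsigma] := probability_of_density mu' u'0 u'1.
have [fsm min] := min_mu_tau.
(* The added density is at most [C * expR (- W x)], which has a finite second moment. *)
have sigma2 : finite_second_moment sigma.
  have msq : measurable_fun setT (fun x : 'rV[R]_d => (sqnorm x)%:E).
    by apply/measurable_EFinP; exact: measurable_sqnorm.
  have sq0 (x : 'rV[R]_d) : (0 <= (sqnorm x)%:E)%E by rewrite lee_fin sqnorm_ge0.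
  rewrite /finite_second_moment (integral_state dsigma msq sq0).
  move: fsm; rewrite /finite_second_moment (integral_state du msq sq0).
  move=> fsm_u; apply: lte_sum_pinfty => g _.
  have fsm_ug : (\int[L]_x ((sqnorm x)%:E * (u x g)%:E) < +oo)%E.
    apply: le_lt_trans fsm_u; rewrite (bigD1 g)//= leeDl// sume_ge0// => g' _.
    by apply: integral_ge0 => x _; rewrite -EFinM lee_fin mulr_ge0 ?sqnorm_ge0.
  have mW' : measurable_fun setT (fun x => expR (- W x)).
    by apply: measurableT_comp => //; exact: measurable_funN.
  have C0 : 0 <= C.
    have /andP[h1 h2] := AW 0 g; have := le_trans h1 h2.
    by rewrite pmulr_lge0 ?expR_gt0.
  apply: (@le_lt_trans _ _ (\int[L]_x ((sqnorm x)%:E * (u x g)%:E +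
      C%:E * (sqnorm x * expR (- W x))%:E))%E).
    apply: ge0_le_integral => //.
    - by move=> x _; rewrite -EFinM lee_fin mulr_ge0 ?sqnorm_ge0.
    - apply/measurable_EFinP; apply: measurable_funM => //; exact: measurable_sqnorm.
    - apply/measurable_EFinP; apply: measurable_funD.
        apply: measurable_funM => //; exact: measurable_sqnorm.
      by apply: measurable_funM => //; apply: measurable_funM => //; exact: measurable_sqnorm.
    - move=> x _; rewrite -!EFinM -EFinD lee_fin mulrCA -mulrDr ler_wpM2l ?sqnorm_ge0//.
      by have := AW x g; have := Bu x g; rewrite /u'; have := u0 x g; lra.
  rewrite ge0_integralD//; last 4 first.
  - by move=> x _; rewrite -EFinM lee_fin mulr_ge0 ?sqnorm_ge0.
  - apply/measurable_EFinP; apply: measurable_funM => //; exact: measurable_sqnorm.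
  - by move=> x _; rewrite -EFinM lee_fin !mulr_ge0 ?sqnorm_ge0 ?expR_ge0.
  - apply/measurable_EFinP; apply: measurable_funM => //.
    by apply: measurable_funM => //; exact: measurable_sqnorm.
  rewrite ge0_integralZl//; last 2 first.
  - by apply/measurable_EFinP; apply: measurable_funM => //; exact: measurable_sqnorm.
  - by move=> x _; rewrite lee_fin mulr_ge0 ?sqnorm_ge0 ?expR_ge0.
  by apply: lte_add_pinfty => //; rewrite lte_mul_pinfty.
(* When integrated and summed, the [+ 1] terms cancel, because [A] and [B] carry the same mass
   [m]. *)
have F'le x g : F (u' x g) x g <=
    F (u x g) x g + ((al + 1) * A x g - (be + 1) * B x g).
  have := @entropy_perturb _ (u x g) (A x g) (B x g) (V x g) al be (u0 x g).
  have /andP[A0 _] := AW x g.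
  by rewrite addrA; apply => //; [exact: Aal|exact: Bbe].
have iF g := integrable_entropy g.
have iAB g : L.-integrable setT (fun x => ((al + 1) * A x g - (be + 1) * B x g)%:E).
  have := integrableB measurableT (integrableZl measurableT (al + 1) (iA g))
    (integrableZl measurableT (be + 1) (iB g)).
  exact: eq_integrable.
have iFAB g : L.-integrable setT (fun x =>
    (F (u x g) x g + ((al + 1) * A x g - (be + 1) * B x g))%:E).
  have := integrableD measurableT (iF g) (iAB g).
  exact: eq_integrable.
have iF' g : L.-integrable setT (fun x => (F (u' x g) x g)%:E).
  apply: (@integrable_le2 _ _ _ _ (fun x => F (u' x g) x g)
    (fun x => - expR (- V x g))
    (fun x => F (u x g) x g + ((al + 1) * A x g - (be + 1) * B x g))).
  - exact: mF.
  - by move=> x; rewrite F'le andbT; exact: entropy_lb.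
  - have := integrableN (integrable_expRV g); exact: eq_integrable.
  - exact: iFAB.
have F'int g : fine (\int[L]_x (F (u' x g) x g)%:E) <=
    fine (\int[L]_x (F (u x g) x g)%:E) + ((al + 1) * fine (\int[L]_x (A x g)%:E)
      - (be + 1) * fine (\int[L]_x (B x g)%:E)).
  have := le_integral measurableT (iF' g) (iFAB g) (fun x _ => F'le x g : (_%:E <= _%:E)%E).
  have -> : (\int[L]_x (F (u x g) x g + ((al + 1) * A x g - (be + 1) * B x g))%:E =
      \int[L]_x (F (u x g) x g)%:E + ((al + 1)%:E * \int[L]_x (A x g)%:E -
      (be + 1)%:E * \int[L]_x (B x g)%:E))%E.
    rewrite -(integralZl measurableT (iA g)) -(integralZl measurableT (iB g)).
    rewrite -(integralB measurableT (integrableZl measurableT (al + 1) (iA g))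
      (integrableZl measurableT (be + 1) (iB g))).
    exact (integralD measurableT (iF g) (iAB g)).
  rewrite (integral_finE (iF' g)) (integral_finE (iF g)) (integral_finE (iA g)).
  by rewrite (integral_finE (iB g)) -!EFinM -EFinB -EFinD lee_fin.
have entE nu f : is_density nu f -> (forall g, L.-integrable setT (fun x => (F (f x g) x g)%:E)) ->
   entropy V nu = (\sum_(g : G) fine (\int[L]_x (F (f x g) x g)%:E))%:E.
  move=> df iFf; rewrite (entropyE mV df) -sumEFin; apply: eq_bigr => g _.
  exact: integral_finE (iFf g).
have tr : (transport_cost K W tau mu sigma <= cost K W tau gamma h + Delta%:E)%E.
  apply: le_trans cost'; apply: ereal_inf_lbound; exists gamma', h'; split => //.
  split => // g S mS; have [_ _ sE] := dsigma; rewrite sE//.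
  exact: gamma2.
have := min _ sigma2; rewrite (entE _ _ du iF) (entE _ _ dsigma iF').
case: opt_h => Tfin _ costE.
move=> /le_trans/(_ (leeD2l _ tr)); rewrite costE -(fineK Tfin) -!EFinD lee_fin.
have : \sum_(g : G) fine (\int[L]_x (F (u' x g) x g)%:E) <=
   \sum_(g : G) fine (\int[L]_x (F (u x g) x g)%:E) + ((al + 1) * m - (be + 1) * m).
  rewrite -[in (al + 1) * m]Am' -Bm' !mulr_sumr -sumrB -big_split/=.
  by apply: ler_sum => g _; exact: F'int.
lra.
Qed.

(** * Jump fluxes and the second marginals of the plans *)

Let gamma1 g S : measurable S -> gamma g (S `*` setT) = slice mu g S.
Proof. by case: opt_h => _ [H _ _ _ _] _; exact: H. Qed.

Let mh g g' : measurable_fun setT (h g g').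
Proof. by case: opt_h => _ [_ H _ _ _] _; exact: H. Qed.

Let hN g g' x : h g g' x = - h g' g x.
Proof. by case: opt_h => _ [_ _ H _ _] _; exact: H. Qed.

Let energy_lty : (jump_energy K W h < +oo)%E.
Proof. by case: opt_h => _ [_ _ _ H _] _. Qed.

Let mu_ g : measurable_fun setT (u^~ g).
Proof. by case: du. Qed.

Let u0 x g : 0 <= u x g.
Proof. by case: du. Qed.

Let iu g : L.-integrable setT (EFin \o u^~ g) := density_integrable g du.

Let mexpW : measurable_fun setT (fun x => expR (- W x)).
Proof. by apply: measurableT_comp => //; exact: measurable_funN. Qed.

Lemma integrable_energy g g' :
  L.-integrable setT (fun x => (h g g' x ^+ 2 * K g g' * expR (- W x))%:E).
Proof.
have ge0 a b x : 0 <= h a b x ^+ 2 * K a b * expR (- W x).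
  by rewrite mulr_ge0 ?expR_ge0// mulr_ge0 ?sqr_ge0.
apply/integrableP; split.
  apply/measurable_EFinP; apply: measurable_funM => //.
  by apply: measurable_funM => //; exact: measurable_funX.
under eq_integral do rewrite gee0_abs ?lee_fin//.
apply: le_lt_trans energy_lty.
rewrite /jump_energy (bigD1 g)//= (bigD1 g')//= -addeA leeDl//.
apply: adde_ge0; apply: sume_ge0 => a _; first by apply: integral_ge0 => x _; rewrite lee_fin.
by apply: sume_ge0 => b _; apply: integral_ge0 => x _; rewrite lee_fin.
Qed.

(** By [|h| <= h ^+ 2 + 1]: the jump energy controls the first term, and [expR (- W)] is
    integrable. *)
Lemma integrable_flux g g' :
  L.-integrable setT (fun x => (h g g' x * K g g' * expR (- W x))%:E).
Proof.
apply: (@integrable_le _ _ _ _ (fun x => h g g' x * K g g' * expR (- W x))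
  (fun x => h g g' x ^+ 2 * K g g' * expR (- W x) + K g g' * expR (- W x))).
- by apply: measurable_funM => //; exact: measurable_funM.
- move=> x; rewrite !normrM (ger0_norm (K_ge0 _ _)) (ger0_norm (expR_ge0 _)).
  rewrite -!(mulrA _ (K g g')); set c := K g g' * _; have c0 : 0 <= c by rewrite mulr_ge0 ?expR_ge0.
  rewrite -[h g g' x ^+ 2]real_normK ?num_real//; set a := `|_|.
  have key (b : R) : b <= b ^+ 2 + 1 by nra.
  have := key a.
  by move=> /(ler_wpM2r c0); rewrite mulrDl mul1r.
- have := integrableD measurableT (integrable_energy g g')
    (integrableZl measurableT (K g g') iW).
  exact: eq_integrable.
Qed.

Lemma integral_net_flux (S : set 'rV[R]_d) (f : 'rV[R]_d -> R)
    (t : G -> 'rV[R]_d -> R) : measurable S ->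
  L.-integrable setT (EFin \o f) -> (forall b, L.-integrable setT (EFin \o t b)) ->
  (\int[L]_(x in S) (f x - tau * \sum_b t b x)%:E =
   \int[L]_(x in S) (f x)%:E - tau%:E * \sum_b \int[L]_(x in S) (t b x)%:E)%E.
Proof.
move=> mS if_ it.
have iS k : L.-integrable setT k -> L.-integrable S k.
  by apply: integrableS.
have isum : L.-integrable S (fun x => \sum_b (t b x)%:E)%E.
  by apply: integrable_sum => // b _; exact: iS (it b).
rewrite -integral_sum//; last by move=> b; exact: iS (it b).
rewrite -integralZl//.
rewrite -(integralB mS (iS _ if_) (integrableZl mS tau isum)).
by apply: eq_integral => x _; rewrite /= sumEFin.
Qed.

(** Density of the second marginal of [gamma g], that is, of the mass after transport and before the
    jumps. *)
Definition terminal_density g x :=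
  u x g + tau * \sum_(g' : G) h g g' x * K g g' * expR (- W x).

Lemma integrable_terminal_density g :
  L.-integrable setT (EFin \o terminal_density g).
Proof.
have isum : L.-integrable setT (fun x => \sum_b (h g b x * K g b * expR (- W x))%:E)%E.
  by apply: integrable_sum => // b _; exact: integrable_flux.
have := integrableD measurableT (iu g) (integrableZl measurableT tau isum).
by apply: eq_integrable => // x _; rewrite /= sumEFin.
Qed.

Lemma terminal_densityE g S : measurable S ->
  gamma g (setT `*` S) = (\int[L]_(x in S) (terminal_density g x)%:E)%E.
Proof.
move=> mS; case: opt_h => _ [_ _ _ _ H] _.
have := integral_net_flux mS (integrable_terminal_density g) (integrable_flux g).
under [in LHS]eq_integral do rewrite addrK.
have [_ _ <-//] := du; rewrite (H g S mS).
have fin b : (\int[L]_(x in S) (h g b x * K g b * expR (- W x))%:E)%E \is a fin_num.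
  apply: integrable_fin_num => //.
  by apply: integrableS (integrable_flux g b).
set X := (tau%:E * _)%E; have /fineK <- : X \is a fin_num.
  by rewrite fin_numM//; apply/sum_fin_numP => b _ _.
by move=> /(congr1 (fun y => y + (fine X)%:E)%E); rewrite !subeK.
Qed.

(** If [k] exceeded [s1 - s2], lowering the flux over [S] would pay off: each unit of mass left at
    [g] instead of [g'] costs about [s1 - s2] in entropy and saves about [k] in jump energy. *)
Lemma jump_step (g g' : G) (k s1 s2 : R) (S : set 'rV[R]_d) : 0 < K g g' ->
  g != g' -> measurable S -> L S != 0%E ->
  (forall x, S x -> [/\ k <= h g g' x, u x g * expR (V x g) <= expR s1 &
     expR s2 <= u x g' * expR (V x g')]) ->
  k <= s1 - s2.
Proof.
move=> Kgg' gg' mS LS hS; rewrite leNgt; apply/negP => lt_k.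
(* A quarter of the gap: the bounds on [ln w] lose [2 * eta], and the quadratic term of the energy
   loses [eps / 2 <= eta / 2]. *)
pose eta := (k - s1 + s2) / 4; have eta0 : 0 < eta by rewrite divr_gt0//; lra.
pose c := tau * K g g' / lam'; have c0 : 0 < c by rewrite divr_gt0 ?mulr_gt0.
have e1 : 0 < expR (s1 + eta) - expR s1 by rewrite subr_gt0 ltr_expR ltrDl.
have e2 : 0 < expR s2 - expR (s2 - eta) by rewrite subr_gt0 ltr_expR ltrBlDr ltrDl.
have e3 : 0 < expR s2 / 2 by rewrite divr_gt0 ?expR_gt0.
(* The perturbation changes [w] by at most [eps * c], by the lower bound of [expR (- V)]. The bounds
   keep [w] below [expR (s1 + eta)] at [g] and above [expR (s2 - eta)] at [g'], and ensure
   [B <= u / 2]. *)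
have [eps [eps0 eps1 eps2 eps3 eps4]] : exists eps, [/\ 0 < eps,
    eps * c <= expR (s1 + eta) - expR s1, eps * c <= expR s2 - expR (s2 - eta),
    eps * c <= expR s2 / 2 & eps <= eta].
  pose t := Num.min (Num.min (expR (s1 + eta) - expR s1)
    (expR s2 - expR (s2 - eta))) (expR s2 / 2).
  have t0 : 0 < t by rewrite !lt_min e1 e2 e3.
  exists (Num.min (t / c) eta).
  have H : Num.min (t / c) eta * c <= t by rewrite -ler_pdivlMr// ge_min lexx.
  split; [by rewrite lt_min eta0 divr_gt0|..|by rewrite ge_min lexx orbT];
    by apply: (le_trans H); rewrite /t !ge_min lexx ?orbT.
pose I x : R := \1_S x.
have I01 x : I x = 0 \/ I x = 1 /\ S x.
  by rewrite /I indicE; have [/set_mem|] := boolP (x \in S); [right|left].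
have mI : measurable_fun setT I by exact: measurable_indic.
have mIW : measurable_fun setT (fun x => I x * expR (- W x)) by exact: measurable_funM.
have I0 x : 0 <= I x <= 1 by case: (I01 x) => [->|[-> _]]; rewrite ?lexx ?ler01.
have iIW : L.-integrable setT (EFin \o (fun x => I x * expR (- W x))).
  apply: (integrable_le (g := fun x => expR (- W x))) => // x.
  have /andP[h0 h1] := I0 x.
  by rewrite normrM !ger0_norm ?expR_ge0// ler_piMl ?expR_ge0.
have [kap kapE] : exists kap, (\int[L]_x (I x * expR (- W x))%:E = kap%:E)%E.
  by eexists; exact: integral_finE iIW.
have kap0 : 0 < kap.
  by rewrite -lte_fin -kapE; apply: integral_indic_gt0 => // x; exact: expR_gt0.
pose D := eps * tau * K g g'; have D0 : 0 < D by rewrite !mulr_gt0.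
pose A x a := (a == g)%:R * (D * (I x * expR (- W x))).
pose B x a := (a == g')%:R * (D * (I x * expR (- W x))).
pose s a b : R := ((a == g) && (b == g'))%:R - ((a == g') && (b == g))%:R.
have sN a b : s a b = - s b a.
  by rewrite /s opprB (andbC (b == g')) (andbC (b == g)).
(* The net flux over [S] along the edge from [g] to [g'] is lowered by [eps]. *)
pose h' a b x := h a b x - eps * I x * s a b.
have intD a0 : (\sum_(a : G) \int[L]_x ((a == a0)%:R * (D * (I x * expR (- W x))))%:E
    = (D * kap)%:E)%E.
  rewrite (bigD1 a0)//= big1 ?adde0.
    under eq_integral do rewrite eqxx mul1r EFinM.
    by rewrite (integralZl measurableT iIW) kapE.
  move=> a /negbTE aa0; apply: integral0_eq => x _.
  by rewrite aa0 mul0r.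
have Ddelta x a : D * (I x * expR (- W x)) * expR (V x a) <= eps * c.
  have H : expR (- W x) * expR (V x a) <= lam'^-1.
    rewrite -ler_pdivlMr ?expR_gt0// -expRN -ler_pdivrMl ?invr_gt0// invrK.
    exact: WV.
  have /andP[h0 h1] := I0 x.
  have -> : eps * c = D * (1 * lam'^-1) by rewrite /c /D; ring.
  have -> : D * (I x * expR (- W x)) * expR (V x a) =
    D * (I x * (expR (- W x) * expR (V x a))) by ring.
  by rewrite ler_pM2l//; apply: ler_pM => //; rewrite mulr_ge0 ?expR_ge0.
have m0 : 0 < D * kap by rewrite mulr_gt0.
have sK a : \sum_b s a b * K a b = (a == g)%:R * K g g' - (a == g')%:R * K g g'.
  have sum1 (p q : G) : \sum_b ((a == p) && (b == q))%:R * K a b = (a == p)%:R * K p q.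
    rewrite (bigD1 q)//= eqxx andbT big1 ?addr0.
      by case: eqVneq => [->|_]; rewrite ?mul0r.
    by move=> b /negbTE ->; rewrite andbF mul0r.
  under eq_bigr do rewrite /s mulrBl.
  by rewrite sumrB !sum1 (K_sym g' g).
have mh' a b : measurable_fun setT (h' a b).
  by apply: measurable_funB => //; apply: measurable_funM => //; exact: measurable_funM.
have ih' a b : L.-integrable setT (EFin \o (fun x => h' a b x * K a b * expR (- W x))).
  have := integrableB measurableT (integrable_flux a b)
    (integrableZl measurableT (eps * s a b * K a b) iIW).
  apply: eq_integrable => // x _; rewrite /=; congr EFin.
  by rewrite /h'; ring.
(* [t] marks both orientations of the edge. On each, the square grows by
   [eps ^+ 2 - 2 * eps * h g g' x], which is at most [r] on [S]. *)
pose t a b : R := ((a == g) && (b == g'))%:R + ((a == g') && (b == g))%:R.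
pose r := eps ^+ 2 - 2 * eps * k.
have energy_pt a b x : h' a b x ^+ 2 * K a b * expR (- W x) <=
    h a b x ^+ 2 * K a b * expR (- W x) + (r * t a b * K a b) * (I x * expR (- W x)).
  have -> : h a b x ^+ 2 * K a b * expR (- W x) + (r * t a b * K a b) * (I x * expR (- W x)) =
    (h a b x ^+ 2 + r * t a b * I x) * K a b * expR (- W x) by ring.
  rewrite ler_wpM2r ?expR_ge0// ler_wpM2r// /h' /t /s /r.
  case: (I01 x) => [->|[-> /hS[hk _ _]]]; first by rewrite !(mulr0, mul0r) subr0 addr0.
  have [/andP[/eqP -> /eqP ->]|_] := boolP ((a == g) && (b == g')).
    by rewrite (negbTE gg')/=; nra.
  have [/andP[/eqP -> /eqP ->]|_] := boolP ((a == g') && (b == g)).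
    by rewrite (hN g' g) /=; nra.
  by rewrite /=; nra.
have energy_int a b : (\int[L]_x (h' a b x ^+ 2 * K a b * expR (- W x))%:E <=
    \int[L]_x (h a b x ^+ 2 * K a b * expR (- W x))%:E + (r * kap * (t a b * K a b))%:E)%E.
  have -> : ((r * kap * (t a b * K a b))%:E =
      \int[L]_x ((r * t a b * K a b)%:E * (I x * expR (- W x))%:E))%E.
    by rewrite (integralZl measurableT iIW) kapE -EFinM; congr EFin; ring.
  rewrite -(integralD measurableT (integrable_energy a b) (integrableZl measurableT _ iIW)).
  have sq0 x : 0 <= h' a b x ^+ 2 * K a b * expR (- W x).
    by rewrite mulr_ge0 ?expR_ge0// mulr_ge0 ?sqr_ge0.
  apply: ge0_le_integral => //.
  - by move=> x _; rewrite lee_fin.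
  - apply/measurable_EFinP; apply: measurable_funM => //; apply: measurable_funM => //.
    exact: measurable_funX.
  - apply/measurable_EFinP; apply: measurable_funD.
      by apply: measurable_funM => //; apply: measurable_funM => //; exact: measurable_funX.
    exact: measurable_funM.
  - by move=> x _; rewrite -EFinM -EFinD lee_fin; exact: energy_pt.
have tK : \sum_a \sum_b t a b * K a b = 2 * K g g'.
  have sum2 (p q : G) : \sum_a \sum_b ((a == p) && (b == q))%:R * K a b = K p q.
    rewrite (bigD1 p)//= [X in _ + X]big1 ?addr0.
      rewrite (bigD1 q)//= !eqxx mul1r big1 ?addr0// => b /negbTE ->.
      by rewrite andbF mul0r.
    by move=> a /negbTE ->; rewrite big1// => b _; rewrite mul0r.
  under eq_bigr do under eq_bigr do rewrite /t mulrDl.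
  under eq_bigr do rewrite big_split/=.
  by rewrite big_split/= !sum2 (K_sym g' g); ring.
have energy_le : (jump_energy K W h' <= jump_energy K W h + (r * kap * (2 * K g g'))%:E)%E.
  rewrite /jump_energy -tK mulr_sumr -sumEFin -big_split/=.
  apply: lee_sum => a _; rewrite mulr_sumr -sumEFin -big_split/=.
  by apply: lee_sum => b _; exact: energy_int.
have Jfin : jump_energy K W h \is a fin_num.
  by apply/sum_fin_numP => a _ _; apply/sum_fin_numP => b _ _;
    exact: integrable_fin_num (integrable_energy a b).
have := @first_order_condition A B gamma h' D (s1 + eta) (s2 - eta)
  (D * kap * (eps / 2 - k)) (D * kap).
have WE x : 0 < expR (- W x) by exact: expR_gt0.
have AE x : 0 <= D * (I x * expR (- W x)) <= D * expR (- W x).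
  have /andP[i0 i1] := I0 x; apply/andP; split.
    by apply: mulr_ge0; [exact: ltW|exact: mulr_ge0].
  by rewrite (ler_pM2l D0) ger_pMl.
suff : 0 <= (s1 + eta - (s2 - eta)) * (D * kap) + D * kap * (eps / 2 - k).
  rewrite mulrC -mulrDr pmulr_rge0//.
  have : eta * 4 = k - s1 + s2 by rewrite /eta divfK.
  lra.
apply: (@first_order_condition A B gamma h' D _ _ _ _) => //.
- by move=> a; apply: measurable_funM => //; exact: measurable_funM.
- by move=> a; apply: measurable_funM => //; exact: measurable_funM.
- move=> x a; rewrite /A; case: eqVneq => _.
    by rewrite mul1r.
  by rewrite mul0r lexx/= mulr_ge0 ?expR_ge0// ltW.
- move=> x a; rewrite /B; case: eqVneq => [->|_]; last first.
    by rewrite mul0r lexx/= divr_ge0.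
  rewrite mul1r; have /andP[-> _] := AE x; rewrite /=.
  case: (I01 x) => [->|[_ Sx]]; first by rewrite mul0r mulr0 divr_ge0.
  have [_ _ us2] := hS x Sx.
  rewrite -(ler_pM2r (expR_gt0 (V x g'))).
  by have := Ddelta x g'; lra.
- exact: intD.
- exact: intD.
- move=> x a; rewrite /A; case: eqVneq => [->|_]; last by rewrite mul0r ltxx.
  rewrite mul1r; case: (I01 x) => [->|[_ Sx]]; first by rewrite mul0r mulr0 ltxx.
  have [_ us1 _] := hS x Sx => _; rewrite mulrDl.
  by have := Ddelta x g; lra.
- move=> x a; rewrite /B; case: eqVneq => [->|_]; last by rewrite mul0r ltxx.
  rewrite mul1r; case: (I01 x) => [->|[_ Sx]]; first by rewrite mul0r mulr0 ltxx.
  have [_ _ us2] := hS x Sx => _; rewrite mulrBl.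
  by have := Ddelta x g'; lra.
- by move=> a b x; rewrite /h' (hN a b) (sN a b); ring.
- apply: le_lt_trans energy_le _.
  by rewrite -(fineK Jfin) -EFinD ltry.
- move=> a S' mS'; rewrite terminal_densityE//.
  rewrite -(integral_net_flux mS' (integrable_terminal_density a) (ih' a)).
  apply: eq_integral => x _; congr EFin.
  rewrite /terminal_density -addrA -addrA; congr (_ + _).
  rewrite -mulrBr -sumrB.
  have -> : \sum_i (h a i x * K a i * expR (- W x) - h' a i x * K a i * expR (- W x)) =
     \sum_i s a i * K a i * (eps * (I x * expR (- W x))).
    by apply: eq_bigr => b _; rewrite /h'; ring.
  by rewrite -mulr_suml sK /A /B /D; ring.
- rewrite /cost; apply: (@le_trans _ _ (\sum_a quadratic_cost tau (gamma a) +
    (tau / 4)%:E * (jump_energy K W h + (r * kap * (2 * K g g'))%:E))%E).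
    by apply: leeD2l; rewrite lee_pmul2l// ?lte_fin ?divr_gt0.
  rewrite -(fineK Jfin) -EFinD -!EFinM -addeA -EFinD.
  rewrite (_ : tau / 4 * _ = tau / 4 * fine (jump_energy K W h) + D * kap * (eps / 2 - k))//.
  by rewrite /r /D; field.
Qed.

(** * Redirecting a part of a plan *)

Definition tcost (p : 'rV[R]_d * 'rV[R]_d) : R := (2 * tau)^-1 * sqnorm (p.1 - p.2).

Lemma tcost_ge0 p : 0 <= tcost p.
Proof. by rewrite mulr_ge0 ?sqnorm_ge0// invr_ge0 mulr_ge0// ltW. Qed.

Lemma measurable_tcost : measurable_fun setT tcost.
Proof. by apply: measurable_funM => //; exact: measurable_sqnormB. Qed.

Let gammaT_lty g : (gamma g setT < +oo)%E.
Proof. by rewrite -setXTT gamma1//; exact: slice_lty. Qed.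

Let Tfin : (cost K W tau gamma h) \is a fin_num.
Proof. by case: opt_h => H _ ->. Qed.

Let energy_ge0 h0 : (0 <= jump_energy K W h0)%E.
Proof.
apply: sume_ge0 => a _; apply: sume_ge0 => b _; apply: integral_ge0 => x _.
by rewrite lee_fin mulr_ge0 ?expR_ge0// mulr_ge0 ?sqr_ge0.
Qed.

Let quad_ge0 (pi : {measure set ('rV[R]_d * 'rV[R]_d) -> \bar R}) :
  (0 <= quadratic_cost tau pi)%E.
Proof. by apply: integral_ge0 => p _; rewrite lee_fin tcost_ge0. Qed.

Lemma quadratic_cost_fin g : quadratic_cost tau (gamma g) \is a fin_num.
Proof.
rewrite ge0_fin_numE//; have := Tfin; rewrite ge0_fin_numE; last first.
  by apply: adde_ge0; [apply: sume_ge0|apply: mule_ge0; rewrite ?lee_fin ?divr_ge0// ltW].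
apply: le_lt_trans; rewrite /cost (bigD1 g)//= -addeA leeDl//.
apply: adde_ge0; [exact: sume_ge0|apply: mule_ge0 => //].
by rewrite lee_fin divr_ge0// ltW.
Qed.

Lemma measurable_terminal_density g : measurable_fun setT (terminal_density g).
Proof.
apply/measurable_EFinP; exact: measurable_int (integrable_terminal_density g).
Qed.

Let arith1 (e a b c d' : R) : 0 < e -> e * 4 = a + b - c - d' ->
  0 <= c + e - (a - e) + (d' - b) -> False.
Proof. lra. Qed.

Let arith2 (a b c d' : R) : d' <= b - c -> a <= c -> a + d' <= b.
Proof. lra. Qed.

Let arith3 (r e b c m a : R) : r + e * b = c + e * (m * a) ->
  c + e * m * a - e * b = r.
Proof. lra. Qed.

(** Otherwise a fraction of the plan on [B1] is redirected to endpoints spread over [B2]. Per unit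
    of mass the cost changes by at most [k2 - k1] and the entropy by at most about [s2 - s1]. The
    constant [M] bounds the arriving mass by a multiple of [u], so that a small fraction of it can
    be removed from [u]. *)
Lemma transport_step (g : G) (k1 k2 s1 s2 M : R)
    (B1 : set ('rV[R]_d * 'rV[R]_d)) (B2 : set 'rV[R]_d) : 0 < M ->
  measurable B1 -> measurable B2 -> gamma g B1 != 0%E -> L B2 != 0%E ->
  (forall p, B1 p -> [/\ k1 <= tcost p, expR s1 <= u p.2 g * expR (V p.2 g) &
     terminal_density g p.2 <= M * u p.2 g]) ->
  (forall z, B2 z -> u z g * expR (V z g) <= expR s2) ->
  (forall p z, B1 p -> B2 z -> tcost (p.1, z) <= k2) ->
  s1 + k1 <= s2 + k2.
Proof.
move=> M0 mB1 mB2 gB1 LB2 hB1 hB2 hk2; rewrite leNgt; apply/negP => lt_k.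
(* A quarter of the gap; the two logarithmic bounds use up half of it. *)
pose eta := (s1 + k1 - s2 - k2) / 4; have eta0 : 0 < eta by rewrite divr_gt0//; lra.
have B1_lty : (gamma g B1 < +oo)%E.
  by rewrite (le_lt_trans _ (gammaT_lty g))// le_measure ?inE.
have [m0 m0E] : exists m0, gamma g B1 = m0%:E.
  by exists (fine (gamma g B1)); rewrite fineK// ge0_fin_numE.
have m00 : 0 < m0 by rewrite -lte_fin -m0E lt0e gB1 measure_ge0.
pose I2 x : R := \1_B2 x.
have I01 x : I2 x = 0 \/ I2 x = 1 /\ B2 x.
  by rewrite /I2 indicE; have [/set_mem|] := boolP (x \in B2); [right|left].
have I0 x : 0 <= I2 x <= 1 by case: (I01 x) => [->|[-> _]]; rewrite ?lexx ?ler01.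
have mI : measurable_fun setT I2 by exact: measurable_indic.
have mexpV : measurable_fun setT (fun x => expR (- V x g)).
  by apply: measurableT_comp => //; exact: measurable_funN.
have mIV : measurable_fun setT (fun x => I2 x * expR (- V x g)) by exact: measurable_funM.
have iIV : L.-integrable setT (EFin \o (fun x => I2 x * expR (- V x g))).
  apply: (integrable_le (g := fun x => expR (- V x g))) => //; last exact: integrable_expRV.
  move=> x; have /andP[h0 h1] := I0 x.
  by rewrite normrM !ger0_norm ?expR_ge0// ler_piMl ?expR_ge0.
have [kap kapE] : exists kap, (\int[L]_x (I2 x * expR (- V x g))%:E = kap%:E)%E.
  by eexists; exact: integral_finE iIV.
have kap0 : 0 < kap.
  by rewrite -lte_fin -kapE; apply: integral_indic_gt0 => // x; exact: expR_gt0.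
(* With the weight [expR (- V)], adding a multiple of [a] raises [w] by a bounded amount, and [a] is
   at most a multiple of [expR (- W)]. *)
pose a x := kap^-1 * (I2 x * expR (- V x g)).
have a0 x : 0 <= a x.
  by have /andP[? _] := I0 x; rewrite mulr_ge0 ?mulr_ge0 ?expR_ge0// invr_ge0 ltW.
have ma : measurable_fun setT a by exact: measurable_funM.
have [n0 n0E] := density_measure L ma a0.
have a1 : (\int[L]_x (a x)%:E = 1)%E.
  under eq_integral do rewrite EFinM.
  by rewrite (integralZl measurableT iIV) kapE -EFinM mulVf// gt_eqF.
have n0T : (n0 setT < +oo)%E by rewrite n0E// a1 ltry.
pose n := mfrestr measurableT n0T.
have nE A : n A = n0 A by rewrite /n /= /mfrestr /mrestr setIT.
have nT : n setT = 1%E by rewrite nE n0E.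
(* In this order: [B <= u / 2]; removal lowers [w] by a factor of at least [expR (- eta)]; addition
   keeps [w] below [expR (s2 + eta)] on [B2]; [eps] is a fraction. *)
have [eps [eps0 eps1 eps2 eps3 eps4]] : exists eps, [/\ 0 < eps,
    eps * M <= 2^-1, eps * M <= 1 - expR (- eta),
    eps * (m0 / kap) <= expR (s2 + eta) - expR s2 & eps <= 1].
  have e2 : 0 < 1 - expR (- eta) by rewrite subr_gt0 expR_lt1 oppr_lt0.
  have e3 : 0 < expR (s2 + eta) - expR s2 by rewrite subr_gt0 ltr_expR ltrDl.
  have mk : 0 < m0 / kap by rewrite divr_gt0.
  exists (Num.min (Num.min (2^-1 / M) ((1 - expR (- eta)) / M))
    (Num.min ((expR (s2 + eta) - expR s2) / (m0 / kap)) 1)).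
  by split; rewrite ?lt_min ?divr_gt0 ?ltr01// -?ler_pdivlMr// !ge_min lexx ?orbT.
pose Q := [set z | expR s1 <= u z g * expR (V z g)] `&`
  [set z | terminal_density g z <= M * u z g].
have mexpV' : measurable_fun setT (fun x => expR (V x g)) by apply: measurableT_comp.
have mQ : measurable Q.
  apply: measurableI; apply: measurable_set_ler => //; last exact: measurable_funM.
    exact: measurable_funM.
  exact: measurable_terminal_density.
(* The factor [\1_Q] makes the density [b] of the removed mass vanish at every point outside [Q], so
   the lower bound on [w] is available wherever [b] is positive. *)
pose phi z := M * u z g * \1_Q z.
have mphi : measurable_fun setT phi.
  by apply: measurable_funM; [exact: measurable_funM|exact: measurable_indic].
have phi0 z : 0 <= phi z by rewrite !mulr_ge0// ltW.
pose nu : {measure set 'rV[R]_d -> \bar R} :=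
  measure_function_pushforward__canonical__measure_function_Measure
    (mrestr (gamma g) mB1) (@measurable_snd _ _ 'rV[R]_d 'rV[R]_d).
have nuE S : nu S = gamma g (B1 `&` (setT `*` S)).
  rewrite /nu /= /pushforward /mrestr setIC; congr (gamma g (_ `&` _)).
  by apply/seteqP; split=> [[x y]//|[x y] []].
have nuT : (nu setT < +oo)%E by rewrite nuE setXTT setIT.
have nu_phi S : measurable S -> (nu S <= \int[L]_(x in S) (phi x)%:E)%E.
  move=> mS; have mSQ : measurable (S `&` Q) by exact: measurableI.
  apply: (@le_trans _ _ (gamma g (setT `*` (S `&` Q)))).
    rewrite nuE; apply: le_measure; rewrite ?inE//.
    - by apply: measurableI => //; exact: measurableX.
    - exact: measurableX.
    - by move=> [x y] [/hB1[/= _ q1 q2] [_ Sy]]; do 2!split.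
  rewrite terminal_densityE//.
  apply: (@le_trans _ _ (\int[L]_(x in S `&` Q) (phi x)%:E)%E).
    apply: le_integral => //.
    - by apply: integrableS (integrable_terminal_density g).
    - apply: (@integrableS _ _ _ L setT) => //.
      apply: (integrable_le (g := fun x => M * u x g)) => //.
        move=> x; rewrite ger0_norm// /phi indicE ler_piMr ?mulr_ge0 ?(ltW M0)//.
        by case: (_ \in _).
      by have := integrableZl measurableT M (iu g); exact: eq_integrable.
    - by move=> x; rewrite inE => -[_ Qx]; rewrite lee_fin /phi indicE mem_set// mulr1; case: Qx.
  apply: ge0_subset_integral => //.
  - exact/measurable_EFinP/measurable_funTS.
  - by move=> x _; rewrite lee_fin.
have [b [mb bphi bE]] := dominated_density nuT mphi phi0 nu_phi.
have eps01 : 0 <= eps <= 1 by rewrite ltW.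
have [pi' [pi'1 pi'2 pi'c]] := spread_plan (gammaT_lty g) mB1 nT eps01.
pose gamma' a' := if a' == g then pi' else gamma a'.
pose A x a' := (a' == g)%:R * (eps * m0 * a x).
pose B x a' := (a' == g)%:R * (eps * b x).
have b0 x : 0 <= b x by have /andP[] := bphi x.
have ia : L.-integrable setT (EFin \o a).
  by have := integrableZl measurableT kap^-1 iIV; exact: eq_integrable.
have iphi : L.-integrable setT (EFin \o phi).
  apply: (integrable_le (g := fun x => M * u x g)) => //.
    move=> x; rewrite ger0_norm// /phi indicE ler_piMr ?mulr_ge0 ?(ltW M0)//.
    by case: (_ \in _).
  by have := integrableZl measurableT M (iu g); exact: eq_integrable.
have ib : L.-integrable setT (EFin \o b).
  apply: (integrable_le (g := phi)) => // x.
  by rewrite ger0_norm//; have /andP[] := bphi x.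
have b1 : (\int[L]_x (b x)%:E = m0%:E)%E.
  by rewrite -bE// nuE setXTT setIT.
have intD (f : 'rV[R]_d -> R) (c : R) : (\int[L]_x (c * f x)%:E = (eps * m0)%:E)%E ->
    (\sum_(a' : G) \int[L]_x ((a' == g)%:R * (c * f x))%:E = (eps * m0)%:E)%E.
  move=> fE; rewrite (bigD1 g)//= big1 ?adde0.
    by under eq_integral do rewrite eqxx mul1r.
  move=> a' /negbTE aa0; apply: integral0_eq => x _.
  by rewrite aa0 mul0r.
have aV x : a x * expR (V x g) <= kap^-1.
  have /andP[h0 h1] := I0 x.
  rewrite /a -!mulrA -expRD addNr expR0 mulr1 -[leRHS]mulr1 ler_wpM2l//.
  by rewrite invr_ge0 ltW.
have Qb x : 0 < b x -> Q x.
  move=> bx; apply: contrapT => nQ; have /andP[_] := bphi x.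
  by rewrite /phi indicE memNset// mulr0 leNgt bx.
have bu x : eps * b x <= eps * M * u x g.
  have /andP[_ bx] := bphi x; rewrite -mulrA ler_pM2l// (le_trans bx)//.
  rewrite /phi indicE ler_piMr ?mulr_ge0 ?(ltW M0)//.
  by case: (_ \in _).
have em0 : 0 < eps * m0 by rewrite mulr_gt0.
suff : 0 <= (s2 + eta - (s1 - eta)) * (eps * m0) + eps * m0 * (k2 - k1).
  rewrite mulrC -mulrDr pmulr_rge0//.
  by apply: arith1 => //; rewrite /eta divfK.
apply: (@first_order_condition A B gamma' h (eps * m0 * (kap^-1 * Lam'))) => //.
- by move=> a'; apply: measurable_funM => //; exact: measurable_funM.
- by move=> a'; apply: measurable_funM => //; exact: measurable_funM.
- move=> x a'; have H : 0 <= eps * m0 * a x <= eps * m0 * (kap^-1 * Lam') * expR (- W x).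
    rewrite mulr_ge0 ?(ltW em0)//= -(mulrA (eps * m0)) ler_pM2l// -mulrA.
    rewrite ler_pM2l ?invr_gt0//; apply: le_trans (VW x g).
    by have /andP[h0 h1] := I0 x; rewrite ler_piMl ?expR_ge0.
  rewrite /A; case: eqVneq => _; first by rewrite mul1r.
  by rewrite mul0r lexx/=; case/andP : H => H1; apply: le_trans.
- move=> x a'; rewrite /B; case: eqVneq => [->|_]; last by rewrite mul0r lexx/= divr_ge0.
  rewrite mul1r mulr_ge0 ?(ltW eps0)//= (le_trans (bu x))// mulrC ler_wpM2l//.
- by apply: intD; under eq_integral do rewrite EFinM; rewrite (integralZl measurableT ia) a1 mule1.
- by apply: intD; under eq_integral do rewrite EFinM; rewrite (integralZl measurableT ib) b1.
- move=> x a'; rewrite /A; case: eqVneq => [->|_]; last by rewrite mul0r ltxx.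
  rewrite mul1r pmulr_rgt0// => ax.
  have B2x : B2 x.
    case: (I01 x) => [I2x|[]//]; move: ax.
    by rewrite /a I2x mul0r mulr0 ltxx.
  rewrite mulrDl; apply: arith2 (hB2 x B2x); apply: le_trans eps3.
  by rewrite (mulrA eps m0) -(mulrA (eps * m0) (a x)) ler_pM2l.
- move=> x a'; rewrite /B; case: eqVneq => [->|_]; last by rewrite mul0r ltxx.
  rewrite mul1r pmulr_rgt0// => bx; have [Q1 Q2] := Qb x bx.
  apply: (@le_trans _ _ (expR (- eta) * (u x g * expR (V x g)))).
    by rewrite addrC expRD ler_wpM2l ?expR_ge0.
  rewrite mulrA ler_wpM2r ?expR_ge0//.
  rewrite lerBrDr -lerBrDl (le_trans (bu x))//.
  by rewrite -{2}[u x g]mul1r -mulrBl ler_wpM2r.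
- move=> a' S mS; rewrite /gamma'; case: eqVneq => [->|_]; last exact: gamma1.
  by rewrite pi'1// gamma1.
- move=> a' S mS.
  have iAB : L.-integrable setT (EFin \o (fun x => terminal_density a' x + A x a' - B x a')).
    have iA : L.-integrable setT (EFin \o A^~ a').
      have := integrableZl measurableT ((a' == g)%:R * (eps * m0)) ia.
      by apply: eq_integrable => // x _; congr EFin; rewrite /A /=; ring.
    have iB : L.-integrable setT (EFin \o B^~ a').
      have := integrableZl measurableT ((a' == g)%:R * eps) ib.
      by apply: eq_integrable => // x _; congr EFin; rewrite /B /=; ring.
    have := integrableB measurableT (integrableD measurableT
      (integrable_terminal_density a') iA) iB.
    exact: eq_integrable.
  transitivity (\int[L]_(x in S) (terminal_density a' x + A x a' - B x a' -
     tau * \sum_b h a' b x * K a' b * expR (- W x))%:E)%E.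
    by apply: eq_integral => x _; congr EFin; rewrite /terminal_density; ring.
  rewrite (integral_net_flux mS iAB (integrable_flux a')); congr (_ - _)%E.
  rewrite /gamma' /A /B; case: eqVneq => [->|_]; last first.
    rewrite terminal_densityE//; apply: eq_integral => x _; congr EFin.
    by rewrite !mul0r addr0 subr0.
  have iS (f : 'rV[R]_d -> R) : L.-integrable setT (EFin \o f) -> L.-integrable S (EFin \o f).
    by apply: integrableS.
  have finE (f : 'rV[R]_d -> R) : L.-integrable setT (EFin \o f) ->
      (\int[L]_(x in S) (f x)%:E = (fine (\int[L]_(x in S) (f x)%:E))%:E)%E.
    by move=> /iS /(integrable_fin_num mS) /fineK.
  have iDr := integrable_terminal_density g.
  have -> : (\int[L]_(x in S) (terminal_density g x + 1 * (eps * m0 * a x) - 1 * (eps * b x))%:E =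
      \int[L]_(x in S) (terminal_density g x)%:E + (eps * m0)%:E * \int[L]_(x in S) (a x)%:E -
      eps%:E * \int[L]_(x in S) (b x)%:E)%E.
    rewrite -(integralZl mS (iS _ ia)) -(integralZl mS (iS _ ib)).
    rewrite -(integralD mS (iS _ iDr) (integrableZl mS _ (iS _ ia))).
    rewrite -(integralB mS (integrableD mS (iS _ iDr) (integrableZl mS _ (iS _ ia)))
      (integrableZl mS _ (iS _ ib))).
    by apply: eq_integral => x _; rewrite !mul1r.
  have nS : n S = (\int[L]_(x in S) (a x)%:E)%E by rewrite nE n0E.
  have := pi'2 S mS; rewrite -nuE bE// m0E terminal_densityE//.
  rewrite [X in (m0%:E * X)%E]nS.
  rewrite (finE _ ia) (finE _ ib) (finE _ iDr) -!EFinM -!EFinD.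
  by case: (pi' _) => [r||]//= [] /arith3 ->.
- have quad' : (quadratic_cost tau pi' <= quadratic_cost tau (gamma g) +
      (eps * m0 * (k2 - k1))%:E)%E.
    rewrite (_ : (eps * m0 * (k2 - k1))%:E = ((eps * (k2 - k1))%:E * gamma g B1)%E); last first.
      by rewrite m0E -EFinM; congr EFin; ring.
    apply: (pi'c tcost k1 k2) => //.
    + exact: measurable_tcost.
    + exact: tcost_ge0.
    + by have := quadratic_cost_fin g; rewrite ge0_fin_numE.
    + by move=> p /hB1[].
    + move=> p B1p; have mcp : measurable_fun setT (fun z => (tcost (p.1, z))%:E).
        apply/measurable_EFinP; apply: (measurableT_comp measurable_tcost).
        exact: measurable_fun_pair (measurable_cst _) (@measurable_id _ _ _).
      rewrite (@eq_measure_integral _ _ _ _ n0); last by move=> C _ _; exact: nE.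
      rewrite (ge0_integral_density ma a0 n0T n0E mcp); last first.
        by move=> z; rewrite lee_fin tcost_ge0.
      rewrite -[leRHS]mule1 -a1 -(integralZl measurableT ia).
      apply: ge0_le_integral => //.
      * by move=> z _; rewrite -EFinM lee_fin mulr_ge0// tcost_ge0.
      * by apply: emeasurable_funM => //; exact/measurable_EFinP.
      * by apply: emeasurable_funM => //; exact/measurable_EFinP.
      * move=> z _; rewrite -!EFinM lee_fin /a; case: (I01 z) => [->|[_ Bz]].
          by rewrite mul0r !mulr0.
        by apply: ler_wpM2r; [exact: a0|exact: hk2].
  rewrite /cost (bigD1 g)//= [X in (_ <= X + _ + _)%E](bigD1 g)//=.
  rewrite {1}/gamma' eqxx [X in (_ + X + _ <= _)%E]
    (eq_bigr (fun i => quadratic_cost tau (gamma i))); last first.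
    by move=> i /negbTE ig; rewrite /gamma' ig.
  set q := quadratic_cost tau (gamma g); set S := (\sum_(i | _) _)%E.
  set T := (_ * _)%E; set D := (eps * m0 * (k2 - k1))%:E.
  have -> : (q + S + T + D = q + D + S + T)%E by rewrite (addeAC _ T) (addeAC q).
  by do 2!apply: leeD2r.
Qed.

(** * Pointwise first-order inequalities *)

Let w x g := u x g * expR (V x g).

Let w0 x g : 0 <= w x g.
Proof. by rewrite mulr_ge0 ?expR_ge0. Qed.

Let mw g : measurable_fun setT (w^~ g).
Proof.
by apply: measurable_funM => //; exact: measurableT_comp.
Qed.

Let expR_lt_split (t a : R) : 0 <= a -> a < expR t -> exists2 t', t' < t & a <= expR t'.
Proof.
rewrite le_eqVlt => /orP[/eqP <- _|a0 at_].
  by exists (t - 1); rewrite ?expR_ge0// ltrBlDr ltrDl.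
by exists (ln a); rewrite ?lnK ?posrE// -ltr_expR lnK ?posrE.
Qed.

Let rat_between (a b : R) : a < b -> exists q : rat, a < ratr q < b.
Proof. by move=> /rat_in_itvoo[q]; rewrite in_itv/=; exists q. Qed.

(** A violation at [x] puts [x] in one of countably many sets with rational bounds, which are null
    by [jump_step]. Only [w x g'] has to be positive: the form with [expR] then yields positivity of
    [w x g], which a logarithm would presuppose. *)
Lemma jump_ae g g' : 0 < K g g' -> {ae L, forall x, 0 < w x g' ->
  expR (h g g' x + ln (w x g')) <= w x g}.
Proof.
move=> Kgg'; have [<-|gg'] := eqVneq g g'.
  apply/aeW => x w1; rewrite (_ : h g g x = 0) ?add0r ?lnK//.
  by have := hN g g x; lra.
pose S (i : rat * rat * rat) := [set x | ratr i.1.1 <= h g g' x] `&`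
  [set x | w x g <= expR (ratr i.1.2)] `&` [set x | expR (ratr i.2) <= w x g'].
have mS i : measurable (S i).
  by apply: measurableI; [apply: measurableI|]; apply: measurable_set_ler.
pose S' i := if ratr i.1.2 - ratr i.2 < ratr i.1.1 :> R then S i else set0.
have Sn i : L.-negligible (S' i).
  rewrite /S'; case: ifPn => [H|_]; last exact: negligible_set0.
  apply/(negligibleP _ (mS i))/eqP; apply: contraLR H => LS; rewrite -leNgt.
  by apply: (jump_step Kgg' gg' (mS i) LS) => x [[]].
apply: negligibleS (negligible_countable Sn) => x /= /not_implyP[wx /negP].
rewrite -ltNge => /(expR_lt_split (w0 x g))[t tlt wt].
(* A third of the gap, as three rational bounds are chosen, each with an error below [del]. *)
pose del := (h g g' x + ln (w x g') - t) / 3.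
have del0 : 0 < del by rewrite divr_gt0// subr_gt0.
have [k /andP[k1 k2]] : exists q : rat, h g g' x - del < ratr q < h g g' x.
  by apply: rat_between; rewrite ltrBlDr ltrDl.
have [s1 /andP[s11 s12]] : exists q : rat, t < ratr q < t + del.
  by apply: rat_between; rewrite ltrDl.
have [s2 /andP[s21 s22]] : exists q : rat, ln (w x g') - del < ratr q < ln (w x g').
  by apply: rat_between; rewrite ltrBlDr ltrDl.
exists (k, s1, s2) => //; rewrite /S' /= ifT; last first.
  have : del * 3 = h g g' x + ln (w x g') - t by rewrite /del divfK.
  lra.
split; [split|] => /=; first exact: ltW.
  by apply: le_trans wt _; rewrite ler_expR ltW.
by rewrite -[leRHS]lnK ?posrE// ler_expR ltW.
Qed.

Lemma continuous_tcost : continuous tcost.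
Proof.
move=> p; apply: cvgMr.
apply: (@continuous_comp _ _ _ (fun p : 'rV[R]_d * 'rV[R]_d => p.1 - p.2) (@sqnorm R d)).
  by apply: cvgB; [exact: cvg_fst|exact: cvg_snd].
exact/differentiable_continuous/differentiable_sqnorm.
Qed.

(** For each box of rational parameters, [transport_step] makes one of [B1] and [B2] null, and that
    one joins [N] or [M]. So [M] does not depend on [p], and the inequality holds for all [p]
    outside [N] and all [z] outside [M] at once; the supremum over [p] that defines the potential
    needs this. *)
Lemma transport_ae g : exists N M, [/\ (gamma g).-negligible N, L.-negligible M &
  forall p z, ~ N p -> ~ M z -> 0 < w p.2 g ->
    expR (ln (w p.2 g) + tcost p - tcost (p.1, z)) <= w z g].
Proof.
pose idx : countType := (rat * rat * rat * rat * 'rV[rat]_d * 'rV[rat]_d * nat * nat)%type.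
pose k1 (i : idx) : R := ratr i.1.1.1.1.1.1.1; pose k2 (i : idx) : R := ratr i.1.1.1.1.1.1.2.
pose s1 (i : idx) : R := ratr i.1.1.1.1.1.2; pose s2 (i : idx) : R := ratr i.1.1.1.1.2.
pose D1 (i : idx) := ball (map_mx ratr i.1.1.1.2 : 'rV[R]_d) i.1.2.+1%:R^-1.
pose D2 (i : idx) := ball (map_mx ratr i.1.1.2 : 'rV[R]_d) i.1.2.+1%:R^-1.
pose M (i : idx) : R := i.2.+1%:R.
pose B1 i := [set p | D1 i p.1] `&` [set p | k1 i <= tcost p] `&`
  ([set p | expR (s1 i) <= w p.2 g] `&` [set p | terminal_density g p.2 <= M i * u p.2 g]).
pose B2 i := D2 i `&` [set z | w z g <= expR (s2 i)].
(* The parameters contradict the conclusion of [transport_step], and the balls are so small that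
   [k2] bounds the cost between any of their points. *)
pose good i := s2 i + k2 i < s1 i + k1 i /\ forall x z, D1 i x -> D2 i z -> tcost (x, z) <= k2 i.
have msnd (f : 'rV[R]_d -> R) : measurable_fun setT f ->
    measurable_fun setT (fun p : 'rV[R]_d * 'rV[R]_d => f p.2).
  by move=> mf; exact: measurableT_comp mf measurable_snd.
have mB1 i : measurable (B1 i).
  apply: measurableI; apply: measurableI.
  - rewrite (_ : mkset _ = D1 i `*` setT); last first.
      by apply/seteqP; split=> [[x y]|[x y] []].
    by apply: measurableX => //; apply: borel_rV_open; exact: ball_open.
  - by apply: measurable_set_ler => //; exact: measurable_tcost.
  - by apply: measurable_set_ler => //; exact: (msnd (w^~ g)).
  - apply: measurable_set_ler; first
    exact: (msnd (terminal_density g) (measurable_terminal_density g)).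
    by apply: measurable_funM => //; exact: (msnd (u^~ g)).
have mB2 i : measurable (B2 i).
  apply: measurableI; first by apply: borel_rV_open; exact: ball_open.
  exact: measurable_set_ler.
have step i : good i -> gamma g (B1 i) = 0%E \/ L (B2 i) = 0%E.
  move=> [lt_k Dk]; have [gB|gB] := eqVneq (gamma g (B1 i)) 0%E; first by left.
  right; apply/eqP; apply: contraLR lt_k => LB; rewrite -leNgt.
  apply: (@transport_step g _ _ _ _ (M i) (B1 i) (B2 i)) => //.
  - by move=> p [[_ ?] [? ?]]; split.
  - by move=> z [].
  - by move=> p z [[? _] _] [? _]; exact: Dk.
pose N i := if `[< good i /\ gamma g (B1 i) = 0%E >] then B1 i else set0.
pose M' i := if `[< good i /\ L (B2 i) = 0%E >] then B2 i else set0.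
exists (\bigcup_i N i), (\bigcup_i M' i); split.
- apply: negligible_countable => i; rewrite /N; case: asboolP => [[_ H]|_].
    exact/negligibleP.
  exact: negligible_set0.
- apply: negligible_countable => i; rewrite /M'; case: asboolP => [[_ H]|_].
    exact/negligibleP.
  exact: negligible_set0.
move=> p z Np Mz wp; rewrite leNgt; apply/negP => /(expR_lt_split (w0 z g))[t tlt wt].
(* Four rational bounds cost less than [del] each, out of a gap of [5 * del]. *)
pose del := (ln (w p.2 g) + tcost p - tcost (p.1, z) - t) / 5.
have del0 : 0 < del by rewrite divr_gt0// subr_gt0.
have [a1 /andP[a11 a12]] : exists q : rat, tcost p - del < ratr q < tcost p.
  by apply: rat_between; rewrite ltrBlDr ltrDl.
have [a2 /andP[a21 a22]] : exists q : rat, tcost (p.1, z) < ratr q < tcost (p.1, z) + del.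
  by apply: rat_between; rewrite ltrDl.
have [b1 /andP[b11 b12]] : exists q : rat, ln (w p.2 g) - del < ratr q < ln (w p.2 g).
  by apply: rat_between; rewrite ltrBlDr ltrDl.
have [b2 /andP[b21 b22]] : exists q : rat, t < ratr q < t + del.
  by apply: rat_between; rewrite ltrDl.
have [e e0 eP] : exists2 e : R, 0 < e & forall x' z', ball p.1 e x' -> ball z e z' ->
    tcost (x', z') <= ratr a2.
  have [] := cvgr_lt _ (@continuous_tcost (p.1, z)) _ a21.
  move=> [P1 P2] [/= /nbhs_ballP[e1 /= e10 P1e] /nbhs_ballP[e2 /= e20 P2e]] P12.
  exists (Num.min e1 e2); first by rewrite lt_min e10.
  move=> x' z' px zz; apply/ltW/(P12 (x', z')); split => /=.
    by apply: P1e; apply: le_ball px; rewrite ge_min lexx.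
  by apply: P2e; apply: le_ball zz; rewrite ge_min lexx orbT.
have [r] : exists r, 0 + r.+1%:R^-1 < e / 2 by apply: ltr_add_invr; rewrite divr_gt0.
rewrite add0r => re; have r0 : 0 < r.+1%:R^-1 :> R by rewrite invr_gt0.
have [q1 pq1] := rat_dense_ball_rV p.1 r0.
have [q2 zq2] := rat_dense_ball_rV z r0.
have up : 0 < u p.2 g by move: wp; rewrite /w pmulr_lgt0 ?expR_gt0.
have [m mP] : exists m : nat, terminal_density g p.2 <= m.+1%:R * u p.2 g.
  exists (Num.truncn (terminal_density g p.2 / u p.2 g)).
  by rewrite -ler_pdivrMr// ltW// truncnS_gt.
pose i : idx := (a1, a2, b1, b2, q1, q2, r, m).
have ball2 (x q y : 'rV[R]_d) : ball q r.+1%:R^-1 x -> ball q r.+1%:R^-1 y -> ball x e y.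
  move=> qx qy; apply: (@ball_splitr _ _ q); exact: (le_ball (ltW re)).
have gi : good i.
  split; first last.
    by move=> x z' /= Dx Dz; apply: eP; [exact: ball2 pq1 Dx|exact: ball2 zq2 Dz].
  have : del * 5 = ln (w p.2 g) + tcost p - tcost (p.1, z) - t by rewrite /del divfK.
  by rewrite /s1 /s2 /k1 /k2 /=; lra.
have Bp : B1 i p.
  split; split => //=; rewrite /k1 /s1 /=; first exact: ltW.
  by rewrite -[leRHS]lnK ?posrE// ler_expR ltW.
have Bz : B2 i z.
  by split => //=; rewrite /s2/= (le_trans wt)// ler_expR ltW.
have [gB|LB] := step i gi.
  by apply: Np; exists i => //; rewrite /N; case: asboolP => // -[].
by apply: Mz; exists i => //; rewrite /M'; case: asboolP => // -[].
Qed.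

(** * The maximum principle *)

Context (f : 'rV[R]_d -> G -> R) (lam Lam : R).
Hypothesis K_connected : forall g g', connect (fun a b => 0 < K a b) g g'.
Hypothesis lam_gt0 : 0 < lam.
Hypothesis Lam_gt0 : 0 < Lam.
Hypothesis df : is_density mu f.
Hypothesis f_bounds : {ae L, forall x, forall g,
  lam * expR (- V x g) <= f x g <= Lam * expR (- V x g)}.

Lemma negligible_snd g M : L.-negligible M ->
  (gamma g).-negligible [set p | M p.2].
Proof.
move=> [N [mN N0 MN]]; exists (setT `*` N); split; first exact: measurableX.
  rewrite terminal_densityE// null_set_integral//.
  apply/measurable_EFinP/measurable_funTS; exact: measurable_terminal_density.
by move=> p Mp; split => //; exact: MN.
Qed.

Lemma negligible_fst g M : L.-negligible M ->
  (gamma g).-negligible [set p | M p.1].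
Proof.
move=> [N [mN N0 MN]]; exists (N `*` setT); split; first exact: measurableX.
  have [mf _ fE] := df.
  rewrite gamma1// fE// null_set_integral//.
  exact/measurable_EFinP/measurable_funTS.
by move=> p Mp; split => //; exact: MN.
Qed.

(** Discrete integration by parts: exchanging [g] and [g'] reverses the sign of the flux. *)
Lemma sum_antisym (B : G -> R) (x : 'rV[R]_d) :
  \sum_g \sum_g' B g * (h g g' x * K g g' * expR (- W x)) =
  2^-1 * \sum_g \sum_g' (B g - B g') * (h g g' x * K g g' * expR (- W x)).
Proof.
set S := LHS.
have S2 : \sum_g \sum_g' B g' * (h g g' x * K g g' * expR (- W x)) = - S.
  rewrite exchange_big /S -sumrN; apply: eq_bigr => a _.
  rewrite -sumrN; apply: eq_bigr => b _; rewrite hN K_sym; ring.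
have -> : \sum_g \sum_g' (B g - B g') * (h g g' x * K g g' * expR (- W x)) = S - - S.
  rewrite -S2 /S -sumrB; apply: eq_bigr => a _.
  by rewrite -sumrB; apply: eq_bigr => b _; ring.
by field.
Qed.

Lemma terminal_density_sum x : \sum_g terminal_density g x = \sum_g u x g.
Proof.
rewrite /terminal_density big_split/= -mulr_sumr.
have := sum_antisym (fun=> 1) x.
rewrite (eq_bigr (fun g => \sum_g' (h g g' x * K g g' * expR (- W x)))); last first.
  by move=> g _; apply: eq_bigr => g' _; rewrite mul1r.
move=> ->; rewrite [X in 2^-1 * X]big1 ?mulr0 ?addr0// => g _.
by rewrite big1// => g' _; rewrite subrr mul0r.
Qed.

Lemma jump_ae_all : {ae L, forall x, forall g g', 0 < K g g' -> 0 < w x g' ->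
  expR (h g g' x + ln (w x g')) <= w x g}.
Proof.
apply: filter_forall => g; apply: filter_forall => g'.
have [Kgg'|Kgg'] := boolP (0 < K g g'); last by apply/aeW.
by apply: filterS (jump_ae Kgg') => x H _.
Qed.

Let w_gt0 x g : (0 < w x g) = (0 < u x g).
Proof. by rewrite /w pmulr_lgt0 ?expR_gt0. Qed.

(** By [jump_ae], positivity of [w] passes from a node to its neighbours, hence along paths to every
    node. *)
Lemma zero_or_pos : {ae L, forall x, (forall g, u x g = 0) \/ (forall g, 0 < u x g)}.
Proof.
apply: filterS jump_ae_all => x H.
have [[g0 ug0]|nex] := pselect (exists g, 0 < u x g); last first.
  by left=> g; apply/eqP; rewrite eq_le u0 andbT leNgt; apply/negP => ug; apply: nex; exists g.
right=> g; have /connectP[p] := K_connected g0 g.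
elim: p g0 ug0 => [|a p IH] g0 ug0 /=; first by move=> _ ->.
move=> /andP[Ka pathp] lastp; apply: (IH a) => //.
have := H a g0; rewrite K_sym => /(_ Ka); rewrite w_gt0 => /(_ ug0).
by move/(lt_le_trans (expR_gt0 _)); rewrite w_gt0.
Qed.

(** Up to a null set, [u] vanishes at [g] only where it vanishes at all nodes. There the densities
    of the second marginals add up to zero, and marginals are nonnegative measures. *)
Lemma gamma_zero g : (gamma g).-negligible [set p | u p.2 g = 0].
Proof.
pose Z := \bigcap_(g in [set: G]) [set x | u x g = 0].
have mZ : measurable Z.
  apply: fin_bigcap_measurable; first exact: finite_finset.
  move=> a _; rewrite (_ : mkset _ = [set x | u x a <= cst 0 x]).
    exact: measurable_set_ler.
  by apply/seteqP; split=> x /= ux; [rewrite ux|apply/le_anti; rewrite ux u0].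
have Z0 : gamma g (setT `*` Z) = 0%E.
  have : (\sum_g gamma g (setT `*` Z) = 0)%E.
    under eq_bigr do rewrite terminal_densityE//.
    rewrite -integral_sum//; last first.
      by move=> a; apply: integrableS (integrable_terminal_density a).
    apply: integral0_eq => x Zx; rewrite sumEFin terminal_density_sum.
    by rewrite big1// => a _; exact: Zx.
  move=> sum0; apply/le_anti/andP; split; last exact: measure_ge0.
  by rewrite -sum0 (bigD1 g)//= leeDl// sume_ge0.
have [M0 [mM M00 Msub]] := zero_or_pos.
apply: (@negligibleS _ _ _ _ ([set p | M0 p.2] `|` (setT `*` Z))).
  move=> p /= up; have [Mp|Mp] := pselect (M0 p.2); [by left|right; split => //].
  have : ~ (~` [set x | (forall g, u x g = 0) \/ (forall g, 0 < u x g)]) p.2.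
    by move=> /Msub.
  move/contrapT => [H a _|/(_ g)]; [exact: H|by rewrite up ltxx].
apply: negligibleU.
  by apply: negligible_snd; exists M0; split.
by apply/negligibleP => //; exact: measurableX.
Qed.

Lemma gamma_neq0 g : gamma g setT != 0%E.
Proof.
rewrite -setXTT gamma1//; have [mf f0 fE] := df; rewrite fE//.
rewrite gt_eqF//.
have mexp : measurable_fun setT (fun x => lam * expR (- V x g)).
  by apply: measurable_funM => //; apply: measurableT_comp => //; exact: measurable_funN.
apply: (@lt_le_trans _ _ (\int[L]_x (lam * expR (- V x g))%:E)%E).
  rewrite [X in (_ < X)%E](_ : _ =
      \int[L]_x (\1_(setT : set 'rV[R]_d) x * (lam * expR (- V x g)))%:E)%E; last first.
    by apply: eq_integral => x _; rewrite indicT mul1r.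
  apply: integral_indic_gt0 => //; first by move=> x; rewrite mulr_gt0 ?expR_gt0.
  rewrite gt_eqF// (lt_le_trans (lebesgue_rV_ball_gt0 (0 : 'rV[R]_d) ltr01))//.
  apply: le_measure; rewrite ?inE//.
  by apply: borel_rV_open; exact: ball_open.
apply: ae_ge0_le_integral => //.
- by move=> x _; rewrite lee_fin mulr_ge0 ?expR_ge0// ltW.
- exact/measurable_EFinP.
- by move=> x _; rewrite lee_fin.
- exact/measurable_EFinP.
- by apply: filterS f_bounds => x /(_ g) /andP[? _] _; rewrite lee_fin.
Qed.

(** The logarithmic form of [transport_ae], now that plans end where [u] is positive. Both endpoints
    avoid [M], so [z = p.1] may be tested and [p.2] is itself a regular point. *)
Lemma contact g : exists N M, [/\ (gamma g).-negligible N, L.-negligible M &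
  forall p, ~ N p -> [/\ ~ M p.1, ~ M p.2, 0 < u p.2 g & forall z, ~ M z ->
    0 < u z g /\ ln (w p.2 g) + tcost p <= ln (w z g) + tcost (p.1, z)]].
Proof.
have [N [M [Nn Mn H]]] := transport_ae g.
exists (N `|` [set p | u p.2 g = 0] `|` ([set p | M p.1] `|` [set p | M p.2])), M; split=> //.
  apply: negligibleU; apply: negligibleU => //.
  - exact: gamma_zero.
  - exact: negligible_fst.
  - exact: negligible_snd.
move=> p /not_orP[/not_orP[Np up] /not_orP[M1 M2]].
have up0 : 0 < u p.2 g by rewrite lt0r u0 andbT; apply/eqP.
split => // z Mz; have := H p z Np Mz; rewrite w_gt0 => /(_ up0) Hz.
have wz : 0 < w z g by apply: lt_le_trans Hz; exact: expR_gt0.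
split; first by rewrite -w_gt0.
by move: Hz; rewrite -[leRHS](lnK (x := w z g)) ?posrE// ler_expR; lra.
Qed.

(** One contact pair suffices, since its inequality bounds [w z g] away from zero for almost every
    [z]; it exists because [gamma g] has positive mass. *)
Lemma u_pos : {ae L, forall x, forall g, 0 < u x g}.
Proof.
apply: filter_forall => g; have [N [M [Nn Mn H]]] := contact g.
have [p Np] : exists p, ~ N p.
  apply/existsNP => NT; move: (gamma_neq0 g); apply/negP/negPn/eqP/negligibleP => //.
  by apply: negligibleS Nn => p _; exact: NT.
apply: negligibleS Mn => z /= uz; apply: contrapT => Mz; apply: uz.
by have [_ _ _ /(_ z Mz)[]] := H p Np.
Qed.

Lemma jump_formula : {ae L, forall x, forall g g', 0 < K g g' ->
  h g g' x = ln (w x g) - ln (w x g')}.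
Proof.
apply: filterS2 u_pos jump_ae_all => x up H g g' Kgg'.
have wp a : 0 < w x a by rewrite w_gt0.
have le a b : 0 < K a b -> h a b x <= ln (w x a) - ln (w x b).
  move=> Kab; have := H a b Kab (wp b).
  by rewrite -[leRHS]lnK ?posrE// ler_expR lerBrDr.
apply/le_anti; rewrite le//=; have := le g' g; rewrite K_sym => /(_ Kgg').
by rewrite hN; lra.
Qed.

Let mono_ln (s a b : R) : s = 1 \/ s = - 1 -> 0 < a -> 0 < b -> s * a <= s * b ->
  0 <= s * (ln b - ln a).
Proof.
move=> [->|->] a0 b0; rewrite ?mul1r ?mulN1r.
  by rewrite subr_ge0 ler_ln.
by rewrite lerN2 opprB subr_ge0 ler_ln.
Qed.

Lemma gamma_le g X Y N : measurable X -> measurable Y -> (gamma g).-negligible N ->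
  (forall p, ~ N p -> X p -> Y p) -> (gamma g X <= gamma g Y)%E.
Proof.
move=> mX mY [N' [mN N0 NN]] XY.
apply: (@le_trans _ _ (gamma g (Y `|` N'))).
  apply: le_measure; rewrite ?inE//; first exact: measurableU.
  move=> p Xp; have [Np|Np] := pselect (N p); first by right; exact: NN.
  by left; exact: XY.
apply: (@le_trans _ _ (gamma g Y + gamma g N')%E); first exact: measureU2.
by rewrite [X in (_ + X)%E]N0 adde0.
Qed.

(* Where [s * w] is large, transport only exports mass and jumps only remove it.
   The sign [s] treats the upper and the lower bound at once. *)
Lemma maximum_principle (s b : R) : s = 1 \/ s = - 1 ->
  {ae L, forall x, forall g, s * f x g <= s * (b * expR (- V x g))} ->
  {ae L, forall x, forall g, s * w x g <= s * b}.
Proof.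
move=> s1 fb; have [mf f0 fE] := df.
pose B g := [set x | s * b < s * w x g].
have mB g : measurable (B g).
  by apply: measurable_set_ltr => //; exact: measurable_funM.
pose I g x : R := \1_(B g) x.
have I01 g x : I g x = 0 \/ I g x = 1.
  by rewrite /I indicE; case: (_ \in _); [right|left].
have iexp g : L.-integrable setT (EFin \o (fun x => b * expR (- V x g))).
  by have := integrableZl measurableT b (integrable_expRV g); exact: eq_integrable.
have if_ g : L.-integrable setT (EFin \o f^~ g) := density_integrable g df.
(* By [contact] with [z = p.1], plans decrease [w]. For [s = 1], mass that ends in [B g] has started
   there; for [s = - 1], mass that starts in [B g] stays there. *)
have transport g : (\int[L]_(x in B g) (s * terminal_density g x)%:E <=
    \int[L]_(x in B g) (s * f x g)%:E)%E.
  have iS (k : 'rV[R]_d -> R) : L.-integrable setT (EFin \o k) -> L.-integrable (B g) (EFin \o k).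
    by apply: integrableS.
  under eq_integral do rewrite EFinM.
  under [leRHS]eq_integral do rewrite EFinM.
  rewrite (integralZl (mB g) (iS _ (integrable_terminal_density g))).
  rewrite (integralZl (mB g) (iS _ (if_ g))) -terminal_densityE// -fE//.
  rewrite -gamma1//; have [N [M [Nn Mn H]]] := contact g.
  have m1 : measurable (setT `*` B g : set ('rV[R]_d * 'rV[R]_d)) by exact: measurableX.
  have m2 : measurable (B g `*` setT : set ('rV[R]_d * 'rV[R]_d)) by exact: measurableX.
  have dec p : ~ N p -> w p.2 g <= w p.1 g.
    move=> /H[M1 _ up /(_ _ M1)[up1]].
    have -> : tcost (p.1, p.1) = 0.
      by rewrite /tcost subrr /sqnorm big1 ?mulr0// => i _; rewrite mxE expr0n.
    rewrite addr0 => /(le_trans _) le1.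
    have : ln (w p.2 g) <= ln (w p.1 g) by apply: le1; rewrite lerDl tcost_ge0.
    by rewrite ler_ln ?posrE ?w_gt0.
  case: s1 => sE; rewrite sE.
    rewrite !mul1e; apply: (gamma_le m1 m2 Nn) => p /dec wp [_]; rewrite /B sE /= !mul1r.
    by move=> /lt_le_trans/(_ wp).
  rewrite !EFinN !mulN1e leeN2; apply: (gamma_le m2 m1 Nn) => p /dec wp [+ _].
  rewrite /B sE /= !mulN1r !ltrN2 => lt1; split => //=.
  exact: le_lt_trans lt1.
pose T0 g x := s * (terminal_density g x - b * expR (- V x g)).
pose U0 g x := s * (u x g - b * expR (- V x g)).
have mI g : measurable_fun setT (I g) by exact: measurable_indic.
have iT0 g : L.-integrable setT (EFin \o T0 g).
  have := integrableZl measurableT s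
    (integrableB measurableT (integrable_terminal_density g) (iexp g)).
  exact: eq_integrable.
have iU0 g : L.-integrable setT (EFin \o U0 g).
  have := integrableZl measurableT s (integrableB measurableT (iu g) (iexp g)).
  exact: eq_integrable.
have iI (k : 'rV[R]_d -> R) g : L.-integrable setT (EFin \o k) ->
    L.-integrable setT (EFin \o (fun x => I g x * k x)).
  move=> ik; apply: (integrable_le (g := fun x => `|k x|)).
  - apply: measurable_funM => //; apply/measurable_EFinP; exact: measurable_int ik.
  - by move=> x; case: (I01 g x) => ->; rewrite ?mul0r ?normr0 ?mul1r.
  - by have := integrable_abse ik.
have intI g (k : 'rV[R]_d -> R) :
    (\int[L]_(x in B g) (k x)%:E = \int[L]_x (I g x * k x)%:E)%E.
  rewrite integral_mkcond; apply: eq_integral => x _.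
  by rewrite patchE /I indicE; case: ifP => _; rewrite ?mul1r ?mul0r.
have isf g : L.-integrable setT (EFin \o (fun x => s * f x g)).
  by have := integrableZl measurableT s (if_ g); exact: eq_integrable.
have isb g : L.-integrable setT (EFin \o (fun x => s * (b * expR (- V x g)))).
  by have := integrableZl measurableT s (iexp g); exact: eq_integrable.
have ist g : L.-integrable setT (EFin \o (fun x => s * terminal_density g x)).
  by have := integrableZl measurableT s (integrable_terminal_density g); exact: eq_integrable.
have T0le g : (\int[L]_x (I g x * T0 g x)%:E <= 0)%E.
  have -> : (\int[L]_x (I g x * T0 g x)%:E = \int[L]_x (I g x * (s * terminal_density g x))%:E -
      \int[L]_x (I g x * (s * (b * expR (- V x g))))%:E)%E.
    rewrite -(integralB measurableT (iI _ g (ist g)) (iI _ g (isb g))).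
    by apply: eq_integral => x _; rewrite /= -EFinB /T0; congr EFin; ring.
  rewrite (integral_finE (iI _ g (isb g))) leeBlDr// add0e -(integral_finE (iI _ g (isb g))).
  rewrite -intI (le_trans (transport g))// intI.
  apply: ae_le_integral; [exact: iI|exact: iI|].
  apply: filterS fb => x fbx; case: (I01 g x) => ->; rewrite ?mul0r// !mul1r.
  exact: fbx.
have U0gt x g : B g x -> 0 < U0 g x.
  rewrite /B /= -subr_gt0 -(pmulr_lgt0 (U0 g x) (expR_gt0 (V x g))).
  rewrite (_ : U0 g x * _ = s * w x g - s * b * (expR (- V x g) * expR (V x g))); last first.
    by rewrite /U0 /w; ring.
  by rewrite -expRD addNr expR0 mulr1.
have U0ge x g : 0 <= I g x * U0 g x.
  rewrite /I indicE; have [/set_mem Bx|_] := boolP (x \in B g); last by rewrite mul0r.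
  by rewrite mul1r ltW// U0gt.
(* The difference of both sides is the jump term. After [sum_antisym] each edge contributes a
   product of [I g x - I g' x] and [s * (ln (w x g) - ln (w x g'))]; this is nonnegative, as the
   indicator increases with [s * w]. *)
have le_ae : {ae L, forall x, \sum_g I g x * U0 g x <= \sum_g I g x * T0 g x}.
  apply: filterS2 u_pos jump_formula => x up hx.
  rewrite -subr_ge0 -sumrB.
  rewrite (eq_bigr (fun g => s * tau *
    \sum_g' I g x * (h g g' x * K g g' * expR (- W x)))); last first.
    by move=> g _; rewrite /T0 /U0 /terminal_density -mulr_sumr; ring.
  rewrite -mulr_sumr sum_antisym.
  rewrite (_ : s * tau * (2^-1 * _) = tau / 2 *
      \sum_g \sum_g' s * ((I g x - I g' x) * (h g g' x * K g g' * expR (- W x)))); last first.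
    under [in RHS]eq_bigr => g _ do rewrite -mulr_sumr.
    by rewrite -mulr_sumr; ring.
  rewrite mulr_ge0 ?divr_ge0 ?(ltW tau_gt0)//.
  apply: sumr_ge0 => g _; apply: sumr_ge0 => g' _.
  have [K0|Kgg'] := eqVneq (K g g') 0; first by rewrite K0 !(mulr0, mul0r).
  have {}Kgg' : 0 < K g g' by rewrite lt0r Kgg'/=.
  rewrite hx//.
  rewrite (_ : s * _ = K g g' * expR (- W x) *
    ((I g x - I g' x) * (s * (ln (w x g) - ln (w x g'))))); last by ring.
  apply: mulr_ge0; first by rewrite mulr_ge0 ?expR_ge0 ?(ltW Kgg').
  have wp a : 0 < w x a by rewrite w_gt0.
  rewrite /I !indicE; have [/set_mem B1|/negP B1] := boolP (x \in B g);
    have [/set_mem B2|/negP B2] := boolP (x \in B g'); rewrite ?subrr ?mul0r//.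
  - rewrite subr0 mul1r; apply: mono_ln => //; apply: le_trans (ltW B1).
    by rewrite leNgt; apply/negP => B2'; apply: B2; rewrite inE.
  - rewrite sub0r mulN1r -mulrN opprB; apply: mono_ln => //; apply: le_trans (ltW B2).
    by rewrite leNgt; apply/negP => B1'; apply: B1; rewrite inE.
have sum_int (k : G -> 'rV[R]_d -> R) : (forall g, L.-integrable setT (EFin \o k g)) ->
    L.-integrable setT (EFin \o (fun x => \sum_g I g x * k g x)) /\
    (\int[L]_x (\sum_g I g x * k g x)%:E = \sum_g \int[L]_x (I g x * k g x)%:E)%E.
  move=> ik; split.
    have := @integrable_sum _ _ _ L setT measurableT _ (index_enum G) xpredT
      (fun g x => (I g x * k g x)%:E) (fun g _ => iI _ g (ik g)).
    by apply: eq_integrable => // x _; rewrite /= sumEFin.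
  rewrite -integral_sum//; last by move=> g; exact: iI.
  by apply: eq_integral => x _; rewrite sumEFin.
have [isT sT] := sum_int T0 iT0; have [isU sU] := sum_int U0 iU0.
(* The integrands are nonnegative, and positive on [B g]; a total that is not positive makes every
   [B g] null. *)
have sumU : (\sum_g \int[L]_x (I g x * U0 g x)%:E <= 0)%E.
  rewrite -sU (le_trans (ae_le_integral isU isT le_ae))// sT.
  by apply: sume_le0 => g _; exact: T0le.
apply: filter_forall => g.
have Ug : (\int[L]_x (I g x * U0 g x)%:E <= 0)%E.
  apply: le_trans sumU; rewrite (bigD1 g)//= leeDl// sume_ge0// => a _.
  by apply: integral_ge0 => x _; rewrite lee_fin.
have Ug0 : (\int[L]_x `|(I g x * U0 g x)%:E| = 0)%E.
  under eq_integral do rewrite gee0_abs ?lee_fin//.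
  by apply/le_anti/andP; split => //; apply: integral_ge0 => x _; rewrite lee_fin.
have mIU : measurable_fun setT (fun x => (I g x * U0 g x)%:E).
  exact: measurable_int (iI _ g (iU0 g)).
have : ae_eq L setT (fun x => (I g x * U0 g x)%:E) (cst 0%E).
  by apply/(ae_eq_integral_abs _ measurableT mIU).
apply: filterS => x /(_ Logic.I) /= [] IU; rewrite leNgt; apply/negP => Bx.
have := U0gt x g Bx; move: IU; rewrite /I indicE mem_set// mul1r => ->.
by rewrite ltxx.
Qed.

Lemma bounds : {ae L, forall x, forall g, lam <= w x g <= Lam}.
Proof.
have H1 := maximum_principle (s := 1) (b := Lam) (or_introl erefl).
have H2 := maximum_principle (s := - 1) (b := lam) (or_intror erefl).
have {}H1 : {ae L, forall x, forall g, 1 * w x g <= 1 * Lam}.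
  apply: H1; apply: filterS f_bounds => x fx g.
  by have /andP[_] := fx g; rewrite !mul1r.
have {}H2 : {ae L, forall x, forall g, - 1 * w x g <= - 1 * lam}.
  apply: H2; apply: filterS f_bounds => x fx g.
  by have /andP[+ _] := fx g; rewrite !mulN1r lerN2.
apply: filterS2 H1 H2 => x H1 H2 g; have := H1 g; have := H2 g.
by rewrite !mul1r !mulN1r lerN2 => -> ->.
Qed.

(** The jumps change the density at a node by at most [tau * C0 * u]: [jump_formula] and [bounds]
    give [|h| <= |ln Lam - ln lam|] along edges, and [expR (- W) <= u / (lam * lam')]. *)
Let C0 := `|ln Lam - ln lam| * (\sum_g \sum_g' K g g') / (lam * lam').

Hypothesis tau_small : tau * C0 < 1.

Let u_ge_expRW x g : lam <= w x g -> expR (- W x) <= u x g / (lam * lam').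
Proof.
move=> lw; rewrite ler_pdivlMr ?mulr_gt0// mulrCA mulrC.
rewrite (_ : u x g = w x g * expR (- V x g)); last by rewrite /w -mulrA -expRD subrr expR0 mulr1.
apply: (@le_trans _ _ (lam * expR (- V x g))); last by rewrite ler_wpM2r ?expR_ge0.
by rewrite mulrC ler_wpM2l ?(ltW lam_gt0)// mulrC.
Qed.

(** This allows statements about [gamma g]-almost every endpoint to be read as statements about
    Lebesgue-almost every point. *)
Lemma terminal_density_gt0 : {ae L, forall x, forall g, 0 < terminal_density g x}.
Proof.
apply: filterS3 bounds u_pos jump_formula => x wb up hx g.
pose D := `|ln Lam - ln lam|; pose SK := \sum_a \sum_b K a b.
have lnw a : ln lam <= ln (w x a) <= ln Lam.
  have /andP[w1 w2] := wb a; have wa : 0 < w x a := lt_le_trans lam_gt0 w1.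
  by rewrite !ler_ln ?posrE// w1 w2.
have hK b : - (D * K g b) <= h g b x * K g b.
  have [->|K0] := eqVneq (K g b) 0; first by rewrite !mulr0 oppr0.
  have Kb : 0 < K g b by rewrite lt0r K0/=.
  rewrite -mulNr ler_wpM2r// hx//.
  have /andP[a1 a2] := lnw g; have /andP[b1 b2] := lnw b.
  by have := ler_norm (ln Lam - ln lam); rewrite -/D; lra.
have sumK : \sum_b K g b <= SK.
  by rewrite /SK [leRHS](bigD1 g)//= lerDl sumr_ge0// => a _; exact: sumr_ge0.
have low : - (D * SK * expR (- W x)) <= \sum_b h g b x * K g b * expR (- W x).
  rewrite -mulr_suml -mulNr ler_wpM2r ?expR_ge0//.
  apply: (@le_trans _ _ (\sum_b - (D * K g b))); last by apply: ler_sum.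
  by rewrite sumrN lerN2 -mulr_sumr ler_wpM2l// normr_ge0.
have DSK : 0 <= D * SK.
  by rewrite mulr_ge0 ?normr_ge0// sumr_ge0// => a _; exact: sumr_ge0.
have eW : D * SK * expR (- W x) <= C0 * u x g.
  have /andP[w1 _] := wb g.
  rewrite (_ : C0 * u x g = D * SK * (u x g / (lam * lam'))); last by rewrite /C0 -/D -/SK; ring.
  by rewrite ler_wpM2l// u_ge_expRW.
apply: (@lt_le_trans _ _ (u x g - tau * (C0 * u x g))).
  by rewrite mulrA -[X in X - _]mul1r -mulrBl mulr_gt0// subr_gt0.
rewrite /terminal_density lerD2l -mulrN ler_wpM2l ?(ltW tau_gt0)//.
by apply: le_trans low; rewrite lerN2.
Qed.

(** * The convex potential and the transport map *)

(* [psi] is the supremum over [p] in [A] of the functions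
   [z |-> q p.2 + tcost p - tcost (p.1, z) + |z|^2 / (2 tau)], which are affine. *)
Lemma contact_envelope (A : set ('rV[R]_d * 'rV[R]_d)) (M : set 'rV[R]_d)
    (q : 'rV[R]_d -> R) (C : R) : A !=set0 -> L.-negligible M ->
  (forall z, ~ M z -> q z <= C) ->
  (forall p, A p -> ~ M p.2) ->
  (forall p z, A p -> ~ M z -> q p.2 + tcost p <= q z + tcost (p.1, z)) ->
  exists psi : 'rV[R]_d -> R, affine_sup psi /\
    forall p, A p -> psi p.2 = q p.2 + (2 * tau)^-1 * sqnorm p.2 /\
      exists2 r, forall z, dotp (tau^-1 *: p.1) z + r <= psi z &
        psi p.2 = dotp (tau^-1 *: p.1) p.2 + r.
Proof.
move=> [p0 Ap0] Mn qC AM Aq.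
pose r (p : 'rV[R]_d * 'rV[R]_d) := q p.2 + tcost p - (2 * tau)^-1 * sqnorm p.1.
pose piece (p : 'rV[R]_d * 'rV[R]_d) z := dotp (tau^-1 *: p.1) z + r p.
have dotpZl k (x z : 'rV[R]_d) : dotp (k *: x) z = k * dotp x z.
  by rewrite /dotp mulr_sumr; apply: eq_bigr => i _; rewrite mxE mulrA.
have tcostE x z : tcost (x, z) =
    (2 * tau)^-1 * sqnorm x - tau^-1 * dotp x z + (2 * tau)^-1 * sqnorm z.
  rewrite /tcost/= sqnormB; field; exact: lt0r_neq0.
have pieceE p z : piece p z = q p.2 + tcost p - tcost (p.1, z) + (2 * tau)^-1 * sqnorm z.
  by rewrite /piece /r tcostE dotpZl; ring.
have pieceq p z : A p -> ~ M z -> piece p z <= q z + (2 * tau)^-1 * sqnorm z.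
  by move=> Ap Mz; rewrite pieceE lerD2r lerBlDr; exact: Aq.
(* The bound [C] on [q] is known only off [M], but pieces are continuous and the complement of [M]
   is dense. The bound at every [z] makes the supremum finite everywhere. *)
have pieceC p z : A p -> piece p z <= C + (2 * tau)^-1 * sqnorm z.
  move=> Ap; rewrite pieceE lerD2r lerBlDr leNgt; apply/negP => lt1.
  have : \forall y \near z, tcost (p.1, y) < q p.2 + tcost p - C.
    have ct : (fun y => tcost (p.1, y)) y @[y --> z] --> tcost (p.1, z).
      apply: (@differentiable_continuous _ _ _ z
        ((2 * tau)^-1 *: (@sqnorm R d \o (fun y => p.1 - y)))).
      apply: differentiableZ; apply: differentiable_comp; first exact: differentiableB.
      exact: differentiable_sqnorm.
    by apply: (cvgr_lt _ ct); rewrite ltrBrDl.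
  move=> /nbhs_ballP[e /= e0 ez].
  have [y yz My] := lebesgue_rV_dense z e0 Mn.
  have := ez _ yz; have := Aq p y Ap My; have := qC _ My; rewrite /=; lra.
pose P z := [set piece p z | p in A].
have P0 z : P z !=set0 by exists (piece p0 z), p0.
have Pub z : has_ubound (P z).
  by exists (C + (2 * tau)^-1 * sqnorm z) => _ [p Ap <-]; exact: pieceC.
have le_sup p z : A p -> piece p z <= sup (P z).
  by move=> Ap; apply: ub_le_sup => //; exists p.
exists (fun z => sup (P z)); split.
  move=> z e e0; have [_ [p Ap <-] lte] := sup_adherent e0 (conj (P0 z) (Pub z)).
  exists (tau^-1 *: p.1), (r p); split => // y; exact: le_sup.
move=> p Ap.
have E : sup (P p.2) = q p.2 + (2 * tau)^-1 * sqnorm p.2.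
  apply/le_anti/andP; split.
    by apply: ge_sup => // _ [p' Ap' <-]; apply: pieceq => //; exact: AM.
  apply: le_trans (le_sup p p.2 Ap); rewrite pieceE.
  by case: (p) => x y /=; lra.
split => //; exists (r p); first by move=> z; exact: le_sup.
rewrite E -/(piece p p.2) pieceE; case: (p) => x y /=; lra.
Qed.

(** The envelope for [q = ln w], bounded by [ln Lam]. Equality holds at the endpoint of almost every
    pair of the plan; the set where it fails thus has no mass under the second marginal, whose
    density is positive, so it is Lebesgue null. *)
Lemma potential g : exists psi, [/\ affine_sup psi,
  {ae L, forall y, psi y = ln (w y g) + (2 * tau)^-1 * sqnorm y} &
  {ae gamma g, forall p, exists2 r, forall z, dotp (tau^-1 *: p.1) z + r <= psi z &
     psi p.2 = dotp (tau^-1 *: p.1) p.2 + r}].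
Proof.
have [N [M [Nn Mn H]]] := contact g.
pose M' := ~` [set x | forall g, lam <= w x g <= Lam].
pose A := [set p | ~ N p /\ ~ M' p.2].
have An : (gamma g).-negligible (~` A).
  apply: (@negligibleS _ _ _ _ (N `|` [set p | M' p.2])).
    move=> p /not_andP[/contrapT|/contrapT]; by [left|right].
  by apply: negligibleU => //; apply: negligible_snd; exact: bounds.
have A0 : A !=set0.
  apply/set0P/negP => /eqP A0; move: (gamma_neq0 g); apply/negP/negPn/eqP/negligibleP => //.
  by apply: negligibleS An => p _; rewrite A0.
have MMn : L.-negligible (M `|` M') by apply: negligibleU => //; exact: bounds.
have [z /not_orP[_ Mz]|p [Np Mp']|p z [Np _] /not_orP[Mz _]|psi [psis psiA]] :=
    @contact_envelope A (M `|` M') (fun z => ln (w z g)) (ln Lam) A0 MMn.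
- move/contrapT: Mz => /(_ g) /andP[w1 w2].
  by rewrite ler_ln ?posrE// (lt_le_trans lam_gt0).
- by have [_ Mp _ _] := H p Np; move=> [].
- by have [_ _ _ /(_ z Mz)[]] := H p Np.
exists psi; split => //; last by apply: negligibleS An => p; apply: contra_not => /psiA[].
pose B := [set y | psi y <> ln (w y g) + (2 * tau)^-1 * sqnorm y].
have mpsi : measurable_fun setT psi := measurable_affine_sup psis.
have mq : measurable_fun setT (fun y => ln (w y g) + (2 * tau)^-1 * sqnorm y).
  apply: measurable_funD; first by apply: measurableT_comp (mw g).
  by apply: measurable_funM => //; exact: measurable_sqnorm.
have mB : measurable B.
  rewrite (_ : B = [set y | psi y < ln (w y g) + (2 * tau)^-1 * sqnorm y] `|`
      [set y | ln (w y g) + (2 * tau)^-1 * sqnorm y < psi y]).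
    by apply: measurableU; exact: measurable_set_ltr.
  apply/seteqP; split => y /=.
    by move/eqP; rewrite neq_lt => /orP.
  by move=> lt1; apply/eqP; rewrite neq_lt; apply/orP.
have B0 : (\int[L]_(x in B) (terminal_density g x)%:E = 0)%E.
  rewrite -terminal_densityE//; apply/negligibleP; first exact: measurableX.
  by apply: negligibleS An => p [_ Bp] Ap; apply: Bp; have [] := psiA p Ap.
have mt : measurable_fun B (EFin \o terminal_density g).
  by apply/measurable_funTS/measurable_EFinP; exact: measurable_terminal_density.
have : ae_eq L B (EFin \o terminal_density g) (cst 0%E).
  apply/(ae_eq_integral_abs _ mB mt); rewrite -{}[RHS]B0.
  apply: ae_eq_integral => //; first exact: measurableT_comp.
  by apply: filterS terminal_density_gt0 => x /(_ g) t0 _; rewrite /= gtr0_norm.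
move=> B0'; apply: filterS2 B0' terminal_density_gt0 => y By /(_ g) t0.
apply: contrapT => /By[] ty; by rewrite ty ltxx in t0.
Qed.

(** The map is [S = tau * grad psi]. Since [u = expR (psi - |.|^2 / (2 * tau) - V)] almost
    everywhere, differentiating gives the equation. *)
Lemma transport_map g : (0 < d)%N -> (forall x, differentiable (V^~ g) x) ->
  exists S Df : 'rV[R]_d -> 'rV[R]_d, [/\ measurable_fun setT S,
    (forall B : set ('rV[R]_d * 'rV[R]_d), measurable B ->
       gamma g B = (\int[L]_(y in [set y | B (S y, y)]) (terminal_density g y)%:E)%E),
    ae_gradient (u^~ g) Df &
    {ae L, forall y, (u y g / tau) *: (S y - y) = Df y + u y g *: grad (V^~ g) y}].
Proof.
move=> d0 dV; have [psi [psis psiE contactE]] := potential g.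
(* One-sided derivatives define [S] at every point and make it measurable, also where [psi] has a
   corner. *)
pose S y : 'rV[R]_d := \row_i (tau * dir_deriv psi (delta_mx ord0 i) y).
have mS : measurable_fun setT S.
  apply: measurable_row => i; under eq_fun do rewrite mxE.
  by apply: measurable_funM => //; exact: measurable_dir_deriv.
have corner : {ae L, forall y, forall i : 'I_d,
    dir_deriv psi (delta_mx ord0 i) y <= - dir_deriv psi (- delta_mx ord0 i) y}.
  apply: filter_forall => i; apply: negligibleS (affine_sup_corner_set psis i) => y /=.
  by move=> /negP; rewrite -ltNge.
(* Off the corners, the slope [p.1 / tau] of the touching affine function lies between equal left
   and right derivatives in each coordinate. *)
have graph : {ae gamma g, forall p, p.1 = S p.2}.
  have := negligible_snd g corner; move: contactE; apply: filterS2.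
  move=> p [r pr pE] pc; apply/rowP => i; rewrite mxE.
  have dN v : dotp (tau^-1 *: p.1) (- v) = - dotp (tau^-1 *: p.1) v.
    by rewrite -scaleN1r dotpZ mulN1r.
  have H1 := affine_sup_contact (delta_mx ord0 i) pr pE.
  have H2 := affine_sup_contact (- delta_mx ord0 i) pr pE.
  rewrite dN in H2; rewrite !dotp_delta mxE in H1 H2.
  have := pc i => H3.
  have -> : dir_deriv psi (delta_mx ord0 i) p.2 = tau^-1 * p.1 ord0 i.
    by apply/le_anti; rewrite H1 andbT (le_trans H3)// lerNl.
  by rewrite mulrA divff ?mul1r// lt0r_neq0.
(* The gradient is defined by the equation to be shown, which leaves the proof that it is the
   gradient of a representative of [u]. *)
exists S, (fun y => (u y g / tau) *: (S y - y) - u y g *: grad (V^~ g) y); split => //.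
- move=> B mB.
  have mSB : measurable [set y | B (S y, y)].
    rewrite -[X in measurable X]setTI.
    by apply: (measurable_fun_pair mS (@measurable_id _ _ setT)).
  have mT : measurable (setT `*` [set y | B (S y, y)] : set ('rV[R]_d * 'rV[R]_d)).
    exact: measurableX.
  rewrite -terminal_densityE//; apply/le_anti/andP; split.
  + by apply: (gamma_le mB mT graph) => -[x y] /contrapT /= -> ByS.
  + by apply: (gamma_le mT mB graph) => -[x y] /contrapT /= -> [].
- exists (fun y => expR (psi y - (2 * tau)^-1 * sqnorm y - V y g)); split.
    apply: filterS2 psiE u_pos => y -> /(_ g) uy.
    rewrite addrK expRD lnK ?posrE; last by rewrite w_gt0.
    by rewrite /w -mulrA -expRD subrr expR0 mulr1.
  apply: filterS3 psiE corner u_pos => y psiy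
    /(affine_sup_differentiable psis d0)[dpsi pE] /(_ g) uy.
  pose k : 'rV[R]_d -> R := psi - (2 * tau)^-1 *: @sqnorm R d - V^~ g.
  have ds : differentiable ((2 * tau)^-1 *: @sqnorm R d) y.
    by apply: differentiableZ; exact: differentiable_sqnorm.
  have dps : differentiable (psi - (2 * tau)^-1 *: @sqnorm R d) y by exact: differentiableB.
  have dk : differentiable k y by exact: differentiableB.
  have ky : expR (k y) = u y g.
    rewrite /k !fctE psiy -[_ *: _]/(_ * _) addrK expRD lnK ?posrE; last by rewrite w_gt0.
    by rewrite /w -mulrA -expRD subrr expR0 mulr1.
  have [i0 _] : exists i : 'I_d, True by exists (Ordinal d0).
  have -> : (fun y => expR (psi y - (2 * tau)^-1 * sqnorm y - V y g)) = expR \o k by [].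
  split; first by have [] := pderiv_expR i0 dk.
  apply/rowP => i; rewrite !mxE; have [_ ->] := pderiv_expR i dk.
  rewrite ky /pderiv /k deriveB; [|exact: diff_derivable..].
  rewrite deriveB; [|exact: diff_derivable..].
  rewrite deriveZ; last exact/diff_derivable/differentiable_sqnorm.
  have := pE i; have := @pderiv_sqnorm R d i y; rewrite /pderiv => -> ->.
  by rewrite -[_ *: _]/(_ * _); field; rewrite lt0r_neq0.
- by apply/aeW => y; rewrite subrK.
Qed.

(** Replacing one plan by another with the same marginals keeps the pair admissible, and the
    remaining cost [Q] is finite, so it cancels. *)
Lemma optimal_plan_opt g : optimal_plan tau (gamma g).
Proof.
move=> pi' m1 m2; pose gamma' a := if a == g then pi' else gamma a.
have [H1 H2 H3 H4 H5] : ADM K W tau mu mu_tau gamma h by case: opt_h.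
have adm : ADM K W tau mu mu_tau gamma' h.
  split => // a A mA; rewrite /gamma'; case: eqVneq => [->|_].
  - by rewrite m1// H1.
  - exact: H1.
  - by rewrite m2// H5.
  - exact: H5.
pose Q := (\sum_(i | i != g) quadratic_cost tau (gamma i) + (tau / 4)%:E * jump_energy K W h)%E.
have cE : cost K W tau gamma h = (quadratic_cost tau (gamma g) + Q)%E.
  by rewrite /cost (bigD1 g)// addeA.
have cE' : cost K W tau gamma' h = (quadratic_cost tau pi' + Q)%E.
  rewrite /cost (bigD1 g)// /Q addeA [gamma' g]/gamma' eqxx; congr (_ + _ + _)%E.
  by apply: eq_bigr => i /andP[_ /negbTE ig]; rewrite /gamma' ig.
have Qfin : Q \is a fin_num by move: Tfin; rewrite cE fin_numD => /andP[].
rewrite -(leeD2rE _ _ Qfin) -cE -cE'.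
have [_ _ ->] := opt_h; apply: ereal_inf_lbound; by exists gamma', h.
Qed.

End competitors.

(** * Finite entropy of the minimizer, and the theorem *)

Lemma transport_cost_refl (R : realType) (G : finPointedType) (K : G -> G -> R) d
    (W : 'rV[R]_d -> R) (tau : R) (mu : probability ('rV[R]_d * discrete_space G)%type R)
    (f : 'rV[R]_d -> G -> R) : 0 < tau -> is_density mu f ->
  (transport_cost K W tau mu mu <= 0)%E.
Proof.
move=> tau_gt0 [mf f0 fE].
have /choice[nu nuE] : forall g, exists nu : {measure set 'rV[R]_d -> \bar R},
    forall A, measurable A -> nu A = slice mu g A.
  move=> g; have [nu nuE] := density_measure (lebesgue_rV d) (mf g) (f0^~ g).
  by exists nu => A mA; rewrite nuE// fE.
have mdiag : measurable_fun setT (fun x : 'rV[R]_d => (x, x)).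
  by apply: measurable_fun_pair; exact: measurable_id.
pose gamma : plans := fun g =>
  measure_function_pushforward__canonical__measure_function_Measure (nu g) mdiag.
have energy0 : jump_energy K W (fun _ _ _ => 0) = 0%E.
  rewrite /jump_energy big1// => g _; rewrite big1// => g' _.
  by rewrite integral0_eq// => x _; rewrite expr0n/= !mul0r.
have plan0 g : quadratic_cost tau (gamma g) = 0%E.
  rewrite /quadratic_cost [LHS]ge0_integral_pushforward//.
  - apply: integral0_eq => x _ /=.
    by rewrite subrr /sqnorm big1 ?mulr0// => i _; rewrite mxE expr0n.
  - by apply/measurable_EFinP; apply: measurable_funM => //; exact: measurable_sqnormB.
  - by move=> p _; rewrite lee_fin mulr_ge0 ?sqnorm_ge0// invr_ge0 mulr_ge0// ltW.
apply: ereal_inf_lbound; exists gamma, (fun _ _ _ => 0); split.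
  split => //.
  - by move=> g A mA; rewrite /gamma/= /pushforward -nuE//; congr (nu g _);
      apply/seteqP; split => x //= [].
  - by move=> *; rewrite oppr0.
  - by rewrite energy0.
  - move=> g A mA; rewrite big1 => [|g' _]; last first.
      by rewrite integral0_eq// => x _; rewrite !mul0r.
    rewrite mule0 sube0 /gamma/= /pushforward -nuE//; congr (nu g _).
    by apply/seteqP; split => x //= [].
by rewrite /cost big1 ?energy0 ?mule0 ?adde0// => g _.
Qed.

(** Comparison with the competitor [mu], which is reached from itself at no cost by the diagonal
    plan without jumps. *)
Lemma JKO_entropy_lty (R : realType) (G : finPointedType) (K : G -> G -> R) d
    V (W : 'rV[R]_d -> R) (tau : R) (mu mu_tau : probability ('rV[R]_d * discrete_space G)%type R)
    (f : 'rV[R]_d -> G -> R) : 0 < tau -> is_density mu f -> finite_second_moment mu ->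
  (entropy V mu < +oo)%E -> JKO_minimizer K V W tau mu mu_tau ->
  transport_cost K W tau mu mu_tau \is a fin_num -> (entropy V mu_tau < +oo)%E.
Proof.
move=> tau_gt0 df mom elt [_ /(_ mu mom) le1] Tfin; rewrite -(fineK Tfin) in le1.
have : (entropy V mu_tau + (fine (transport_cost K W tau mu mu_tau))%:E < +oo)%E.
  apply: le_lt_trans le1 _; apply: le_lt_trans (_ : entropy V mu + 0 < _)%E.
    by rewrite leeD2l// (transport_cost_refl _ _ tau_gt0 df).
  by rewrite adde0.
by case: (entropy V mu_tau) => [r _||_]; rewrite ?ltry ?ltNyr.
Qed.

Theorem proposition5p6 (R : realType) (G : finPointedType) (K : G -> G -> R)
    (K_ge0 : forall g g', 0 <= K g g')
    (K_sym : forall g g', K g g' = K g' g)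
    (K_connected : forall g g', connect (fun a b => 0 < K a b) g g')
    (lam Lam lam' Lam' : R)
    (lam_gt0 : 0 < lam) (Lam_gt0 : 0 < Lam)
    (lam'_gt0 : 0 < lam') (Lam'_gt0 : 0 < Lam') :
  exists tau0 : R, 0 < tau0 < 2^-1 /\
  forall (d : nat) (V : 'rV[R]_d -> G -> R) (W : 'rV[R]_d -> R),
  (0 < d)%N ->
  (forall g x, differentiable (V^~ g) x) ->
  W12loc W ->
  (\int[lebesgue_rV d]_x (sqnorm x * expR (- W x))%:E < +oo)%E ->
  (forall x g, lam' * expR (- W x) <= expR (- V x g) <= Lam' * expR (- W x)) ->
  forall tau : R, 0 < tau < tau0 ->
  forall (mu : probability ('rV[R]_d * discrete_space G)%type R)
    (f : 'rV[R]_d -> G -> R),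
  finite_second_moment mu ->
  (entropy V mu < +oo)%E ->
  is_density mu f ->
  {ae lebesgue_rV d, forall x, forall g,
     lam * expR (- V x g) <= f x g <= Lam * expR (- V x g)} ->
  forall (mu_tau : probability ('rV[R]_d * discrete_space G)%type R)
    (f_tau : 'rV[R]_d -> G -> R),
  JKO_minimizer K V W tau mu mu_tau ->
  is_density mu_tau f_tau ->
  forall (gamma : plans) (h : jumps),
  Opt K W tau mu mu_tau gamma h ->
  (forall g : G, optimal_plan tau (gamma g) /\
     exists S Df : 'rV[R]_d -> 'rV[R]_d,
     [/\ measurable_fun setT S,
         (forall B : set ('rV[R]_d * 'rV[R]_d), measurable B ->
            (gamma g B = \int[lebesgue_rV d]_(y in [set y | B (S y, y)])
              (f_tau y g +
               tau * \sum_(g' : G) h g g' y * K g g' * expR (- W y))%:E)%E),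
         ae_gradient (f_tau^~ g) Df &
         {ae lebesgue_rV d, forall y,
            (f_tau y g / tau) *: (S y - y) =
            Df y + f_tau y g *: grad (V^~ g) y}]) /\
  (forall g g' : G, 0 < K g g' ->
     {ae lebesgue_rV d, forall x,
        [/\ 0 < f_tau x g, 0 < f_tau x g' &
            h g g' x =
            ln (f_tau x g) + V x g - ln (f_tau x g') - V x g']}).
Proof.
pose C0 := `|ln Lam - ln lam| * (\sum_g \sum_g' K g g') / (lam * lam').
have C0_ge0 : 0 <= C0.
  rewrite divr_ge0 ?(ltW (mulr_gt0 lam_gt0 lam'_gt0))// mulr_ge0//.
  by apply: sumr_ge0 => g _; apply: sumr_ge0.
have C1 : 0 < 4 * (1 + C0) by lra.
(* The factor 4 keeps the threshold below [1 / 2], and [1 + C0] gives [tau * C0 < 1] even if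
   [C0 = 0]. *)
exists (4 * (1 + C0))^-1; split.
  by rewrite invr_gt0 C1 ltf_pV2 ?posrE//; lra.
move=> d V W d_gt0 dV W12 momW VW tau /andP[tau_gt0 tau_lt] mu f mom elt df fb
  mu_tau u min du gamma h opt.
have tau_small : tau * C0 < 1.
  move: tau_lt; rewrite -[_^-1]mul1r ltr_pdivlMr//; nra.
have mV g : measurable_fun setT (V^~ g).
  by apply: measurable_cont_rV => x; apply: differentiable_continuous.
have mW : measurable_fun setT W by case: W12 => -[].
have WV x g : lam' * expR (- W x) <= expR (- V x g) by case/andP: (VW x g).
have {}VW x g : expR (- V x g) <= Lam' * expR (- W x) by case/andP: (VW x g).
have mexpW : measurable_fun setT (fun x => expR (- W x)).
  by apply: measurableT_comp => //; exact: measurable_funN.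
(* Integrability of [expR (- W)] comes from [mu]: almost everywhere [lam * lam' * expR (- W)] is at
   most the density [f] at any node. *)
have iW : (lebesgue_rV d).-integrable setT (fun x => (expR (- W x))%:E).
  pose g : G := point.
  have /integrableP[_ fin] := integrableZl measurableT (lam * lam')^-1 (density_integrable g df).
  have [mf f0 _] := df.
  apply/integrableP; split; first exact/measurable_EFinP.
  apply: le_lt_trans fin; apply: ae_ge0_le_integral => //.
  - by apply: measurableT_comp => //; exact/measurable_EFinP.
  - apply: measurableT_comp => //; apply: measurable_funeM; exact/measurable_EFinP.
  apply: filterS fb => x /(_ g)/andP[fx _] _ /=; rewrite lee_fin !ger0_norm ?expR_ge0//.
    rewrite ler_pdivlMl ?mulr_gt0//; apply: le_trans fx.
    by rewrite -mulrA ler_wpM2l ?(ltW lam_gt0).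
  by rewrite mulr_ge0// invr_ge0 mulr_ge0// ltW.
have elt' : (entropy V mu_tau < +oo)%E.
  by case: (opt) => Tfin _ _; exact: JKO_entropy_lty tau_gt0 df mom elt min Tfin.
split.
  move=> g; split; first exact: optimal_plan_opt opt _.
  exact: (transport_map K_ge0 K_sym mV mW lam'_gt0 WV VW momW iW tau_gt0 min du
    opt elt' K_connected lam_gt0 Lam_gt0 df fb tau_small d_gt0 (dV g)).
move=> g g' Kgg'.
have up := u_pos K_ge0 K_sym mV mW lam'_gt0 WV VW momW iW tau_gt0 min du
  opt elt' K_connected lam_gt0 df fb.
have hx := jump_formula K_ge0 K_sym mV mW lam'_gt0 WV VW momW iW tau_gt0 min du
  opt elt' K_connected lam_gt0 df fb.
apply: filterS2 up hx => x up /(_ g g' Kgg') ->; split => //.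
by rewrite !lnM ?posrE ?expR_gt0// !expRK opprD addrA.
Qed.
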